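(* (i) Let $\{Z(t):t\ge0\}$ be the process on $\Omega$ generated by $L$ and suppose that $E[|Z(0)|^k]<\infty$ for all $k\in\mathbb N$. For each $t\ge0$ and $k\in\mathbb N$ denote by $r_k(t,d\mathbf z_k)$ the $k$th correlation measure of $\Xi(Z(t))$. Then $\{r_k(t,d\mathbf z_k):t\ge0,k\in\mathbb N\}$ is admissible and is a weak solution of the hierarchical coagulation-fragmentation equation with kernels $K(x,y)=xy\widehat H(x,y)$ and $F(x,y)=(x+y)\check H(x,y)$. (ii) Let $\widehat Q$ and $\check Q$ be symmetric, nonnegative bounded measurable functions on $\{(x,y):x,y>0,\ x+y\le1\}$ and set $K_1(x,y)=xy\,\widehat Q(x,y)$ and $F_1(x,y)=(x+y)\check Q(x,y)$. Let $\{X(t):t\ge0\}$ be the process on $\Omega_1$ generated by $$L_1^\sharp\Phi(\mathbf x)=\frac12\sum_{i\ne j}K_1(x_i,x_j)\left(\Phi(M_{ij}\mathbf x)-\Phi(\mathbf x)\right)+\frac12\sum_i x_i\int_0^1 du\,F_1(ux_i,(1-u)x_i)\left(\Phi(S_i^u\mathbf x)-\Phi(\mathbf x)\right).$$ For each $t\ge0$ and $k\in\mathbb N$ denote by $q_k(t,d\mathbf x_k)$ the $k$th correlation measure of $\Xi(X(t))$. Then $\{q_k(t,d\mathbf x_k):t\ge0,k\in\mathbb N\}$ is admissible (with $\lambda=0$) and is a weak solution of the hierarchical coagulation-fragmentation equation with kernels $K_1$ and $F_1$ in place of $K$ and $F$.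
   Context: Rates: fix $\lambda\ge0$. $\widehat H,\check H:(0,\infty)^2\to[0,\infty)$ are symmetric, measurable, homogeneous of degree $\lambda$ ($H(ax,ay)=a^\lambda H(x,y)$ for $a,x,y>0$), with $\widehat C:=\sup_{0<u<1}\widehat H(u,1-u)\in(0,\infty)$ and $\check C:=\int_0^1\check H(u,1-u)\,du\in(0,\infty)$; $K(x,y)=xy\widehat H(x,y)$, $F(x,y)=(x+y)\check H(x,y)$. Spaces and processes: $\Omega=\{\mathbf z=(z_i)_{i\ge1}:z_1\ge z_2\ge\cdots\ge0,\ 0<\sum_iz_i<\infty\}$ (product topology), $|\mathbf z|=\sum_iz_i$, $\Omega_1=\{\mathbf z\in\Omega:|\mathbf z|=1\}$; $B(S)$ denotes bounded Borel functions on $S$. $M_{ij}\mathbf z$ is obtained from $\mathbf z$ by merging $z_i,z_j$ into $z_i+z_j$ and reordering decreasingly; $S_i^{(y)}\mathbf z$ by splitting $z_i$ into $y,z_i-y$ and reordering; $S_i^u\mathbf z=S_i^{(uz_i)}\mathbf z$. Sums over $i\ne j$ (resp. $i$) are over indices with $z_iz_j>0$ (resp. $z_i>0$). $$L\Phi(\mathbf z)=\frac12\sum_{i\neq j}K(z_i,z_j)(\Phi(M_{ij}\mathbf z)-\Phi(\mathbf z))+\frac12\sum_i\int_0^{z_i}dy\,F(y,z_i-y)(\Phi(S_i^{(y)}\mathbf z)-\Phi(\mathbf z)).$$ The operator $\widetilde L\Phi(\mathbf z)=|\mathbf z|^{-(2+\lambda)}L\Phi(\mathbf z)$ is bounded on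 $B(\Omega)$ and generates a Markov jump process $\widetilde Z(t)$ (semigroup $e^{t\widetilde L}$) preserving $|\cdot|$; the process generated by $L$ is $Z(t):=\widetilde Z(|\widetilde Z(0)|^{2+\lambda}t)$. $L_1^\sharp$ is bounded on $B(\Omega_1)$ and the process it generates is the Markov jump process with semigroup $e^{tL_1^\sharp}$. Correlation measures: $\Xi(\mathbf z)=\sum_i\mathbf 1_{\{z_i>0\}}\delta_{z_i}$; for a point process $\xi=\sum_i\delta_{Z_i}$ on $(0,\infty)$ the $k$th correlation measure is the mean measure on $(0,\infty)^k$ of $\xi^{[k]}=\sum_{i_1,\dots,i_k\text{ distinct}}\delta_{(Z_{i_1},\dots,Z_{i_k})}$. Admissibility: $B_{+,c}^k$ is the set of nonnegative bounded Borel functions on $(0,\infty)^k$ with compact support in $(0,\infty)^k$; $\mathbf z_k=(z_1,\dots,z_k)$; integrals without indicated domain are over $(0,\infty)^m$ for the appropriate $m$. A family of measures $\{c_k(t,d\mathbf z_k):t\ge0,k\in\mathbb N\}$ is admissible if: (A1) each $c_k(t,\cdot)$ is a locally finite measure on $(0,\infty)^k$; (A2) for any $f\in B_{+,c}^k$, $g\in B_{+,c}^{k-1}$ and $l\in\{1,\dots,k\}$ the following functions of $t$ are locally integrable on $[0,\infty)$: (i) $\int f(\mathbf z_k)c_k(t,d\mathbf z_k)$; (ii) $\int z_lz_{l+1}f(z_1,\dots,z_{l-1},z_l+z_{l+1},z_{l+2},\dots,z_{k+1})c_{k+1}(t,d\mathbf z_{k+1})$; (iii) $\int z_1(z_1^{1+\lambda}\vee1)c_1(t,dz_1)$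 if $k=1$, and $\int z_l(z_l^{1+\lambda}\vee1)g(z_1,\dots,z_{l-1},z_{l+1},\dots,z_k)c_k(t,d\mathbf z_k)$ if $k\ge2$. Weak solution: an admissible family is a weak solution of the hierarchical coagulation-fragmentation equation with kernels $K,F$ if for any $t>0$, $k\in\mathbb N$ and $f\in B_{+,c}^k$ \begin{align*} &\int f(\mathbf z_k)c_k(t,d\mathbf z_k)-\int f(\mathbf z_k)c_k(0,d\mathbf z_k)\\ &=\frac12\sum_{l=1}^k\int_0^tds\int K(z_l,z_{l+1})f({\rm Coag}_{l,l+1}\mathbf z_{k+1})c_{k+1}(s,d\mathbf z_{k+1})\\ &\quad-\frac12\sum_{l=1}^k\int_0^tds\int\int_0^{z_l}dy\,F(y,z_l-y)f(\mathbf z_k)c_k(s,d\mathbf z_k)\\ &\quad-\sum_{l=1}^k\int_0^tds\int K(z_l,z_{l+1})f(z_1,\dots,z_l,z_{l+2},\dots,z_{k+1})c_{k+1}(s,d\mathbf z_{k+1})\\ &\quad+\sum_{l=1}^k\int_0^tds\int\int_0^{z_l}dy\,F(y,z_l-y)f(z_1,\dots,z_{l-1},y,z_{l+1},\dots,z_k)c_k(s,d\mathbf z_k)\\ &\quad-\mathbf 1_{\{k\ge2\}}\sum_{1\le l<m\le k}\int_0^tds\int K(z_l,z_m)f(\mathbf z_k)c_k(s,d\mathbf z_k)\\ &\quad+\mathbf 1_{\{k\ge2\}}\sum_{1\le l<m\le k}\int_0^tds\int\int_0^{z_l}dy\,F(y,z_l-y)f({\rm Frag}^{(y)}_{l,m}\mathbf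 z_{k-1})c_{k-1}(s,d\mathbf z_{k-1}), \end{align*} where ${\rm Coag}_{l,l+1}\mathbf z_{k+1}=(z_1,\dots,z_{l-1},z_l+z_{l+1},z_{l+2},\dots,z_{k+1})$ and ${\rm Frag}^{(y)}_{l,m}\mathbf z_{k-1}=(z_1,\dots,z_{l-1},y,z_{l+1},\dots,z_{m-1},z_l-y,z_m,\dots,z_{k-1})$. In part (ii) of the claim the kernels $K_1,F_1$ are only evaluated on $\{x+y\le1\}$, since $q_k(t,\cdot)$ is carried by $\{x_1+\cdots+x_k\le1\}$. *)

(* Defs.v *)
From HB Require Import structures.
From mathcomp Require Import all_boot all_order all_algebra.
From mathcomp Require Import all_classical all_reals all_analysis.

Set Implicit Arguments.
Unset Strict Implicit.
Unset Printing Implicit Defensive.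

Import Order.TTheory GRing.Theory Num.Theory.
Import numFieldNormedType.Exports.

Local Open Scope classical_set_scope.
Local Open Scope ring_scope.

(* Indices are 0-based throughout: the terms of z : mseq R are z 0, z 1, ... and
   the coordinates of a k-tuple are numbered from 0 to k - 1. *)

(* Real sequences with the Borel sigma-algebra of the product topology; the state
   spaces below are subsets of this type, with the trace sigma-algebra. *)
Notation mseq R :=
  (g_sigma_algebraType (@open (prod_topology (fun _ : nat => R)))).

Definition mass_ereal (R : realType) (z : mseq R) : \bar R :=
  (\sum_(0 <= i <oo) (z i)%:E)%E.

Definition mass (R : realType) (z : mseq R) : R := fine (mass_ereal z).

Definition Omega (R : realType) : set (mseq R) :=
  [set z | [/\ nonincreasing_seq z, forall i, 0 <= z i &
              (0 < mass_ereal z < +oo)%E]].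

Definition Omega1 (R : realType) : set (mseq R) :=
  Omega (R := R) `&` [set z | mass z = 1].

(* Decreasing rearrangement of a nonnegative sequence tending to 0: the term of
   rank n is the least level s >= 0 which at most n of the terms exceed. *)
Definition rearr (R : realType) (w : nat -> R) : mseq R :=
  fun n => inf [set s : R | 0 <= s /\ ([set i | (s < w i)%R] #<= `I_n)%card].

Definition merge_at (R : realType) (i j : nat) (z : mseq R) : mseq R :=
  rearr (fun n => if n == i then z i + z j else if n == j then 0 else z n).

Definition split_at (R : realType) (i : nat) (y : R) (z : mseq R) : mseq R :=
  rearr (fun n => if n is m.+1 then (if m == i then z i - y else z m) else y).

Definition bounded_borel (R : realType) (S : set (mseq R)) (Phi : mseq R -> R) :
    Prop :=
  measurable_fun S Phi /\ exists M : R, forall z, S z -> `|Phi z| <= M.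

Definition coag_part (R : realType) (K : R -> R -> R) (Phi : mseq R -> R)
    (z : mseq R) : R :=
  limn (series (fun i => limn (series (fun j =>
    if (i != j) && (0 < z i * z j)
    then K (z i) (z j) * (Phi (merge_at i j z) - Phi z) else 0)))).

Definition gen_L (R : realType) (K F : R -> R -> R) (Phi : mseq R -> R)
    (z : mseq R) : R :=
  2^-1 * coag_part K Phi z +
  2^-1 * limn (series (fun i =>
    if 0 < z i then
      \int[@lebesgue_measure R]_(y in `]0, z i[)
        (F y (z i - y) * (Phi (split_at i y z) - Phi z))
    else 0)).

Definition gen_Ltilde (R : realType) (lambda : R) (K F : R -> R -> R)
    (Phi : mseq R -> R) (z : mseq R) : R :=
  mass z `^ (- (2 + lambda)) * gen_L K F Phi z.

Definition gen_L1 (R : realType) (K1 F1 : R -> R -> R) (Phi : mseq R -> R)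
    (x : mseq R) : R :=
  2^-1 * coag_part K1 Phi x +
  2^-1 * limn (series (fun i =>
    if 0 < x i then
      x i * \int[@lebesgue_measure R]_(u in `]0, 1[)
        (F1 (u * x i) ((1 - u) * x i) * (Phi (split_at i (u * x i) x) - Phi x))
    else 0)).

(* The semigroup exp (t A) of a bounded operator A, evaluated pointwise. *)
Definition exp_op (R : realType) (A : (mseq R -> R) -> (mseq R -> R)) (t : R)
    (Phi : mseq R -> R) (z : mseq R) : R :=
  limn (series (fun n => t ^+ n / n`!%:R * iter n A Phi z)).

Definition history (R : realType) (d : measure_display) (T : measurableType d)
    (X : R -> T -> mseq R) (s : R) : set (set T) :=
  <<s \bigcup_(u in `[0, s]) preimage_set_system setT (X u) measurable >>.

(* Right-continuous step function with finitely many jumps in bounded time. *)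
Definition step_path (R : realType) (x : R -> mseq R) : Prop :=
  exists tau : nat -> R,
    [/\ tau 0%N = 0, forall n, tau n < tau n.+1, tau n @[n --> \oo] --> +oo &
        forall n t, tau n <= t < tau n.+1 -> x t = x (tau n)].

(* The last clause is the Markov property
   E[Phi(X(s+t)) | history up to s] = (exp (t A) Phi)(X(s)). *)
Definition markov_jump_process (R : realType) (d : measure_display)
    (T : measurableType d) (P : probability T R) (S : set (mseq R))
    (A : (mseq R -> R) -> (mseq R -> R)) (X : R -> T -> mseq R) : Prop :=
  [/\ forall t, 0 <= t -> measurable_fun setT (X t),
      forall t w, 0 <= t -> S (X t w),
      forall w, step_path (fun t => X t w) &
      forall (s t : R) (Phi : mseq R -> R) (E : set T),
        0 <= s -> 0 <= t -> bounded_borel S Phi -> history X s E ->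
        (\int[P]_(w in E) (Phi (X (s + t) w))%:E =
         \int[P]_(w in E) (exp_op A t Phi (X s w))%:E)%E].

Definition generated_by_L (R : realType) (d : measure_display)
    (T : measurableType d) (P : probability T R) (lambda : R)
    (K F : R -> R -> R) (Z : R -> T -> mseq R) : Prop :=
  exists Zt : R -> T -> mseq R,
    markov_jump_process P (@Omega R) (gen_Ltilde lambda K F) Zt /\
    forall t w, 0 <= t -> Z t w = Zt (mass (Zt 0 w) `^ (2 + lambda) * t) w.

Definition rate_function (R : realType) (lambda : R) (H : R -> R -> R) : Prop :=
  [/\ forall x y, 0 < x -> 0 < y -> 0 <= H x y,
      forall x y, 0 < x -> 0 < y -> H x y = H y x,
      measurable_fun [set p : R * R | 0 < p.1 /\ 0 < p.2]
        (fun p : R * R => H p.1 p.2) &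
      forall a x y, 0 < a -> 0 < x -> 0 < y ->
        H (a * x) (a * y) = a `^ lambda * H x y].

Definition coag_rate_function (R : realType) (lambda : R) (H : R -> R -> R) :
    Prop :=
  let values := [set H u (1 - u) | u in `]0, 1[ ] in
  [/\ rate_function lambda H, has_ubound values & 0 < sup values].

Definition frag_rate_function (R : realType) (lambda : R) (H : R -> R -> R) :
    Prop :=
  rate_function lambda H /\
  (0 < \int[@lebesgue_measure R]_(u in `]0%R, 1%R[) (H u (1 - u)%R)%:E < +oo)%E.

Definition coag_kernel (R : realType) (H : R -> R -> R) (x y : R) : R :=
  x * y * H x y.

Definition frag_kernel (R : realType) (H : R -> R -> R) (x y : R) : R :=
  (x + y) * H x y.

Definition simplex2 (R : realType) : set (R * R) :=
  [set p | [/\ 0 < p.1, 0 < p.2 & p.1 + p.2 <= 1]].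

Definition bounded_rate (R : realType) (Q : R -> R -> R) : Prop :=
  [/\ forall x y, simplex2 (x, y) -> 0 <= Q x y,
      forall x y, simplex2 (x, y) -> Q x y = Q y x,
      measurable_fun (@simplex2 R) (fun p : R * R => Q p.1 p.2) &
      exists M : R, forall x y, simplex2 (x, y) -> Q x y <= M].

(* A function on simplex2 is given as R -> R -> R with irrelevant values outside
   of it; those are replaced by 0, so that the integrals over (0,oo)^k in the
   hierarchical equation only depend on the function on simplex2. *)
Definition ext_simplex2 (R : realType) (Q : R -> R -> R) (x y : R) : R :=
  if [&& 0 < x, 0 < y & x + y <= 1] then Q x y else 0.

(* A measure on (0,oo)^k is represented by a measure on R^k of which only the
   restriction to pos k is used. *)
Definition pos (R : realType) (k : nat) : set (k.-tuple R) :=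
  [set z | forall i, 0 < tnth z i].
Arguments pos {R} k.

Definition measure_family (R : realType) : Type :=
  R -> forall k : nat, {measure set (k.-tuple R) -> \bar R}.

Definition factorial_measure (R : realType) (k : nat) (z : mseq R)
    (A : set (k.-tuple R)) : \bar R :=
  (\esum_(i in [set i : k.-tuple nat | uniq i /\ all (fun n => 0 < z n)%R i])
     (\1_A [tuple of map z i])%:E)%E.

Definition is_correlation_measure (R : realType) (d : measure_display)
    (T : measurableType d) (P : probability T R) (X : T -> mseq R) (k : nat)
    (mu : {measure set (k.-tuple R) -> \bar R}) : Prop :=
  forall A, measurable A -> (mu A = \int[P]_w factorial_measure (X w) A)%E.

Definition compact_in_pos (R : realType) (k : nat) (C : set (k.-tuple R)) :
    Prop :=
  C `<=` pos k /\
  compact [set (tnth z : prod_topology (fun _ : 'I_k => R)) | z in C].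

(* B_{+,c}^k *)
Definition test_function (R : realType) (k : nat) (f : k.-tuple R -> R) : Prop :=
  [/\ measurable_fun (pos k) f,
      forall z, pos k z -> 0 <= f z,
      exists M : R, forall z, pos k z -> f z <= M &
      exists C, compact_in_pos C /\ forall z, pos k z -> ~ C z -> f z = 0].

Definition coag (R : realType) (k l : nat) (z : k.+1.-tuple R) : k.-tuple R :=
  [tuple (if (i < l)%N then z`_i else if i == l :> nat then z`_l + z`_l.+1
          else z`_i.+1) | i < k].

Definition drop_coord (R : realType) (k m l : nat) (z : m.-tuple R) :
    k.-tuple R :=
  [tuple (if (i < l)%N then z`_i else z`_i.+1) | i < k].

Definition replace_coord (R : realType) (k l : nat) (y : R) (z : k.-tuple R) :
    k.-tuple R :=
  [tuple (if i == l :> nat then y else z`_i) | i < k].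

(* In the weak formulation l < m < k. *)
Definition frag (R : realType) (k l m : nat) (y : R) (z : k.-1.-tuple R) :
    k.-tuple R :=
  [tuple (if i == l :> nat then y
          else if (i < m)%N then z`_i
          else if i == m :> nat then z`_l - y
          else z`_i.-1) | i < k].

Definition locally_integrable0 (R : realType) (h : R -> \bar R) : Prop :=
  forall t : R, 0 <= t -> (@lebesgue_measure R).-integrable `[0, t] h.

Definition admissible (R : realType) (lambda : R) (c : measure_family R) : Prop :=
  (forall (t : R) (k : nat) (C : set (k.-tuple R)), 0 <= t -> (0 < k)%N ->
     measurable C -> compact_in_pos C -> (c t k C < +oo)%E) /\
  (forall (k : nat) (f : k.-tuple R -> R) (g : k.-1.-tuple R -> R) (l : nat),
     (0 < k)%N -> test_function f -> test_function g -> (l < k)%N ->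
     [/\ locally_integrable0 (fun t => \int[c t k]_(z in pos k) (f z)%:E)%E,
         locally_integrable0 (fun t => \int[c t k.+1]_(z in pos k.+1)
           (z`_l * z`_l.+1 * f (coag l z))%:E)%E &
         locally_integrable0 (fun t => \int[c t k]_(z in pos k)
           (z`_l * Num.max (z`_l `^ (1 + lambda)) 1 *
            (if k == 1%N then 1 else g (drop_coord k.-1 l z)))%:E)%E]).

Definition weak_solution (R : realType) (K F : R -> R -> R)
    (c : measure_family R) : Prop :=
  forall (t : R) (k : nat) (f : k.-tuple R -> R),
  0 < t -> (0 < k)%N -> test_function f ->
  let mu := @lebesgue_measure R in
  (\int[c t k]_(z in pos k) (f z)%:E - \int[c 0%R k]_(z in pos k) (f z)%:E =
   2^-1%:E * (\sum_(l < k) \int[mu]_(s in `[0%R, t])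
     \int[c s k.+1]_(z in pos k.+1) (K z`_l z`_l.+1 * f (coag l z))%:E)
   - 2^-1%:E * (\sum_(l < k) \int[mu]_(s in `[0%R, t])
     \int[c s k]_(z in pos k) \int[mu]_(y in `]0%R, z`_l[)
       (F y (z`_l - y)%R * f z)%:E)
   - (\sum_(l < k) \int[mu]_(s in `[0%R, t])
     \int[c s k.+1]_(z in pos k.+1)
       (K z`_l z`_l.+1 * f (drop_coord k l.+1 z))%:E)
   + (\sum_(l < k) \int[mu]_(s in `[0%R, t])
     \int[c s k]_(z in pos k) \int[mu]_(y in `]0%R, z`_l[)
       (F y (z`_l - y)%R * f (replace_coord l y z))%:E)
   - (if (2 <= k)%N then
       \sum_(l < k) \sum_(m < k | (l < m)%N) \int[mu]_(s in `[0%R, t])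
         \int[c s k]_(z in pos k) (K z`_l z`_m * f z)%:E
      else 0)
   + (if (2 <= k)%N then
       \sum_(l < k) \sum_(m < k | (l < m)%N) \int[mu]_(s in `[0%R, t])
         \int[c s k.-1]_(z in pos k.-1) \int[mu]_(y in `]0%R, z`_l[)
           (F y (z`_l - y)%R * f (frag l m y z))%:E
      else 0))%E.

(* Main.v *)
(* A bounded function Phi supported in {|z| <= N} satisfies
   E[Phi(Z(t))] = E[(exp(tL) Phi)(Z(0))].  For the process of (i) this comes from
   the Markov property of the time-changed process, with the random time
   |Z(0)|^(2+lambda) t approximated from the right on a grid: the jumps preserve the
   mass, so exp(m^(2+lambda) t Ltilde) = exp(tL) on {|z| = m}.  For the process of
   (ii) the substitution y = u x_i turns L_1^# into L on {|x| = 1}.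
   Differentiating the exponential series gives Dynkin's formula, and truncating the
   mass extends it to functions bounded by a power of 1 + |z|, the moments of the
   mass being conserved.

   Dynkin's formula is applied to Phi(z) = sum of f(z_{i_1}, ..., z_{i_k}) over
   tuples of distinct indices.  A merger of z_i and z_j, or a splitting of z_i,
   changes only the tuples through i or j; sorting these by the positions of i and j
   yields the terms of the hierarchical equation.  Since f vanishes near the boundary
   of (0,oo)^k it is at most a constant times the product of its arguments, and the
   sum of z_{i_1} ... z_{i_k} over distinct indices is at most |z|^k; the terms of
   the equation, in which K or F supplies the factors that f does not control, are
   bounded in the same way, so all of them are integrable. *)

Require Import Defs.
From HB Require Import structures.
From mathcomp Require Import all_boot all_order all_algebra.
From mathcomp Require Import all_classical all_reals all_analysis.
From mathcomp Require Import measurable_realfun.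
From mathcomp Require Import finmap zify lra.

Set Implicit Arguments.
Unset Strict Implicit.
Unset Printing Implicit Defensive.

Import Order.TTheory GRing.Theory Num.Theory.
Import numFieldNormedType.Exports.

Local Open Scope classical_set_scope.
Local Open Scope ring_scope.

(** * Sums over injective index sequences *)

Section insert.
Variable T : Type.
Implicit Types (s : seq T) (x : T).

Definition ins (m : nat) (x : T) (s : seq T) : seq T :=
  take m s ++ x :: drop m s.

Lemma size_ins m x s : size (ins m x s) = (size s).+1.
Proof. by rewrite size_cat /= addnS -size_cat cat_take_drop. Qed.

Lemma nth_ins x0 m x s i : (m <= size s)%N ->
  nth x0 (ins m x s) i =
  if (i < m)%N then nth x0 s i else if i == m then x else nth x0 s i.-1.
Proof.
move=> ms; rewrite nth_cat size_takel//; case: ltnP => [im|mi].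
  by rewrite nth_take.
rewrite leq_eqVlt in mi; case/orP: mi => [/eqP<-|mi].
  by rewrite subnn eqxx.
rewrite gtn_eqF// -(subnSK mi)/= nth_drop; congr nth; lia.
Qed.

Lemma drop_take_ins m x s : (m <= size s)%N ->
  take m (ins m x s) ++ drop m.+1 (ins m x s) = s.
Proof.
move=> ms; rewrite /ins take_size_cat ?size_takel//.
by rewrite drop_cat size_takel// ltnNge leqnSn/= subSnn/= drop0 cat_take_drop.
Qed.

End insert.

Lemma map_ins (T U : Type) (g : T -> U) m x s :
  map g (ins m x s) = ins m (g x) (map g s).
Proof. by rewrite map_cat/= map_take map_drop. Qed.

Lemma perm_ins (T : eqType) m (x : T) s : perm_eq (ins m x s) (x :: s).
Proof.
by rewrite /ins -cat1s perm_catCA/= perm_cons cat_take_drop.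
Qed.

Lemma mem_ins (T : eqType) m (x : T) s : ins m x s =i x :: s.
Proof. exact/perm_mem/perm_ins. Qed.

Lemma ins_take_drop (T : Type) (x0 : T) m (s : seq T) : (m < size s)%N ->
  ins m (nth x0 s m) (take m s ++ drop m.+1 s) = s.
Proof.
move=> ms; rewrite /ins take_size_cat ?size_takel 1?ltnW//.
rewrite drop_size_cat ?size_takel 1?ltnW//.
by rewrite -drop_nth// cat_take_drop.
Qed.

Section index_sums.
Context {R : realType}.
Implicit Types (z : nat -> R) (G : seq nat -> \bar R).
Local Open Scope ereal_scope.

Definition supp z : set nat := [set j | (0 < z j)%R].

Definition idx (k : nat) z : set (seq nat) :=
  [set s | [/\ size s = k, uniq s & {in s, forall n, (0 < z n)%R}]].

Definition idxN (k : nat) z (j : nat) : set (seq nat) :=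
  idx k z `&` [set s : seq nat | j \notin s].

Lemma idx0 z : idx 0 z = [set [::]].
Proof.
apply/seteqP; split => [s [/size0nil//]|s ->]; split => //.
Qed.

Lemma esumZl (I : choiceType) (A : set I) (c : R) (F : I -> \bar R) :
  (0 <= c)%R -> (forall i, 0 <= F i) ->
  \esum_(i in A) (c%:E * F i) = c%:E * \esum_(i in A) F i.
Proof.
have le (b : R) (H : I -> \bar R) : (0 <= b)%R -> (forall i, 0 <= H i) ->
    \esum_(i in A) (b%:E * H i) <= b%:E * \esum_(i in A) H i.
  move=> b0 H0; apply: ge_ereal_sup => _ [X [finX XB] <-].
  rewrite -ge0_mule_fsumr// lee_wpmul2l ?lee_fin//.
  by apply: ereal_sup_ubound; exists X.
rewrite le_eqVlt => /orP[/eqP<- F0|c0 F0].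
  by rewrite mul0e esum1// => i _; rewrite mul0e.
apply/eqP; rewrite eq_le le ?(ltW c0)//=.
rewrite -lee_pdivlMl// -[leLHS](_ : \esum_(i in A) (c^-1%:E * (c%:E * F i)) = _).
  by apply: le => [|i]; rewrite ?invr_ge0 ?mule_ge0// ?lee_fin ltW.
by apply: eq_esum => i _; rewrite muleA -EFinM mulVf ?gt_eqF// mul1e.
Qed.

Lemma esum_single (I : choiceType) (A : set I) i0 (F : I -> \bar R) :
  A i0 -> 0 <= F i0 -> (forall i, A i -> i != i0 -> F i = 0) ->
  \esum_(i in A) F i = F i0.
Proof.
move=> Ai0 F0 Fi; rewrite (esumID [set i0]); last first.
  by move=> i Ai; have [->//|/(Fi _ Ai)->] := eqVneq i i0.
rewrite (_ : A `&` [set i0] = [set i0]) ?esum_set1//; last first.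
  by apply/seteqP; split => [i []//|_ ->].
by rewrite esum1 ?adde0// => i [Ai /eqP ii0]; rewrite Fi.
Qed.

Lemma esum_ins k z m G : (m <= k)%N -> (forall s, 0 <= G s) ->
  \esum_(s in idx k.+1 z) G s =
  \esum_(j in supp z) \esum_(s in idxN k z j) G (ins m j s).
Proof.
move=> mk G0; rewrite esum_esum//.
apply: (@reindex_esum _ _ _ _ _ (fun js => ins m js.1 js.2)); split.
- move=> [j s] /= [zj [[sk us zs] /= js]]; split.
  + by rewrite size_ins sk.
  + by rewrite (perm_uniq (perm_ins _ _ _))/= js.
  + by move=> n; rewrite mem_ins inE => /orP[/eqP->|/zs].
- move=> [j s] [j' s'] /set_mem /= [zj [[sk us zs] /= js]].
  move=> /set_mem/= [zj' [[sk' us' zs'] /= js']] E.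
  have ms : (m <= size s)%N by rewrite sk.
  have ms' : (m <= size s')%N by rewrite sk'.
  congr pair.
    have := congr1 (fun s => nth 0%N s m) E.
    by rewrite !nth_ins// !ltnn !eqxx.
  by rewrite -(drop_take_ins j ms) E drop_take_ins.
- move=> s /= [sk us zs]; have ms : (m < size s)%N by rewrite sk ltnS.
  have E := ins_take_drop 0%N ms.
  exists (nth 0%N s m, take m s ++ drop m.+1 s) => //=; split.
    by apply: zs; rewrite mem_nth.
  have [P1 P2] : uniq (nth 0%N s m :: take m s ++ drop m.+1 s) /\
                 s =i (nth 0%N s m :: take m s ++ drop m.+1 s).
    split; first by rewrite -(perm_uniq (perm_ins m _ _)) E.
    by rewrite -{1}E; exact: mem_ins.
  move: P1 => /= /andP[P3 P1]; split => //; split => //.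
    by apply/eqP; rewrite -eqSS -(size_ins m (nth 0%N s m)) E sk.
  by move=> n ns; apply: zs; rewrite P2 inE ns orbT.
Qed.

Lemma sum_nth_uniq (V : nmodType) (s : seq nat) j (a : V) : uniq s ->
  (\sum_(l < size s) (if nth 0%N s l == j then a else 0))%R =
  (if j \in s then a else 0)%R.
Proof.
move=> us; case: ifPn => js.
  have js' : (index j s < size s)%N by rewrite index_mem.
  rewrite (bigD1 (Ordinal js'))//= nth_index// eqxx big1 ?addr0// => i.
  rewrite -val_eqE/= => il; case: eqP => // E.
  by move: il; rewrite -E index_uniq// eqxx.
rewrite big1// => i _; case: eqP => // E.
by move: js; rewrite -E mem_nth.
Qed.

Lemma esum_split k z j G : (0 < z j)%R -> (forall s, 0 <= G s) ->
  \esum_(s in idx k.+1 z) G s =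
  \esum_(s in idxN k.+1 z j) G s +
  \sum_(m < k.+1) \esum_(s in idxN k z j) G (ins m j s).
Proof.
move=> zj G0.
rewrite (esumID [set s : seq nat | j \notin s])//; congr (_ + _).
transitivity (\esum_(s in idx k.+1 z) \sum_(m < k.+1)
    (if nth 0%N s m == j then G s else 0)).
  rewrite esum_mkcondr; apply: eq_esum => s [sk us zs].
  rewrite -sk sum_nth_uniq//; case: ifPn => [/set_mem/=|/negP].
    by move/negP; rewrite negbK => ->.
  case: ifP => // js; rewrite in_setE /=; case.
  by apply/negP; rewrite negbK.
rewrite esum_sum; last by move=> s m _ _; case: ifP.
apply: eq_bigr => m _.
rewrite (@esum_ins _ _ m); [|by rewrite -ltnS|by move=> s; case: ifP].
rewrite (@esum_single _ _ j)//=.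
- apply: eq_esum => s [[sk _ _] _].
  by rewrite nth_ins ?ltnn ?eqxx// sk -ltnS.
- by apply: esum_ge0 => s _; case: ifP.
- move=> i _ ij; apply: esum1 => s [[sk _ _] _].
  rewrite nth_ins ?ltnn ?eqxx ?(negbTE ij)// sk -ltnS//.
Qed.

Lemma esum_nth k z l (A : set (seq nat)) (G : nat -> seq nat -> \bar R) :
  (l < k)%N -> A `<=` idx k z -> (forall i s, 0 <= G i s) ->
  \esum_(i in supp z) \esum_(s in A) (if nth 0%N s l == i then G i s else 0) =
  \esum_(s in A) G (nth 0%N s l) s.
Proof.
move=> lk Ak G0; rewrite esum_esum; last by move=> i j _ _; case: ifP.
rewrite (_ : supp z `*`` _ = supp z `*` A)//.
rewrite (reindex_esum (A `*` supp z) _ (fun x => (x.2, x.1))); last first.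
  split.
  - by move=> [i j] [].
  - by move=> [i1 i2] [j1 j2] /= _ _ [] -> ->.
  - by move=> [i j] [? ?]; exists (j, i).
rewrite -(@esum_esum _ _ _ A (fun=> supp z)
  (fun s i => if nth 0%N s l == i then G i s else 0)); last first.
  by move=> i j _ _; case: ifP.
apply: eq_esum => s As; have [sk us zs] := Ak _ As.
have sz : supp z (nth 0%N s l) by apply: zs; rewrite mem_nth// sk.
rewrite (@esum_single _ _ (nth 0%N s l)) ?eqxx//.
by move=> i _; rewrite eq_sym => /negbTE ->.
Qed.

Lemma esum_subst_split k z w i (A : set (seq nat)) (h : seq R -> \bar R) :
  A `<=` idx k z -> (forall s n, A s -> n \in s -> n != i -> w n = z n) ->
  (forall x, 0 <= h x) ->
  \esum_(s in A) h (map w s) =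
  \esum_(s in A) (if i \in s then 0 else h (map z s)) +
    \sum_(l < k) \esum_(s in A)
      (if nth 0%N s l == i then h (set_nth 0%R (map z s) l (w i)) else 0).
Proof.
move=> Ak wz h0.
rewrite -!esum_sum; do ?by move=> s j _ _; case: ifP.
rewrite -!esumD; do ?by move=> s As; do ?[case: ifP => // _|rewrite sume_ge0// => ? _].
apply: eq_esum => s As; have [sk us zs] := Ak _ As; rewrite -sk.
case: ifPn => is_; last first.
  rewrite big1 => [|l _]; last first.
    by case: eqP => // E; move: is_; rewrite -E mem_nth.
  rewrite adde0; congr h; apply/eq_in_map => n ns; apply: (wz s) => //.
  by apply: contraNneq is_ => <-.
have is' : (index i s < size s)%N by rewrite index_mem.
rewrite add0e (bigD1 (Ordinal is'))//= nth_index// eqxx big1.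
  rewrite adde0; congr h.
  apply: (@eq_from_nth _ 0%R); first by rewrite size_set_nth !size_map; apply/esym/maxn_idPr.
  move=> n; rewrite size_map => ns.
  rewrite (nth_map 0%N)// nth_set_nth/= (nth_map 0%N)//.
  case: eqP => [->|ni]; first by rewrite nth_index.
  apply: (wz s); rewrite ?mem_nth//; apply: contra_notN ni => /eqP <-.
  by rewrite index_uniq.
move=> l; rewrite -val_eqE/= => il; case: eqP => // E.
by move: il; rewrite -E index_uniq// eqxx.
Qed.

Lemma esum_subst k z w i (A : set (seq nat)) (h : seq R -> \bar R) :
  A `<=` idx k z -> (forall s n, A s -> n \in s -> n != i -> w n = z n) ->
  (forall x, 0 <= h x) ->
  \esum_(s in A) h (map w s) +
    \sum_(l < k) \esum_(s in A) (if nth 0%N s l == i then h (map z s) else 0) =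
  \esum_(s in A) h (map z s) +
    \sum_(l < k) \esum_(s in A)
      (if nth 0%N s l == i then h (set_nth 0%R (map z s) l (w i)) else 0).
Proof.
move=> Ak wz h0; rewrite (esum_subst_split Ak wz h0).
rewrite (esum_subst_split (w := z) (i := i) Ak _ h0)// addeAC; congr (_ + _ + _).
apply: eq_bigr => l _; apply: eq_esum => s As; have [sk _ _] := Ak _ As.
case: eqP => // <-; congr h; apply: (@eq_from_nth _ 0%R).
  by rewrite size_set_nth size_map sk; apply/esym/maxn_idPr.
move=> n; rewrite size_map => ns; rewrite nth_set_nth/=.
by case: eqP => [->|//]; rewrite (nth_map 0%N)// sk.
Qed.

Lemma esum_idx_shift k w w' (h : seq R -> \bar R) :
  (forall n, w n.+1 = w' n) ->
  \esum_(s in idxN k w 0) h (map w s) = \esum_(s in idx k w') h (map w' s).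
Proof.
move=> ww'.
rewrite (@reindex_esum _ _ _ (idx k w') _ (map S)); last first.
  split.
  - move=> s [sk us zs]; split; last first.
      by apply/negP => /mapP[].
    split; [by rewrite size_map|by rewrite map_inj_uniq//; exact: succn_inj|].
    by move=> _ /mapP[n /zs zn ->]; rewrite ww'.
  - by move=> s t _ _; apply: inj_map; exact: succn_inj.
  - move=> s [[sk us zs] /= s0].
    have E : map S (map predn s) = s.
      rewrite -map_comp map_id_in// => n ns /=; rewrite prednK//.
      by rewrite lt0n; apply: contraNneq s0 => <-.
    exists (map predn s) => //; split; first by rewrite size_map.
      by rewrite -(map_inj_uniq succn_inj) E.
    move=> _ /mapP[n ns ->]; rewrite -ww' prednK ?zs//.
    by rewrite lt0n; apply: contraNneq s0 => <-.
apply: eq_esum => s _; congr h; rewrite -map_comp.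
by apply: eq_map => n /=; rewrite ww'.
Qed.

Lemma esum_supp z : (forall i, (0 <= z i)%R) ->
  \sum_(0 <= i <oo) (z i)%:E = \esum_(j in supp z) (z j)%:E.
Proof.
move=> z0; rewrite (@nneseries_esumT _ (fun i => (z i)%:E)); last first.
  by move=> n; rewrite lee_fin.
rewrite [RHS]esum_mkcond; apply: eq_esum => j _.
case: ifPn => // /negP zj; have {zj} : ~~ (0 < z j)%R.
  by apply/negP => ?; apply: zj; exact: mem_set.
by rewrite -leNgt => zj; congr EFin; apply/eqP; rewrite eq_le zj z0.
Qed.

Lemma esum_idx_prod_le k z m : (forall i, (0 <= z i)%R) ->
  \sum_(0 <= i <oo) (z i)%:E = m%:E ->
  \esum_(s in idx k z) (\prod_(n <- s) z n)%:E <= (m ^+ k)%:E.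
Proof.
move=> z0 zm.
have p0 s : 0 <= (\prod_(n <- s) z n)%:E by rewrite lee_fin prodr_ge0.
elim: k => [|k IH].
  by rewrite idx0 esum_set1 ?p0// big_nil expr0.
rewrite (@esum_ins _ _ 0)//.
have m0 : (0 <= m)%R.
  by rewrite -lee_fin -zm; apply: nneseries_ge0 => i _ _; rewrite lee_fin.
rewrite exprSr EFinM -zm esum_supp// -esumZl ?exprn_ge0//.
apply: le_esum => j zj; rewrite muleC.
apply: (@le_trans _ _ ((z j)%:E * \esum_(s in idx k z) (\prod_(n <- s) z n)%:E)).
  rewrite -esumZl// esum_mkcondr; apply: le_esum => s _.
  case: ifP => _; last by rewrite mule_ge0 ?p0 ?lee_fin.
  by rewrite /ins take0 drop0 /= big_cons EFinM.
by rewrite lee_wpmul2l ?lee_fin.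
Qed.

Lemma esum_swap (I J : choiceType) (A : set I) (B : set J) (a : I -> J -> \bar R) :
  (forall i j, 0 <= a i j) ->
  \esum_(i in A) \esum_(j in B) a i j = \esum_(j in B) \esum_(i in A) a i j.
Proof.
move=> a0; rewrite !esum_esum//.
rewrite (reindex_esum (B `*` A) _ (fun x => (x.2, x.1))); last first.
  split.
  - by move=> [i j] [].
  - by move=> [i1 i2] [j1 j2] /= _ _ [] -> ->.
  - by move=> [i j] [? ?]; exists (j, i).
by [].
Qed.

Definition remove_nth (T : Type) m (s : seq T) := take m s ++ drop m.+1 s.

Lemma remove_nth_ins (T : Type) m (x : T) s : (m <= size s)%N ->
  remove_nth m (ins m x s) = s.
Proof. exact: drop_take_ins. Qed.

(* A distinguished entry [i] at position [l] and a new index [j] form a longer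
   sequence with [i], [j] at the positions [l], [l.+1]. *)
Lemma esum_pair_adjacent k z l (H : nat -> nat -> seq nat -> \bar R) :
  (l < k)%N -> (forall i j s, 0 <= H i j s) ->
  \esum_(i in supp z) \esum_(j in supp z) (if i != j then
    \esum_(s in idxN k z j) (if nth 0%N s l == i then H i j s else 0) else 0) =
  \esum_(s in idx k.+1 z) H (nth 0%N s l) (nth 0%N s l.+1) (remove_nth l.+1 s).
Proof.
move=> lk H0; rewrite (@esum_ins _ _ l.+1)//.
rewrite esum_swap; last first.
  by move=> i j; case: ifP => // _; apply: esum_ge0 => s _; case: ifP.
apply: eq_esum => j zj.
transitivity (\esum_(i in supp z) \esum_(s in idxN k z j)
    (if nth 0%N s l == i then H i j s else 0)).
  apply: eq_esum => i zi; case: eqVneq => // ij.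
  apply/esym/esum1 => s [[sk _ _] /= js]; case: eqP => // E.
  by move: js; rewrite -ij -E mem_nth// sk.
rewrite (@esum_nth k)//; last by move=> s [].
apply: eq_esum => s [[sk _ _] js].
by rewrite !nth_ins ?sk// ltnSn ltnn eqxx remove_nth_ins ?sk.
Qed.

Lemma esum_pair_inserted k z m (H : nat -> nat -> seq nat -> \bar R) :
  (m <= k)%N -> (forall i j s, 0 <= H i j s) ->
  \esum_(i in supp z) \esum_(j in supp z) (if i != j then
    \esum_(s in idxN k z j) H i j (ins m j s) else 0) =
  \esum_(s in idx k.+2 z) H (nth 0%N s m.+1) (nth 0%N s m) (remove_nth m.+1 s) +
  \sum_(l < k.+1 | l != m :> nat) \esum_(s in idx k.+1 z)
    H (nth 0%N s l) (nth 0%N s m) s.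
Proof.
move=> mk H0.
transitivity (\esum_(s in idx k.+1 z) \esum_(i in supp z)
    (if i != nth 0%N s m then H i (nth 0%N s m) s else 0)).
  rewrite (@esum_ins _ _ m)//; last by move=> s; apply: esum_ge0 => i _; case: ifP.
  rewrite esum_swap; last first.
    by move=> i j; case: ifP => // _; apply: esum_ge0.
  apply: eq_esum => j zj.
  transitivity (\esum_(i in supp z) \esum_(s in idxN k z j)
      (if i != j then H i j (ins m j s) else 0)).
    by apply: eq_esum => i _; case: ifP => // _; rewrite esum1.
  rewrite esum_swap; last by move=> i s; case: ifP.
  apply: eq_esum => s [[sk _ _] js]; apply: eq_esum => i _.
  by rewrite !nth_ins ?sk// ltnn eqxx.
transitivity (\esum_(s in idx k.+1 z) (\esum_(i in supp z)
    (if i \notin s then H i (nth 0%N s m) s else 0) +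
    \sum_(l < k.+1 | l != m :> nat) H (nth 0%N s l) (nth 0%N s m) s)).
  apply: eq_esum => s [sk us zs].
  have ms : (m < size s)%N by rewrite sk ltnS.
  transitivity (\esum_(i in supp z) ((if i \notin s then H i (nth 0%N s m) s else 0) +
     \sum_(l < k.+1 | l != m :> nat)
       (if nth 0%N s l == i then H i (nth 0%N s m) s else 0))).
    apply: eq_esum => i zi; case: (boolP (i \in s)) => /= si; last first.
      rewrite big1 ?adde0; last first.
        move=> l _; case: eqP => // E; move: si.
        by rewrite -E mem_nth// sk.
      by case: eqVneq => // E; move: si; rewrite E mem_nth.
    rewrite add0e.
    have := sum_nth_uniq i (H i (nth 0%N s m) s : \bar R) us.
    rewrite si sk (bigD1 (Ordinal (mk : (m < k.+1)%N)))//= => E.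
    case: eqVneq => im /=.
      rewrite big1// => l lm; case: eqP => // E'; move: lm.
      have /eqP := E'; rewrite im nth_uniq ?sk// => /eqP ->.
      by rewrite eqxx.
    move: E; rewrite eq_sym (negbTE im) add0r => E; apply: (etrans (esym E)).
    by apply: eq_bigl => l; rewrite -val_eqE.
  rewrite esumD; last 2 first.
  - by move=> i _; case: ifP.
  - by move=> i _; apply: sume_ge0 => l _; case: ifP.
  congr (_ + _); rewrite esum_sum; last by move=> i l _ _; case: ifP.
  apply: eq_bigr => l _.
  rewrite (@esum_single _ _ (nth 0%N s l)) ?eqxx//.
    by apply: zs; rewrite mem_nth// sk.
  by move=> i _; rewrite eq_sym => /negbTE ->.
rewrite esumD; last 2 first.
- by move=> s _; apply: esum_ge0 => i _; case: ifP.
- by move=> s _; apply: sume_ge0 => l _.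
congr (_ + _); last by rewrite esum_sum.
rewrite [RHS](@esum_ins _ _ m.+1)// [LHS]esum_swap; last by move=> i s; case: ifP.
apply: eq_esum => i zi; rewrite [RHS]esum_mkcondr.
apply: eq_esum => s [sk _ _].
case: ifPn => si; last by rewrite memNset//= (negbTE si).
rewrite mem_set// !nth_ins ?sk// ltnSn ltnn eqxx remove_nth_ins ?sk//.
Qed.

End index_sums.

(** * Decreasing rearrangement *)

Lemma card_le_seqP (A : set nat) (n : nat) :
  (A #<= `I_n)%card <->
  ~ exists s : seq nat, [/\ uniq s, size s = n.+1 & {in s, forall i, A i}].
Proof.
split=> [An [s [us sn sA]]|nex].
  have : ([set` [fset x in s]%fset] #<= `I_n)%card.
    by apply: card_le_trans An; apply: subset_card_le => i /=; rewrite inE => /sA.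
  have /card_eq_fsetP E : #|` [fset x in s]%fset| = n.+1.
    by rewrite card_fseq undup_id.
  by rewrite (card_le_eql E) card_le_II ltnn.
suff H (X : {fset nat}) : [set` X] `<=` A -> (n < #|` X|)%N -> False.
  have [fA|] := pselect (finite_set A); last first.
    by case/(infinite_set_fset n.+1) => X XA nX; case: (H X XA nX).
  have [m Am] := (finite_setP _).1 fA; rewrite (card_le_eql Am) card_le_II.
  rewrite leqNgt; apply/negP => nm; apply: (H (fset_set A)).
    by rewrite fset_setK.
  by rewrite (card_fset_set Am).
move=> XA nX; apply: nex; exists (take n.+1 X); split.
- by apply: take_uniq; exact: fset_uniq.
- by rewrite size_takel.
- by move=> i /mem_take iX; apply: XA.
Qed.

Section rearrangement.
Context {R : realType}.
Implicit Types (w : nat -> R).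

Definition finite_levels w :=
  (forall i, 0 <= w i) /\ (forall s, 0 < s -> finite_set [set i | s <= w i]).

Definition before w j i := (w i < w j) || ((w i == w j) && (j < i)%N).

Definition rank w i : nat := #|` fset_set [set j | before w j i]|.

Lemma before_trans w : transitive (before w).
Proof.
move=> j i k; rewrite /before => /orP[ji|/andP[/eqP ji ij]] /orP[kj|/andP[/eqP kj jk]].
- by rewrite (lt_trans kj ji).
- by rewrite kj ji.
- by rewrite -ji kj.
- by rewrite kj ji eqxx (ltn_trans ij jk) orbT.
Qed.

Lemma before_irr w i : before w i i = false.
Proof. by rewrite /before ltxx eqxx ltnn. Qed.

Lemma before_total w i j : i != j -> before w i j || before w j i.
Proof.
rewrite /before; case: (ltgtP (w i) (w j)) => //= _.
by rewrite neq_ltn.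
Qed.

Section ranks.
Variable w : nat -> R.
Hypothesis fw : finite_levels w.

Lemma finite_before i : 0 < w i -> finite_set [set j | before w j i].
Proof.
move=> wi; apply: sub_finite_set (fw.2 _ wi) => j /= /orP[/ltW//|].
by case/andP => /eqP ->.
Qed.

Lemma mem_before i j : 0 < w i ->
  (j \in fset_set [set j | before w j i]) = before w j i.
Proof.
move=> wi; rewrite in_fset_set; last exact: finite_before.
by apply/idP/idP => [/set_mem//|/mem_set].
Qed.

Lemma rank_lt i j : 0 < w j -> before w i j -> (rank w i < rank w j)%N.
Proof.
move=> wj ij.
have wi : 0 < w i.
  by case/orP: ij => [/(lt_trans wj)//|/andP[/eqP <-]].
have -> : (rank w i).+1 = #|` (i |` fset_set [set j | before w j i])%fset|.
  by rewrite cardfsU1 mem_before// before_irr.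
apply: fsubset_leq_card; apply/fsubsetP => k.
rewrite in_fset1U !mem_before// => /orP[/eqP->//|ki].
exact: before_trans ij.
Qed.

Lemma rank_inj i j : 0 < w i -> 0 < w j -> rank w i = rank w j -> i = j.
Proof.
move=> wi wj rij; apply: contra_eq (rij) => /before_total.
by move=> /(_ w)/orP[/(rank_lt wj)|/(rank_lt wi)]; rewrite rij ltnn.
Qed.

Lemma card_before i : 0 < w i -> ([set j | before w j i] #= `I_(rank w i))%card.
Proof.
move=> wi; rewrite -[X in (X #= _)%card](fset_setK (finite_before wi)).
exact/card_eq_fsetP.
Qed.

Lemma rearr_rank i : 0 < w i -> rearr w (rank w i) = w i.
Proof.
move=> wi; have cB := card_before wi; rewrite /rearr; set S := [set s | _].
have wS : S (w i).
  split; first exact: ltW.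
  rewrite -(card_le_eqr cB); apply: subset_card_le => j /= wij.
  by rewrite /before wij.
have Sw : lbound S (w i).
  move=> s [s0 sS]; rewrite leNgt; apply/negP => swi.
  move/card_le_seqP: sS; apply.
  exists (i :: fset_set [set j | before w j i]); split => /=.
  - by rewrite fset_uniq andbT mem_before// before_irr.
  - by rewrite -/(rank w i).
  - move=> j; rewrite inE => /orP[/eqP->//|].
    rewrite mem_before// => /orP[/(lt_trans swi)//|/andP[/eqP E _]].
    by rewrite /= -E.
by apply/eqP; rewrite eq_le ge_inf ?lb_le_inf//; [exists (w i)|exists (w i)].
Qed.

Lemma rearr_levels_nonempty n :
  [set s : R | 0 <= s /\ ([set i | s < w i] #<= `I_n)%card] !=set0.
Proof.
have [w0 fw1] := fw.
have fX : finite_set [set i | 1 <= w i] by apply: fw1.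
pose X := fset_set [set i | 1 <= w i].
have S0 : 0 <= \sum_(i <- X) w i by exact: sumr_ge0.
exists (1 + \sum_(i <- X) w i); split; first by rewrite addr_ge0.
rewrite (_ : [set i | _] = set0) ?card_ge0// -subset0 => i /=.
apply/negP; rewrite -leNgt.
have [wi|/ltW wi] := leP 1 (w i); last by rewrite (le_trans wi)// lerDl.
have iX : i \in X by rewrite in_fset_set// mem_set.
rewrite (big_fsetD1 i)//= addrCA lerDl addr_ge0// sumr_ge0//.
Qed.

Lemma rearr_ge0 n : 0 <= rearr w n.
Proof. by apply: lb_le_inf => [|s []//]; exact: rearr_levels_nonempty. Qed.

Lemma rearr_nonincreasing : nonincreasing_seq (rearr w).
Proof.
move=> m n mn; apply: lb_le_inf; first exact: rearr_levels_nonempty.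
move=> s [s0 sm]; apply: ge_inf; first by exists 0 => r [].
split => //; apply: card_le_trans sm _.
by rewrite card_le_II.
Qed.

Lemma rank_surj n : 0 < rearr w n -> exists2 i, 0 < w i & rank w i = n.
Proof.
move=> rn.
have : ~ ([set i | (0:R) < w i] #<= `I_n)%card.
  move=> P; move: rn; apply/negP; rewrite -leNgt; apply: ge_inf => //.
  by exists 0 => r [].
move=> /card_le_seqP/contrapT[s [us ss sw]].
have [i0 [wi0 ni0]] : exists i, 0 < w i /\ (n <= rank w i)%N.
  apply: contrapT => nex.
  have : uniq (map (rank w) s).
    by rewrite map_inj_in_uniq// => i j /sw wi /sw; exact: rank_inj.
  move=> /(@uniq_leq_size _ _ (iota 0 n)); rewrite size_map ss size_iota ltnn.
  suff sub : {subset [seq rank w i | i <- s] <= iota 0 n} by move=> /(_ sub).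
  move=> _ /mapP[i /sw wi ->]; rewrite mem_iota add0n leq0n/= ltnNge.
  by apply/negP => ni; apply: nex; exists i.
have ex : exists m, `[< exists i, [/\ 0 < w i, rank w i = m & (n <= m)%N] >].
  by exists (rank w i0); apply/asboolP; exists i0.
case: (ex_minnP ex) => m /asboolP[i [wi rim nm]] mmin; exists i => //.
apply/eqP; rewrite rim eqn_leq nm andbT -rim.
have : uniq (map (rank w) (fset_set [set j | before w j i])).
  have bw k : k \in fset_set [set j | before w j i] -> 0 < w k.
    by rewrite mem_before// => /orP[/(lt_trans wi)//|/andP[/eqP <-]].
  by rewrite map_inj_in_uniq ?fset_uniq// => j k /bw wj /bw; exact: rank_inj.
move=> /(@uniq_leq_size _ _ (iota 0 n)); rewrite size_map size_iota; apply.
move=> _ /mapP[j jB ->]; move: jB.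
rewrite mem_before// => ji; rewrite mem_iota add0n leq0n/=.
have wj : 0 < w j by case/orP: ji => [/(lt_trans wi)//|/andP[/eqP <-]].
rewrite ltnNge; apply/negP => nj.
have /mmin : `[< exists i, [/\ 0 < w i, rank w i = rank w j & (n <= rank w j)%N] >].
  by apply/asboolP; exists j.
by rewrite -rim leqNgt rank_lt.
Qed.

Lemma rank_bij : set_bij (supp w) (supp (rearr w)) (rank w).
Proof.
split.
- by move=> i wi /=; rewrite /supp/= rearr_rank.
- by move=> i j /set_mem wi /set_mem; exact: rank_inj.
- by move=> n /rank_surj[i wi <-]; exists i.
Qed.

Lemma esum_idx_rearr k (h : seq R -> \bar R) :
  (\esum_(s in idx k (rearr w)) h (map (rearr w) s) =
   \esum_(s in idx k w) h (map w s))%E.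
Proof.
rewrite (@reindex_esum _ _ _ (idx k w) _ (map (rank w))); last first.
  split.
  - move=> s [sk us sw]; split; first by rewrite size_map.
      by rewrite map_inj_in_uniq// => i j /sw wi /sw; exact: rank_inj.
    by move=> _ /mapP[i /sw wi ->]; rewrite rearr_rank.
  - move=> s t /set_mem [sk us sw] /set_mem[tk ut tw] st.
    have szst : size s = size t by rewrite sk tk.
    apply: (@eq_from_nth _ 0%N) => // i ilt.
    have := congr1 (fun s => nth 0%N s i) st.
    rewrite !(nth_map 0%N) -?szst//; apply: rank_inj.
      by apply: sw; rewrite mem_nth.
    by apply: tw; rewrite mem_nth// -szst.
  - move=> s [sk us sw].
    have H n : {i | 0 < rearr w n -> 0 < w i /\ rank w i = n}.
      apply: cid; have [/rank_surj[i wi ri]|_] := boolP (0 < rearr w n).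
        by exists i.
      by exists 0%N.
    pose e n := projT1 (H n).
    have eP n : n \in s -> 0 < w (e n) /\ rank w (e n) = n.
      by move=> /sw; exact: (projT2 (H n)).
    have E : map (rank w) (map e s) = s.
      rewrite -map_comp map_id_in// => n ns /=.
      by have [] := eP _ ns.
    exists (map e s) => //; split; first by rewrite size_map.
      by apply: (@map_uniq _ _ (rank w)); rewrite E.
    by move=> _ /mapP[n ns ->]; have [] := eP _ ns.
apply: eq_esum => s [_ _ sw]; congr h; rewrite -map_comp.
by apply/eq_in_map => n /sw; exact: rearr_rank.
Qed.

Lemma nneseries_rearr :
  (\sum_(0 <= i <oo) (rearr w i)%:E = \sum_(0 <= i <oo) (w i)%:E)%E.
Proof.
rewrite (esum_supp rearr_ge0) (esum_supp fw.1).
rewrite (reindex_esum _ _ _ _ rank_bij); apply: eq_esum => i wi.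
by rewrite rearr_rank.
Qed.

End ranks.

Lemma summable_finite_levels w : (forall i, 0 <= w i) ->
  (\sum_(0 <= i <oo) (w i)%:E < +oo)%E -> finite_levels w.
Proof.
move=> w0 wfin; split => // s s0; apply: contrapT => inf.
pose W := (\sum_(0 <= i <oo) (w i)%:E)%E.
have W0 : (0 <= W)%E by apply: nneseries_ge0 => i _ _; rewrite lee_fin.
have [B BA nB] := infinite_set_fset (Num.bound (fine W / s)) inf.
have : ((s *+ #|` B|)%:E <= W)%E.
  rewrite /W (@nneseries_esumT _ (fun i => (w i)%:E)); last first.
    by move=> i; rewrite lee_fin.
  apply: esum_ge; exists [set` B]; first by split => //; exact: finite_fset.
  rewrite fsbig_finite//= set_fsetK sumEFin lee_fin.
  rewrite -[leLHS]addr0 -iter_addr -(count_predT B) -big_const_seq.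
  by rewrite big_seq [leRHS]big_seq; apply: ler_sum => i /BA.
rewrite -[W]fineK ?ge0_fin_numE// lee_fin; apply/negP; rewrite -ltNge.
apply: (@lt_le_trans _ _ (s * (Num.bound (fine W / s))%:R)).
  rewrite mulrC -ltr_pdivrMr//; apply: archi_boundP.
  by rewrite divr_ge0 ?fine_ge0 ?(ltW s0).
by rewrite -[leRHS]mulr_natr ler_wpM2l ?(ltW s0)// ler_nat.
Qed.


Lemma OmegaP (z : mseq R) : Omega z ->
  [/\ forall i, 0 <= z i, finite_levels z, mass_ereal z = (mass z)%:E &
      0 < mass z].
Proof.
move=> [_ z0 /andP[m0 mfin]].
have E : mass_ereal z = (mass z)%:E.
  by rewrite /mass fineK// ge0_fin_numE// ltW.
split => //; first exact: summable_finite_levels.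
by rewrite -lte_fin -E.
Qed.

Lemma rearr_Omega w m : (forall i, 0 <= w i) ->
  (\sum_(0 <= i <oo) (w i)%:E = m%:E)%E -> 0 < m ->
  Omega (rearr w) /\ mass (rearr w) = m.
Proof.
move=> w0 wm m0.
have fw : finite_levels w by apply: summable_finite_levels => //; rewrite wm ltry.
have E : mass_ereal (rearr w) = m%:E by rewrite -wm -nneseries_rearr.
split; last by rewrite /mass E.
split; [exact: rearr_nonincreasing|exact: rearr_ge0|].
by rewrite E lte_fin m0 ltry.
Qed.

Lemma nneseries_delta (j : nat) (c : R) : 0 <= c ->
  (\sum_(0 <= n <oo) (if n == j then c else 0)%:E = c%:E)%E.
Proof.
move=> c0; rewrite (@nneseries_esumT _ (fun n => (if n == j then c else 0)%:E)).
  rewrite (@esum_single _ _ _ j) ?eqxx ?lee_fin//.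
  by move=> i _ /negbTE ->.
by move=> n; rewrite lee_fin; case: ifP.
Qed.

Definition merged i j (z : nat -> R) : nat -> R :=
  fun n => if n == i then z i + z j else if n == j then 0 else z n.

Lemma merged_ge0 i j z : (forall n, 0 <= z n) -> forall n, 0 <= merged i j z n.
Proof. by move=> z0 n; rewrite /merged; case: ifP => _; [rewrite addr_ge0|case: ifP]. Qed.

Lemma sum_merged i j (z : nat -> R) m : i != j -> (forall n, 0 <= z n) ->
  (\sum_(0 <= n <oo) (z n)%:E = m%:E)%E ->
  (\sum_(0 <= n <oo) (merged i j z n)%:E = m%:E)%E.
Proof.
move=> ij z0 zm.
have : (\sum_(0 <= n <oo) ((merged i j z n)%:E + (if n == j then z j else 0)%:E) =
        \sum_(0 <= n <oo) ((z n)%:E + (if n == i then z j else 0)%:E))%E.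
  apply: eq_eseriesr => n _; rewrite -!EFinD; congr EFin; rewrite /merged.
  have [->|ni] := eqVneq n i; first by rewrite (negbTE ij) addr0.
  by have [->|nj] := eqVneq n j; rewrite ?add0r ?addr0.
rewrite !nneseriesD ?nneseries_delta//; last 4 first.
- by move=> n _ _; rewrite lee_fin.
- by move=> n _ _; rewrite lee_fin; case: ifP.
- by move=> n _ _; rewrite lee_fin merged_ge0.
- by move=> n _ _; rewrite lee_fin; case: ifP.
rewrite zm => H; have := congr1 (fun x => (x - (z j)%:E)%E) H.
by rewrite /= !addeK.
Qed.

Definition fragments i y (z : nat -> R) : nat -> R :=
  fun n => if n is m.+1 then (if m == i then z i - y else z m) else y.

Lemma fragments_ge0 i y z : (forall n, 0 <= z n) -> 0 < y < z i ->
  forall n, 0 <= fragments i y z n.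
Proof.
move=> z0 /andP[y0 yz] [|n] /=; first exact: ltW.
by case: ifP => // _; rewrite subr_ge0 ltW.
Qed.

Lemma sum_fragments i y (z : nat -> R) m : (forall n, 0 <= z n) -> 0 < y < z i ->
  (\sum_(0 <= n <oo) (z n)%:E = m%:E)%E ->
  (\sum_(0 <= n <oo) (fragments i y z n)%:E = m%:E)%E.
Proof.
move=> z0 yz zm; have w0 := fragments_ge0 z0 yz.
rewrite (nneseries_split 0 1) ?big_nat1; last by move=> n _; rewrite lee_fin.
rewrite add0n -(nneseries_addn 1); last by move=> n; rewrite lee_fin.
rewrite -[in RHS]zm addeC.
under eq_eseriesr do rewrite addn1.
have y0 : 0 <= y by case/andP: yz => /ltW.
rewrite -[X in (_ + X)%E](nneseries_delta i y0) -nneseriesD.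
- apply: eq_eseriesr => n _; rewrite -EFinD /=; congr EFin.
  by case: eqP => [->|_]; rewrite ?subrK ?addr0.
- by move=> n _ _; rewrite lee_fin; exact: (w0 n.+1).
- by move=> n _ _; rewrite lee_fin; case: ifP.
Qed.

Lemma merge_at_Omega i j (z : mseq R) : i != j -> Omega z ->
  Omega (merge_at i j z) /\ mass (merge_at i j z) = mass z.
Proof.
move=> ij /OmegaP[z0 _ zm m0]; apply: rearr_Omega => //.
  exact: merged_ge0.
exact: sum_merged.
Qed.

Lemma split_at_Omega i y (z : mseq R) : 0 < y < z i -> Omega z ->
  Omega (split_at i y z) /\ mass (split_at i y z) = mass z.
Proof.
move=> yz /OmegaP[z0 _ zm m0]; apply: rearr_Omega => //.
  exact: fragments_ge0.
exact: sum_fragments.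
Qed.

End rearrangement.

(** * Measurability *)

Section mseq_measurability.
Context {R : realType}.

Definition box (c : seq (rat * rat)) : set (mseq R) :=
  [set z | forall i, (i < size c)%N ->
     ratr (nth (0, 0) c i).1 < z i < ratr (nth (0, 0) c i).2].

(* Rational boxes contained in an open set cover it: otherwise there would be
   points outside of it converging to a point of it. *)
Lemma open_box (U : set (prod_topology (fun _ : nat => R))) z :
  open U -> U z -> exists c, box c z /\ box c `<=` U.
Proof.
move=> oU Uz.
have E e i : 0 < e -> exists p : rat * rat,
    [/\ ratr p.1 < z i, z i < ratr p.2, z i - e < ratr p.1 & ratr p.2 < z i + e].
  move=> e0.
  have [p /itvP pE] : exists p, ratr p \in `]z i - e, z i[.
    by apply: rat_in_itvoo; rewrite ltrBlDr ltrDl.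
  have [q /itvP qE] : exists q, ratr q \in `]z i, z i + e[.
    by apply: rat_in_itvoo; rewrite ltrDl.
  by exists (p, q); rewrite /= pE pE qE qE.
have e0 (N : nat) : 0 < (N.+1%:R^-1 : R) by rewrite invr_gt0.
pose p N i := projT1 (cid (E _ i (e0 N))).
have pP N i : [/\ ratr (p N i).1 < z i, z i < ratr (p N i).2,
    z i - N.+1%:R^-1 < ratr (p N i).1 & ratr (p N i).2 < z i + N.+1%:R^-1].
  exact: (projT2 (cid (E _ i (e0 N)))).
pose c N := mkseq (p N) N.
have cz N : box (c N) z.
  move=> i; rewrite size_mkseq => iN; rewrite nth_mkseq//.
  by have [-> ->] := pP N i.
apply: contrapT => nex.
have H N : exists x, box (c N) x /\ ~ U x.
  apply: contrapT => nexN; apply: nex; exists (c N); split => // x bx.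
  by apply: contrapT => Ux; apply: nexN; exists x.
pose x N : prod_topology (fun _ : nat => R) := projT1 (cid (H N)).
have xP N : box (c N) (x N) /\ ~ U (x N) by exact: (projT2 (cid (H N))).
have xz : x @ \oo --> (z : prod_topology (fun _ : nat => R)).
  apply/cvg_sup => i V [W] [[G] oG <-] Gz GV.
  apply: (filterS GV).
  have : (fun N => x N i) @ \oo --> z i.
    apply/cvgrPdist_lt => e e_gt0.
    near=> N.
    have iN : (i < N)%N by near: N; exists i.+1.
    have [/(_ i)] := xP N.
    rewrite size_mkseq nth_mkseq// => /(_ iN)/andP[x1 x2] _.
    have [_ _ z1 z2] := pP N i.
    have Ne : N.+1%:R^-1 < e by near: N; exact: near_infty_natSinv_lt (PosNum e_gt0).
    rewrite ltr_distlC; apply/andP; split.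
      by apply: lt_trans (lt_trans z1 x1); rewrite ltrD2l ltrN2.
    by apply: lt_trans (lt_trans x2 z2) _; rewrite ltrD2l.
  by move=> /(_ G); apply; apply: open_nbhs_nbhs; split.
have : nbhs (z : prod_topology (fun _ : nat => R)) U by apply: open_nbhs_nbhs; split.
move=> /xz [N _ /(_ N (leqnn N))] /=.
by have [] := xP N.
Unshelve. all: by end_near. Qed.

Lemma measurable_mseq d (T : measurableType d) (D : set T) (f : T -> mseq R) :
  (forall n, measurable_fun D (fun x => f x n)) -> measurable_fun D f.
Proof.
move=> mf mD; apply: (@measurability _ _ _ _ D f (@open (prod_topology (fun _ : nat => R)))) => //.
move=> _ [U oU <-].
have -> : D `&` f @^-1` U =
    \bigcup_(c in [set c | box c `<=` U]) (D `&` f @^-1` (box c)).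
  apply/seteqP; split => [x [Dx Ux]|x [c cU [Dx cx]]].
    by have [c [cz cU]] := open_box oU Ux; exists c.
  by split => //; exact: cU.
rewrite bigcup_mkcond; apply: countable_bigcupT_measurable => // c.
case: ifPn => // _.
have -> : D `&` f @^-1` (box c) = D `&` \bigcap_(i in `I_(size c))
   (D `&` ((fun x => f x i) @^-1`
     `]ratr (nth (0, 0) c i).1, ratr (nth (0, 0) c i).2[)).
  apply/seteqP; split => [x [Dx cx]|x [Dx cx]]; split => //.
    by move=> i ic; split => //=; rewrite in_itv/=; exact: cx.
  by move=> i /cx[_] /=; rewrite in_itv.
apply: measurableI => //; apply: bigcap_measurableType => // i _.
by apply: mf.
Qed.

Lemma measurable_coord (D : set (mseq R)) n :
  measurable_fun D (fun z : mseq R => z n).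
Proof.
apply: (@measurable_funS _ _ _ _ setT) => //.
apply: (measurability _ (RGenInftyO.measurableE R)) => // _ [_ [a ->] <-].
rewrite setTI; apply: sub_sigma_algebra.
apply: (@open_comp (prod_topology (fun _ : nat => R)) R (fun z => z n)).
  by move=> z _; exact: (@proj_continuous nat (fun=> R) n).
exact: interval_open.
Qed.

Lemma measurable_mass_ereal (D : set (mseq R)) :
  (forall z, D z -> forall i, 0 <= z i) ->
  measurable_fun D (fun z : mseq R => mass_ereal z).
Proof.
move=> D0; rewrite /mass_ereal.
have -> : (fun z : mseq R => (\sum_(0 <= i <oo) (z i)%:E)%E) =
   (fun z : mseq R => (\sum_(i <oo | i \in predT) (z i)%:E)%E) by [].
apply: ge0_emeasurable_sum => [k z Dz _|k _]; first by rewrite lee_fin D0.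
by apply/measurable_EFinP; exact: measurable_coord.
Qed.

Lemma measurable_Omega : measurable (@Omega R).
Proof.
pose A : set (mseq R) := \bigcap_n ([set z | z n.+1 <= z n] `&` [set z | 0 <= z n]).
have mA : measurable A.
  apply: bigcapT_measurable => n; apply: measurableI.
    rewrite [X in measurable X](_ : _ = setT `&`
       (fun z : mseq R => (z n - z n.+1)) @^-1` `[0, +oo[); last first.
      by apply/seteqP; split => z /=; rewrite in_itv/= andbT subr_ge0// => -[].
    by apply: measurable_funB => //; exact: measurable_coord.
  rewrite [X in measurable X](_ : _ = setT `&`
       (fun z : mseq R => z n) @^-1` `[0, +oo[); last first.
    by apply/seteqP; split => z /=; rewrite in_itv/= andbT// => -[].
  exact: measurable_coord.
have -> : @Omega R = A `&` (@mass_ereal R) @^-1` `]0%E, +oo%E[.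
  apply/seteqP; split => [z [ni z0 zm]|z [Az]] /=.
    split; last by rewrite /= in_itv.
    by move=> n _; split; [apply: ni|apply: z0].
  rewrite in_itv/= => zm; split => //; last by move=> n; case: (Az n I).
  by apply/nonincreasing_seqP => n; case: (Az n I).
apply: measurable_mass_ereal => //; last exact: emeasurable_itv.
by move=> z Az i; case: (Az i I).
Qed.

Lemma measurable_mass : measurable_fun (@Omega R) (fun z : mseq R => mass z).
Proof.
apply: (@measurableT_comp _ _ _ _ _ _ fine); first exact: fine_measurable.
by apply: measurable_mass_ereal => z [].
Qed.

(* The term of rank [n] is below [a] when, for some rational [q < a], no [n.+1]
   distinct terms exceed [q]. *)
Lemma measurable_rearr d (T : measurableType d) (D : set T) (W : T -> nat -> R) :
  (forall n, measurable_fun D (fun x => W x n)) ->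
  (forall x, D x -> finite_levels (W x)) ->
  measurable_fun D (fun x => rearr (W x)).
Proof.
move=> mW fW; apply: measurable_mseq => n mD.
apply: (measurability _ (RGenInftyO.measurableE R)) => // _ [_ [a ->] <-].
have -> : D `&` (fun x => rearr (W x) n) @^-1` `]-oo, a[ =
  \bigcup_(q in [set q : rat | (0 : R) <= ratr q < a])
    (D `\` \bigcup_(s in [set s : seq nat | uniq s /\ size s = n.+1])
       (D `&` \bigcap_(i in [set` s]) (D `&` (fun x => W x i) @^-1` `]ratr q, +oo[))).
  apply/seteqP; split => [x [Dx]|x [q /= /andP[q0 qa] [Dx nex]]].
    rewrite /= in_itv/= => /(inf_lt (rearr_levels_nonempty (fW _ Dx) n)).
    move=> [s [s0 cs] sa]; have [q /itvP qE] := rat_in_itvoo sa.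
    exists q => /=; first by rewrite qE (le_trans s0)// qE.
    split => // -[t [ut st] [_ Wt]].
    move/card_le_seqP: cs; apply; exists t; split => // i it.
    have [_ /=] := Wt _ it; rewrite in_itv/= andbT; apply: lt_trans.
    by rewrite qE.
  split => //=; rewrite in_itv/=; apply: le_lt_trans qa.
  apply: ge_inf; first by exists 0 => r [].
  split => //; apply/card_le_seqP => -[s [us ss sW]]; apply: nex; exists s => //.
  split => // i /= si; split => //=; rewrite in_itv/= andbT; exact: sW.
rewrite bigcup_mkcond; apply: bigcupT_measurable_rat => q.
case: ifPn => // _; apply: measurableD => //.
rewrite bigcup_mkcond; apply: countable_bigcupT_measurable => // s.
case: ifPn => // _; apply: measurableI => //; apply: bigcap_measurableType => // i _.
by apply: mW.
Qed.

End mseq_measurability.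

(** * Lebesgue integrals *)

Definition push_measure d d' (T1 : measurableType d) (T2 : measurableType d')
    (R : realType) (m : {measure set T1 -> \bar R}) (f : T1 -> T2)
    (mf : measurable_fun setT f) : {measure set T2 -> \bar R}.
Proof. refine (pushforward m f); exact: mf. Defined.

Section lebesgue_affine.
Context {R : realType}.
Notation mu := (@lebesgue_measure R).
Local Open Scope ereal_scope.

Definition affine (a b : R) : measurableTypeR R -> measurableTypeR R :=
  fun y => (a * y + b)%R.

Lemma measurable_affine a b : measurable_fun setT (affine a b).
Proof. by apply: measurable_funD => //; exact: measurable_funM. Qed.

Lemma lebesgue_affine a b (a0 : (a != 0)%R) A : measurable A ->
  (`|a|%:E * mu (affine a b @^-1` A) = mu A).
Proof.
have na0 : (0 <= `|a|)%R by [].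
pose nu : {measure set (measurableTypeR R) -> \bar R} :=
  mscale (NngNum na0) (push_measure mu (measurable_affine a b)).
have nuE B : nu B = `|a|%:E * mu (affine a b @^-1` B) by [].
move=> mA; rewrite -nuE; apply/esym.
apply: (@lebesgue_measure_unique R nu) => // _ [[p q] /= _ <-].
rewrite nuE lebesgue_measure_itv/= lte_fin.
case: (ltgtP a 0%R) a0 => // [an|ap] _.
  have -> : affine a b @^-1` `]p, q] = `[((q - b) / a)%R, ((p - b) / a)%R[%classic.
    apply/seteqP; split => y /=; rewrite !in_itv/= /affine.
      by rewrite ler_ndivrMr// ltr_ndivlMr// ltrBlDr lerBrDr andbC mulrC.
    by rewrite ler_ndivrMr// ltr_ndivlMr// ltrBlDr lerBrDr andbC mulrC.
  rewrite lebesgue_measure_itv/= lte_fin ltr_nM2r ?invr_lt0// ltrD2r.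
  case: ifP => _; last by rewrite mule0.
  rewrite -!EFinB -EFinM; congr EFin; rewrite ltr0_norm// -mulrBl.
  by rewrite mulrC -mulrA mulrN mulVf ?lt_eqF// mulrN1; lra.
have -> : affine a b @^-1` `]p, q] = `]((p - b) / a)%R, ((q - b) / a)%R]%classic.
  apply/seteqP; split => y /=; rewrite !in_itv/= /affine.
    by rewrite ler_pdivlMr// ltr_pdivrMr// ltrBlDr lerBrDr mulrC.
  by rewrite ler_pdivlMr// ltr_pdivrMr// ltrBlDr lerBrDr mulrC.
rewrite lebesgue_measure_itv/= lte_fin ltr_pM2r ?invr_gt0// ltrD2r.
case: ifP => _; last by rewrite mule0.
rewrite -!EFinB -EFinM; congr EFin; rewrite gtr0_norm// -mulrBl.
by rewrite mulrC -mulrA mulVf ?gt_eqF// mulr1; lra.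
Qed.

Lemma ge0_integral_affine a b (a0 : (a != 0)%R) (D : set R) (f : R -> \bar R) :
  measurable D -> measurable_fun D f -> (forall y, D y -> 0 <= f y) ->
  \int[mu]_(y in D) f y =
  `|a|%:E * \int[mu]_(u in affine a b @^-1` D) f (affine a b u).
Proof.
move=> mD mf f0; have na0 : (0 <= `|a|)%R by [].
rewrite -(@ge0_integral_pushforward _ _ _ _ _ _ (measurable_affine a b) mu D f)//.
  transitivity (\int[mscale (NngNum na0)
      (push_measure mu (measurable_affine a b))]_(y in D) f y).
    apply: eq_measure_integral => A mA _.
    exact/esym/(lebesgue_affine b a0 mA).
  by rewrite ge0_integral_mscale.
by move=> y /set_mem; exact: f0.
Qed.

Lemma ge0_integral_reflect (x : R) (f : R -> \bar R) :
  measurable_fun `]0%R, x[ f -> (forall y, (0 < y < x)%R -> 0 <= f y) ->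
  \int[mu]_(y in `]0%R, x[) f y = \int[mu]_(y in `]0%R, x[) f (x - y)%R.
Proof.
move=> mf f0.
rewrite (@ge0_integral_affine (-1)%R x _ _ f)//.
rewrite normrN1 mul1e (_ : _ @^-1` _ = `]0%R, x[%classic).
  by apply: eq_integral => y _; rewrite /affine mulN1r addrC.
by apply/seteqP; split => y /=; rewrite !in_itv/= /affine; lra.
Qed.

Lemma ge0_integral_rescale (x : R) (f : R -> \bar R) : (0 < x)%R ->
  measurable_fun `]0%R, x[ f -> (forall y, (0 < y < x)%R -> 0 <= f y) ->
  \int[mu]_(y in `]0%R, x[) f y = x%:E * \int[mu]_(u in `]0%R, 1%R[) f (u * x)%R.
Proof.
move=> x0 mf f0.
rewrite (@ge0_integral_affine x 0%R _ _ f)// ?gt_eqF//.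
rewrite gtr0_norm// (_ : _ @^-1` _ = `]0%R, 1%R[%classic).
  by congr (_ * _); apply: eq_integral => y _; rewrite /affine addr0 mulrC.
apply/seteqP; split => y /=; rewrite !in_itv/= /affine addr0 pmulr_rgt0//.
  by rewrite -ltr_pdivlMl// mulVf ?gt_eqF.
by rewrite -[(x * y < x)%R]ltr_pdivlMl// mulVf ?gt_eqF.
Qed.

End lebesgue_affine.

Lemma measurable_comp_on d1 d2 d3 (T1 : measurableType d1)
    (T2 : measurableType d2) (T3 : measurableType d3)
    (B : set T2) (f : T2 -> T3) (A : set T1) (g : T1 -> T2) :
  measurable B -> (forall x, A x -> B (g x)) -> measurable_fun B f ->
  measurable_fun A g -> measurable_fun A (fun x => f (g x)).
Proof.
move=> mB AB mf mg; apply: (measurable_comp mB) mf mg.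
by move=> _ [x Ax <-]; exact: AB.
Qed.

Lemma measurable_fun_pair_on d d1 d2 (T : measurableType d)
    (T1 : measurableType d1) (T2 : measurableType d2) (D : set T)
    (f : T -> T1) (g : T -> T2) :
  measurable_fun D f -> measurable_fun D g ->
  measurable_fun D (fun x => (f x, g x)).
Proof.
move=> mf mg mD; have mf' := (measurable_restrictT _ mD).1 mf.
have mg' := (measurable_restrictT _ mD).1 mg.
move: (mD); apply: (@eq_measurable_fun _ _ _ _ _ (fun x => ((f \_ D) x, (g \_ D) x))).
  by move=> x xD; rewrite !patchE xD.
by apply: measurable_funTS; exact: measurable_fun_pair.
Qed.

Section param_integral.
Context {R : realType} d (T : measurableType d).
Notation mu := (@lebesgue_measure R).
Variables (D : set T) (a : T -> R).
Hypotheses (mD : measurable D) (ma : measurable_fun D a).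

Definition undergraph : set (T * R) := [set p | D p.1 /\ 0 < p.2 < a p.1].

Lemma measurable_undergraph : measurable undergraph.
Proof.
have mE : measurable (D `*` [set: R]) by exact: measurableX.
have -> : undergraph = (D `*` setT) `&`
    (fun p : T * R => (0 < p.2) && (p.2 < a p.1)) @^-1` [set true].
  by apply/seteqP; split => [p /= [Dp ap]//|p /= [[Dp _] ap]].
apply: measurable_and => //; apply: measurable_fun_ltr => //.
  exact: measurable_funTS.
- exact: measurable_funTS.
- apply: (@measurable_comp _ _ _ _ _ _ D) => //; first by move=> _ [p [Dp _] <-].
  exact: measurable_funTS.
Qed.

Lemma measurable_ge0_param_integral (h : T -> R -> \bar R) :
  (forall x y, D x -> 0 < y < a x -> (0 <= h x y)%E) ->
  measurable_fun undergraph (fun p => h p.1 p.2) ->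
  measurable_fun D (fun x => \int[mu]_(y in `]0%R, a x[) h x y)%E.
Proof.
move=> h0 mh.
pose g := (fun p : T * measurableTypeR R => h p.1 p.2) \_ undergraph.
have mg : measurable_fun setT g.
  by apply/(measurable_restrictT _ _).1 => //; exact: measurable_undergraph.
have g0 p : (0 <= g p)%E.
  rewrite /g patchE; case: ifPn => // /set_mem[Dp ap]; exact: h0.
apply: (@eq_measurable_fun _ _ _ _ D (fubini_F mu g)); last first.
  apply: measurable_funTS; exact: measurable_fun_fubini_tonelli_F.
move=> x /set_mem Dx; rewrite /fubini_F [RHS]integral_mkcond.
apply: eq_integral => y _; rewrite /g !patchE.
have -> : ((x, y) \in undergraph) = (y \in `]0, a x[%classic).
  apply/idP/idP => [/set_mem[_ xy]|/set_mem/= xy].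
    by apply: mem_set; rewrite /= in_itv.
  by apply: mem_set; split => //; move: xy; rewrite in_itv.
by [].
Qed.

Lemma measurable_param_integral (h : T -> R -> \bar R) :
  measurable_fun undergraph (fun p => h p.1 p.2) ->
  measurable_fun D (fun x => \int[mu]_(y in `]0%R, a x[) h x y)%E.
Proof.
move=> mh.
have mp : measurable_fun D (fun x => \int[mu]_(y in `]0%R, a x[) ((h x)^\+ y))%E.
  apply: measurable_ge0_param_integral => //.
  apply: (@eq_measurable_fun _ _ _ _ _ ((fun p : T * R => h p.1 p.2)^\+)%E).
    by move=> p _; rewrite !unlock.
  exact: measurable_funepos.
have mn : measurable_fun D (fun x => \int[mu]_(y in `]0%R, a x[) ((h x)^\- y))%E.
  apply: measurable_ge0_param_integral => //.
  apply: (@eq_measurable_fun _ _ _ _ _ ((fun p : T * R => h p.1 p.2)^\-)%E).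
    by move=> p _; rewrite !unlock.
  exact: measurable_funeneg.
apply: eq_measurable_fun (emeasurable_funB mp mn) => x _.
by rewrite [RHS]integralE.
Qed.

End param_integral.

(** * The generator *)

Section real_series.
Context {R : realType}.
Implicit Types a b c : nat -> R.

Lemma cvg_series_fine b : (forall n, 0 <= b n) ->
  (\sum_(0 <= n <oo) (b n)%:E < +oo)%E ->
  series b @ \oo --> fine (\sum_(0 <= n <oo) (b n)%:E)%E.
Proof.
move=> b0 bfin; have bfn : (\sum_(0 <= n <oo) (b n)%:E)%E \is a fin_num.
  by rewrite ge0_fin_numE//; apply: nneseries_ge0 => n _ _; rewrite lee_fin.
have H : (fun n => \sum_(0 <= i < n) (b i)%:E)%E @ \oo -->
    (fine (\sum_(0 <= n <oo) (b n)%:E))%:E.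
  rewrite fineK//; apply: (@is_cvg_nneseries _ (fun i => (b i)%:E)) => n _ _.
  by rewrite lee_fin.
have [_] := (fine_cvgP _ _).1 H; apply: cvg_trans; apply: near_eq_cvg.
by apply: nearW => n; rewrite /= sumEFin /series.
Qed.

Lemma series_dominated a b B : (forall n, `|a n| <= b n) ->
  (\sum_(0 <= n <oo) (b n)%:E <= B%:E)%E ->
  cvgn (series a) /\ `|limn (series a)| <= B.
Proof.
move=> ab bB.
have b0 n : 0 <= b n by exact: le_trans (ab n).
have Hb := cvg_series_fine b0 (le_lt_trans bB (ltry _)).
have cb : cvgn (series b) by apply/cvg_ex; eexists; exact: Hb.
have cna : cvgn [normed series a].
  by apply: series_le_cvg cb => // n; rewrite normr_ge0.
have ca : cvgn (series a) by exact: normed_cvg.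
split => //; apply: (le_trans (lim_series_norm cna)).
apply: (@le_trans _ _ (limn (series b))); first exact: lim_series_le.
rewrite (cvg_lim _ Hb)//.
have b0E : (0 <= \sum_(0 <= n <oo) (b n)%:E)%E.
  by apply: nneseries_ge0 => n _ _; rewrite lee_fin.
by rewrite -lee_fin fineK// ge0_fin_numE// (le_lt_trans bB)// ltry.
Qed.

Lemma lim_series_diff b c : (forall n, 0 <= b n) -> (forall n, 0 <= c n) ->
  (\sum_(0 <= n <oo) (b n)%:E < +oo)%E -> (\sum_(0 <= n <oo) (c n)%:E < +oo)%E ->
  limn (series (fun n => b n - c n)) =
  fine (\sum_(0 <= n <oo) (b n)%:E)%E - fine (\sum_(0 <= n <oo) (c n)%:E)%E.
Proof.
move=> b0 c0 bf cf.
have Hb := cvg_series_fine b0 bf; have Hc := cvg_series_fine c0 cf.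
apply/cvg_lim => //.
rewrite (_ : series _ = series b - series c); first exact: cvgB.
by apply/funext => n; rewrite /series/= sumrB.
Qed.

End real_series.

Section generator.
Context {R : realType}.
Notation mu := (@lebesgue_measure R).

Definition quadrant : set (R * R) := [set p | 0 < p.1 /\ 0 < p.2].

Record rate_kernels (lambda C : R) (K F : R -> R -> R) : Prop := RateKernels {
  rk_lambda : 0 <= lambda;
  rk_C : 0 <= C;
  rkK_ge0 : forall x y, 0 < x -> 0 < y -> 0 <= K x y;
  rkK_sym : forall x y, 0 < x -> 0 < y -> K x y = K y x;
  rkK_le : forall x y, 0 < x -> 0 < y -> K x y <= C * (x * y) * (x + y) `^ lambda;
  rkK_mes : measurable_fun quadrant (fun p : R * R => K p.1 p.2);
  rkF_ge0 : forall x y, 0 < x -> 0 < y -> 0 <= F x y;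
  rkF_sym : forall x y, 0 < x -> 0 < y -> F x y = F y x;
  rkF_mes : measurable_fun quadrant (fun p : R * R => F p.1 p.2);
  rkF_le : forall x, 0 < x ->
    (\int[mu]_(y in `]0%R, x[) (F y (x - y)%R)%:E <= (C * x `^ (2 + lambda))%:E)%E }.

Definition level_bounded (Phi : mseq R -> R) (b : R -> R) : Prop :=
  forall z, Omega z -> `|Phi z| <= b (mass z).

Variables (lambda C : R) (K F : R -> R -> R).
Hypothesis KF : rate_kernels lambda C K F.

Lemma measurable_quadrant : measurable quadrant.
Proof.
have -> : quadrant = `]0, +oo[ `*` `]0, +oo[.
  by apply/seteqP; split => [[x y] /=|[x y] /=]; rewrite !in_itv/= !andbT.
exact: measurableX.
Qed.

Lemma measurable_F_section (x : R) :
  measurable_fun `]0, x[ (fun y => F y (x - y)).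
Proof.
apply: (@measurable_comp_on _ _ _ _ _ _ quadrant (fun p : R * R => F p.1 p.2) _
    (fun y : R => (y, x - y))).
- exact: measurable_quadrant.
- move=> y /=; rewrite in_itv/= => /andP[y0 yx].
  by split => //=; rewrite subr_gt0.
- exact: rkF_mes KF.
- by apply: measurable_fun_pair_on => //; exact: measurable_funB.
Qed.

Lemma F_total_ge0 x y : 0 < y < x -> (0 <= (F y (x - y))%:E)%E.
Proof.
by move=> /andP[y0 yx]; rewrite lee_fin (rkF_ge0 KF)// subr_gt0.
Qed.

Section state.
Variable z : mseq R.
Hypothesis Oz : Omega z.

Lemma z_ge0 i : 0 <= z i. Proof. by have [] := OmegaP Oz. Qed.

Lemma mass_gt0 : 0 < mass z. Proof. by have [] := OmegaP Oz. Qed.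

Lemma sum_z : (\sum_(0 <= i <oo) (z i)%:E = (mass z)%:E)%E.
Proof. by have [_ _ <-] := OmegaP Oz. Qed.

Lemma sum2_le_mass i j : i != j -> z i + z j <= mass z.
Proof.
move=> ij; have z0 n : (0 <= (z n)%:E)%E by rewrite lee_fin z_ge0.
rewrite -lee_fin -sum_z (@nneseriesD1 _ _ i)// EFinD leeD2l//.
rewrite (@nneseriesD1 _ _ j)//=; last by rewrite eq_sym.
by rewrite leeDl//; apply: nneseries_ge0 => n _ _.
Qed.

Lemma z_le_mass i : z i <= mass z.
Proof.
rewrite (le_trans _ (@sum2_le_mass i i.+1 _)) ?lerDl ?z_ge0//.
by rewrite neq_ltn ltnSn.
Qed.

Lemma K_le i j : i != j -> 0 < z i -> 0 < z j ->
  K (z i) (z j) <= C * mass z `^ lambda * z i * z j.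
Proof.
move=> ij zi zj; apply: (le_trans (rkK_le KF zi zj)).
have le : (z i + z j) `^ lambda <= mass z `^ lambda.
  rewrite ge0_ler_powR ?(rk_lambda KF) ?nnegrE ?addr_ge0 ?z_ge0 ?sum2_le_mass//.
  exact/ltW/mass_gt0.
rewrite [leRHS](_ : _ = C * (z i * z j) * mass z `^ lambda); last by lra.
by rewrite ler_wpM2l// !mulr_ge0 ?(rk_C KF) ?z_ge0.
Qed.

Lemma massM : mass z `^ lambda * mass z * mass z = mass z `^ (2 + lambda).
Proof.
rewrite addrC powRD; last by apply/implyP => _; rewrite gt_eqF ?mass_gt0.
by rewrite -mulrA -expr2 -powR_mulrn// ltW// mass_gt0.
Qed.

Lemma F_le i : 0 < z i ->
  (\int[mu]_(y in `]0%R, z i[) (F y (z i - y)%R)%:E <=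
    (C * mass z `^ lambda * mass z * z i)%:E)%E.
Proof.
move=> zi; apply: (le_trans (rkF_le KF zi)); rewrite lee_fin.
rewrite -!mulrA ler_wpM2l ?(rk_C KF)//.
rewrite addrC powRD; last by apply/implyP => _; rewrite gt_eqF.
rewrite powR_mulrn ?z_ge0// expr2 ler_pM ?mulr_ge0 ?z_ge0 ?powR_ge0//.
  by rewrite ge0_ler_powR ?(rk_lambda KF) ?nnegrE ?z_ge0 ?z_le_mass// ltW ?mass_gt0.
by rewrite ler_wpM2r ?z_ge0 ?z_le_mass.
Qed.

Lemma F_fin i : 0 < z i ->
  (\int[mu]_(y in `]0%R, z i[) (F y (z i - y)%R)%:E < +oo)%E.
Proof. by move=> zi; rewrite (le_lt_trans (F_le zi))// ltry. Qed.

End state.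

Lemma measurable_split_at i :
  measurable_fun (undergraph (@Omega R) (fun z : mseq R => z i))
    (fun p : mseq R * R => split_at i p.2 p.1).
Proof.
have mU := measurable_undergraph measurable_Omega (@measurable_coord R (@Omega R) i).
rewrite -[X in measurable_fun _ X]/(fun p : mseq R * R => rearr (fragments i p.2 p.1)).
apply: measurable_rearr.
  move=> [|n] /=.
    by apply: measurable_funTS; exact: measurable_snd.
  have [_|_] := eqVneq n i.
    apply: measurable_funB; apply: measurable_funTS => //.
    apply: (measurableT_comp (@measurable_coord R setT i)); exact: measurable_fst.
  apply: measurable_funTS.
  apply: (measurableT_comp (@measurable_coord R setT n)); exact: measurable_fst.
move=> [z y] [/= Oz yz].
have [z0 _ zm m0] := OmegaP Oz.
apply: summable_finite_levels; first exact: fragments_ge0.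
by rewrite (sum_fragments z0 yz zm) ltry.
Qed.

Lemma measurable_merge_at i j : i != j ->
  measurable_fun (@Omega R) (fun z : mseq R => merge_at i j z).
Proof.
move=> ij.
rewrite -[X in measurable_fun _ X]/(fun z : mseq R => rearr (merged i j z)).
apply: measurable_rearr.
  move=> n; rewrite /merged.
  case: (n == i); last case: (n == j) => //; last exact: measurable_coord.
  by apply: measurable_funD; exact: measurable_coord.
move=> z Oz; have [z0 _ zm m0] := OmegaP Oz.
apply: summable_finite_levels; first exact: merged_ge0.
by rewrite (sum_merged ij z0 zm) ltry.
Qed.

Section bounds.
Variables (Phi : mseq R -> R) (b : R -> R).
Hypotheses (mPhi : measurable_fun (@Omega R) Phi) (bPhi : level_bounded Phi b).

Lemma measurable_Phi_split i :
  measurable_fun (undergraph (@Omega R) (fun z : mseq R => z i))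
    (fun p : mseq R * R => Phi (split_at i p.2 p.1)).
Proof.
apply: (measurable_comp_on measurable_Omega _ mPhi (@measurable_split_at i)).
by move=> [z y] [/= Oz yz]; have [] := split_at_Omega yz Oz.
Qed.

Lemma measurable_F_undergraph i :
  measurable_fun (undergraph (@Omega R) (fun z : mseq R => z i))
    (fun p : mseq R * R => F p.2 (p.1 i - p.2)).
Proof.
apply: (@measurable_comp_on _ _ _ _ _ _ quadrant (fun p : R * R => F p.1 p.2) _
    (fun p : mseq R * R => (p.2, p.1 i - p.2))).
- exact: measurable_quadrant.
- by move=> [z y] [/= Oz /andP[y0 yz]]; split => //=; rewrite subr_gt0.
- exact: rkF_mes KF.
- apply: measurable_fun_pair_on; first exact: measurable_funTS.
  apply: measurable_funB; apply: measurable_funTS => //.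
  by apply: (measurableT_comp (@measurable_coord R setT i)); exact: measurable_fst.
Qed.

Definition frag_integrand i (z : mseq R) (y : R) : R :=
  F y (z i - y) * (Phi (split_at i y z) - Phi z).

Lemma measurable_frag_integrand i :
  measurable_fun (undergraph (@Omega R) (fun z : mseq R => z i))
    (fun p : mseq R * R => frag_integrand i p.1 p.2).
Proof.
apply: measurable_funM; first exact: measurable_F_undergraph.
apply: measurable_funB; first exact: measurable_Phi_split.
apply: (measurable_comp_on measurable_Omega _ mPhi); first by move=> p [].
exact: measurable_funTS.
Qed.

Lemma measurable_section i (z : mseq R) (h : mseq R * R -> R) : Omega z ->
  measurable_fun (undergraph (@Omega R) (fun z : mseq R => z i)) h ->
  measurable_fun `]0, z i[ (fun y => h (z, y)).
Proof.
move=> Oz mh.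
apply: (measurable_comp_on (measurable_undergraph measurable_Omega
    (@measurable_coord R (@Omega R) i)) _ mh).
  by move=> y /= yz; split => //; move: yz; rewrite in_itv.
apply: measurable_funTS; exact: pair1_measurable.
Qed.

Lemma frag_integrand_le i (z : mseq R) y : Omega z -> 0 < y < z i ->
  `|frag_integrand i z y| <= 2 * b (mass z) * F y (z i - y).
Proof.
move=> Oz yz; rewrite normrM ger0_norm; last by rewrite -lee_fin F_total_ge0.
rewrite mulrC ler_wpM2r//; first by rewrite -lee_fin F_total_ge0.
have [Os ms] := split_at_Omega yz Oz.
apply: (le_trans (ler_normB _ _)).
have := bPhi Os; have := bPhi Oz; rewrite ms; lra.
Qed.

Lemma level_bound_ge0 (z : mseq R) : Omega z -> 0 <= b (mass z).
Proof. by move=> Oz; exact: le_trans (bPhi Oz). Qed.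

Lemma frag_integrand_abs_le i (z : mseq R) : Omega z -> 0 < z i ->
  (\int[mu]_(y in `]0%R, z i[) `|(frag_integrand i z y)%:E| <=
   (2 * b (mass z) * (C * mass z `^ lambda * mass z * z i))%:E)%E.
Proof.
move=> Oz zi.
apply: (@le_trans _ _ (\int[mu]_(y in `]0%R, z i[)
    ((2 * b (mass z))%:E * (F y (z i - y)%R)%:E))%E).
  apply: ge0_le_integral => //.
  - apply: measurableT_comp => //; apply/measurable_EFinP.
    exact: (measurable_section Oz (@measurable_frag_integrand i)).
  - apply: emeasurable_funM => //; apply/measurable_EFinP.
    exact: measurable_F_section.
  - move=> y; rewrite /= in_itv => /= yz.
    by rewrite -EFinM lee_fin frag_integrand_le.
rewrite ge0_integralZl_EFin//.
- rewrite [leRHS]EFinM; apply: lee_wpmul2l; last exact: F_le.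
  by rewrite lee_fin mulr_ge0// level_bound_ge0.
- by move=> y; rewrite /= in_itv => /= yz; exact: F_total_ge0.
- by apply/measurable_EFinP; exact: measurable_F_section.
- by rewrite mulr_ge0// level_bound_ge0.
Qed.

Lemma frag_integrable i (z : mseq R) : Omega z -> 0 < z i ->
  mu.-integrable `]0, z i[ (fun y => (frag_integrand i z y)%:E).
Proof.
move=> Oz zi; apply/integrableP; split.
  apply/measurable_EFinP.
  exact: (measurable_section Oz (@measurable_frag_integrand i)).
by rewrite (le_lt_trans (frag_integrand_abs_le Oz zi))// ltry.
Qed.

Definition frag_term (z : mseq R) i : R :=
  if 0 < z i then \int[mu]_(y in `]0, z i[) frag_integrand i z y else 0.

Lemma frag_term_le (z : mseq R) i : Omega z ->
  `|frag_term z i| <= 2 * b (mass z) * (C * mass z `^ lambda * mass z) * z i.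
Proof.
move=> Oz; rewrite /frag_term; case: ifPn => [zi|_].
  apply: (le_trans (le_normr_Rintegral _ (frag_integrable Oz zi))) => //.
  rewrite -lee_fin /Rintegral fineK.
    by rewrite -!mulrA mulrA; have := frag_integrand_abs_le Oz zi; rewrite -!mulrA mulrA.
  rewrite ge0_fin_numE ?integral_ge0//.
  by rewrite (le_lt_trans (frag_integrand_abs_le Oz zi))// ltry.
have m0 := mass_gt0 Oz.
have b0 := level_bound_ge0 Oz; have zi0 := z_ge0 Oz i; have C0 := rk_C KF.
have p0 := powR_ge0 (mass z) lambda.
by rewrite normr0 !mulr_ge0// ltW.
Qed.

Definition coag_term (z : mseq R) i j : R :=
  if (i != j) && (0 < z i * z j)
  then K (z i) (z j) * (Phi (merge_at i j z) - Phi z) else 0.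

Lemma z_pair_gt0 (z : mseq R) i j : Omega z -> 0 < z i * z j -> 0 < z i /\ 0 < z j.
Proof.
move=> Oz; have z0 := z_ge0 Oz.
rewrite !lt0r mulf_eq0 negb_or => /andP[/andP[-> ->] _].
by rewrite !z0.
Qed.

Lemma coag_term_le (z : mseq R) i j : Omega z ->
  `|coag_term z i j| <= 2 * b (mass z) * (C * mass z `^ lambda) * z i * z j.
Proof.
move=> Oz; rewrite /coag_term; case: ifPn => [/andP[ij zij]|_]; last first.
  by rewrite normr0 !mulr_ge0 ?(level_bound_ge0 Oz) ?(rk_C KF) ?powR_ge0 ?(z_ge0 Oz).
have [zi zj] := z_pair_gt0 Oz zij.
rewrite normrM ger0_norm ?(rkK_ge0 KF)// mulrC -!mulrA mulrA.
apply: ler_pM => //; rewrite ?(rkK_ge0 KF)//.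
  have [Os ms] := merge_at_Omega ij Oz.
  apply: (le_trans (ler_normB _ _)).
  have := bPhi Os; have := bPhi Oz; rewrite ms; lra.
by rewrite !mulrA K_le.
Qed.

End bounds.

End generator.

Lemma lim_series_scale (R : realType) (a : nat -> R) c : cvgn (series a) ->
  limn (series (fun n => c * a n)) = c * limn (series a).
Proof. by move=> ca; exact: lim_seriesZ. Qed.

Section generator_powers.
Context {R : realType}.
Notation mu := (@lebesgue_measure R).
Variables (lambda C : R) (K F : R -> R -> R).
Hypothesis KF : rate_kernels lambda C K F.

Notation L := (gen_L K F).

Definition jump_rate (m : R) : R := 2 * C * m `^ (2 + lambda).

Lemma jump_rate_ge0 m : 0 <= jump_rate m.
Proof. by rewrite !mulr_ge0 ?(rk_C KF) ?powR_ge0. Qed.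

Lemma gen_LE Phi z : L Phi z =
  2^-1 * limn (series (fun i => limn (series (coag_term K Phi z i)))) +
  2^-1 * limn (series (frag_term F Phi z)).
Proof. by []. Qed.

Definition tame (Phi : mseq R -> R) (b : R -> R) : Prop :=
  measurable_fun (@Omega R) Phi /\ level_bounded Phi b.

Lemma sum_scaled_z (z : mseq R) c : Omega z -> 0 <= c ->
  (\sum_(0 <= n <oo) (c * z n)%:E = (c * mass z)%:E)%E.
Proof.
move=> Oz c0; rewrite EFinM -(sum_z Oz) -nneseriesZl//.
by move=> n _; rewrite lee_fin; exact: z_ge0.
Qed.

Section one_step.
Variables (Phi : mseq R -> R) (b : R -> R).
Hypothesis tPhi : tame Phi b.

Let bPhi := tPhi.2.
Let mPhi := tPhi.1.

Lemma coag_inner (z : mseq R) i : Omega z ->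
  cvgn (series (coag_term K Phi z i)) /\
  `|limn (series (coag_term K Phi z i))| <=
     2 * b (mass z) * (C * mass z `^ lambda) * mass z * z i.
Proof.
move=> Oz; have b0 := level_bound_ge0 bPhi Oz.
have c0 : 0 <= 2 * b (mass z) * (C * mass z `^ lambda) * z i.
  by rewrite !mulr_ge0 ?(rk_C KF) ?powR_ge0 ?(z_ge0 Oz).
rewrite [X in _ /\ _ <= X]mulrAC.
apply: (series_dominated (coag_term_le KF bPhi i ^~ Oz)).
by rewrite sum_scaled_z.
Qed.

Lemma coag_outer (z : mseq R) : Omega z ->
  cvgn (series (fun i => limn (series (coag_term K Phi z i)))) /\
  `|limn (series (fun i => limn (series (coag_term K Phi z i))))| <=
     jump_rate (mass z) * b (mass z).
Proof.
move=> Oz; have b0 := level_bound_ge0 bPhi Oz; have m0 := mass_gt0 Oz.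
have c0 : 0 <= 2 * b (mass z) * (C * mass z `^ lambda) * mass z.
  by rewrite !mulr_ge0 ?(rk_C KF) ?powR_ge0// ltW.
rewrite [X in _ /\ _ <= X](_ : _ =
    2 * b (mass z) * (C * mass z `^ lambda) * mass z * mass z); last first.
  by rewrite /jump_rate -(massM _ Oz); lra.
apply: (series_dominated (fun i => (coag_inner i Oz).2)).
by rewrite sum_scaled_z.
Qed.

Lemma frag_sum (z : mseq R) : Omega z ->
  cvgn (series (frag_term F Phi z)) /\
  `|limn (series (frag_term F Phi z))| <= jump_rate (mass z) * b (mass z).
Proof.
move=> Oz; have b0 := level_bound_ge0 bPhi Oz; have m0 := mass_gt0 Oz.
have c0 : 0 <= 2 * b (mass z) * (C * mass z `^ lambda * mass z).
  by rewrite !mulr_ge0 ?(rk_C KF) ?powR_ge0// ltW.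
rewrite [X in _ /\ _ <= X](_ : _ =
    2 * b (mass z) * (C * mass z `^ lambda * mass z) * mass z); last first.
  by rewrite /jump_rate -(massM _ Oz); lra.
apply: (series_dominated (fun i => frag_term_le KF mPhi bPhi i Oz)).
by rewrite sum_scaled_z.
Qed.

Lemma gen_L_le (z : mseq R) : Omega z ->
  `|L Phi z| <= jump_rate (mass z) * b (mass z).
Proof.
move=> Oz; rewrite gen_LE -mulrDr normrM ger0_norm//.
have := (coag_outer Oz).2; have := (frag_sum Oz).2.
set u := limn _; set v := limn _ => hu hv.
have := ler_normD v u; lra.
Qed.

Lemma measurable_coag_term i j :
  measurable_fun (@Omega R) (fun z : mseq R => coag_term K Phi z i j).
Proof.
have [ij|ij] := eqVneq i j.
  by rewrite /coag_term ij eqxx/=; exact: measurable_cst.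
rewrite /coag_term ij /=.
have mzz : measurable_fun (@Omega R) (fun z : mseq R => z i * z j).
  by apply: measurable_funM; exact: measurable_coord.
have mif : measurable_fun (@Omega R) (fun z : mseq R => 0 < z i * z j).
  exact: measurable_fun_ltr.
apply: measurable_fun_if => //; first exact: measurable_Omega.
have mD : measurable (@Omega R `&` (fun z : mseq R => 0 < z i * z j) @^-1` [set true]).
  by apply: mif => //; exact: measurable_Omega.
apply: measurable_funM.
  apply: (@measurable_comp_on _ _ _ _ _ _ (@quadrant R)
    (fun p : R * R => K p.1 p.2) _ (fun z : mseq R => (z i, z j))).
  - exact: measurable_quadrant.
  - by move=> z [Oz /= zij]; have [] := z_pair_gt0 Oz zij.
  - exact: rkK_mes KF.
  - by apply: measurable_fun_pair_on; exact: measurable_coord.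
apply: (@measurable_funS _ _ _ _ (@Omega R)); first exact: measurable_Omega.
  by move=> z [].
apply: measurable_funB => //.
apply: (measurable_comp_on measurable_Omega _ mPhi (@measurable_merge_at R i j ij)).
by move=> z Oz; have [] := merge_at_Omega ij Oz.
Qed.

Lemma measurable_frag_term i :
  measurable_fun (@Omega R) (fun z : mseq R => frag_term F Phi z i).
Proof.
rewrite /frag_term.
have mif : measurable_fun (@Omega R) (fun z : mseq R => 0 < z i).
  by apply: measurable_fun_ltr => //; exact: measurable_coord.
apply: measurable_fun_if => //; first exact: measurable_Omega.
apply: (@measurable_funS _ _ _ _ (@Omega R)); first exact: measurable_Omega.
  by move=> z [].
apply: (@measurableT_comp _ _ _ _ _ _ fine); first exact: fine_measurable.
apply: (@measurable_param_integral _ _ _ (@Omega R) (fun z : mseq R => z i)).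
- exact: measurable_Omega.
- exact: measurable_coord.
- apply/measurable_EFinP; exact: (@measurable_frag_integrand _ _ _ _ _ KF _ mPhi i).
Qed.

Lemma measurable_series (f : nat -> mseq R -> R) :
  (forall n, measurable_fun (@Omega R) (f n)) ->
  (forall z, Omega z -> cvgn (series (f ^~ z))) ->
  measurable_fun (@Omega R) (fun z : mseq R => limn (series (f ^~ z))).
Proof.
move=> mf cf.
apply: (@measurable_fun_cvg _ _ _ _ (fun n z => series (f ^~ z) n)) => //.
move=> n; rewrite /series /=; exact: measurable_sum.
Qed.

Lemma measurable_gen_L : measurable_fun (@Omega R) (L Phi).
Proof.
rewrite -[L Phi]/(fun z : mseq R =>
  2^-1 * limn (series (fun i => limn (series (coag_term K Phi z i)))) +
  2^-1 * limn (series (frag_term F Phi z))).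
apply: measurable_funD; apply: measurable_funM => //.
  apply: measurable_series => //; last by move=> z /coag_outer[].
  move=> i; apply: measurable_series => //; last by move=> z /(coag_inner i)[].
  move=> j; exact: measurable_coag_term.
apply: measurable_series => //; last by move=> z /frag_sum[].
exact: measurable_frag_term.
Qed.

Lemma tame_gen_L : tame (L Phi) (fun m => jump_rate m * b m).
Proof. by split; [exact: measurable_gen_L|exact: gen_L_le]. Qed.

Lemma gen_L_local Psi (z : mseq R) c : Omega z ->
  (forall z', Omega z' -> mass z' = mass z -> Psi z' = c * Phi z') ->
  L Psi z = c * L Phi z.
Proof.
move=> Oz PsiE; have c1 := (coag_outer Oz).1; have c3 := (frag_sum Oz).1.
have c2 i := (coag_inner i Oz).1.
rewrite !gen_LE mulrDr; congr (_ + _).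
  rewrite mulrCA; congr (_ * _); rewrite -lim_series_scale//.
  congr (limn (series _)); apply/funext => i.
  rewrite -lim_series_scale//.
  congr (limn (series _)); apply/funext => j; rewrite /coag_term.
  case: ifPn => [/andP[ij _]|_]; last by rewrite mulr0.
  have [Os ms] := merge_at_Omega ij Oz.
  by rewrite !PsiE// -mulrBr mulrCA.
rewrite mulrCA; congr (_ * _); rewrite -lim_series_scale//.
congr (limn (series _)); apply/funext => i; rewrite /frag_term.
case: ifPn => zi; last by rewrite mulr0.
rewrite -RintegralZl//; last exact: (frag_integrable KF mPhi bPhi Oz zi).
apply: eq_Rintegral => y /set_mem; rewrite /= in_itv => /= yz.
have [Os ms] := split_at_Omega yz Oz.
by rewrite /frag_integrand !PsiE// -mulrBr mulrCA.
Qed.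

End one_step.

Lemma tame_iter Phi b n : tame Phi b ->
  tame (iter n L Phi) (fun m => jump_rate m ^+ n * b m).
Proof.
move=> tPhi; elim: n => [|n IH] /=.
  by case: tPhi => mP bP; split => // z Oz; rewrite expr0 mul1r bP.
by have [mP bP] := tame_gen_L IH; split => // z Oz; rewrite exprS -mulrA bP.
Qed.

Lemma iter_gen_L_scale Phi Psi b (h : R -> R) n : tame Phi b ->
  (forall z, Omega z -> Psi z = h (mass z) * Phi z) ->
  forall z, Omega z -> iter n L Psi z = h (mass z) * iter n L Phi z.
Proof.
move=> tPhi E; elim: n => [|n IH] z Oz //=; first exact: E.
apply: (gen_L_local (tame_iter n tPhi) Oz) => z' Oz' zz'.
by rewrite IH// zz'.
Qed.

Lemma iter_gen_Ltilde Phi b n : tame Phi b ->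
  forall z, Omega z -> iter n (gen_Ltilde lambda K F) Phi z =
    (mass z `^ (- (2 + lambda))) ^+ n * iter n L Phi z.
Proof.
move=> tPhi; elim: n => [|n IH] z Oz /=; first by rewrite expr0 mul1r.
rewrite /gen_Ltilde exprS -mulrA; congr (_ * _).
apply: (gen_L_local (tame_iter n tPhi) Oz) => z' Oz' zz'.
by rewrite IH// zz'.
Qed.

Lemma gen_L_const (z : mseq R) : L (fun=> 1) z = 0.
Proof.
rewrite gen_LE.
have z0 : limn (series (fun=> 0 : R)) = 0.
  rewrite (_ : series _ = fun=> 0) ?lim_cst//.
  by apply/funext => n; rewrite /series/= big1.
rewrite (_ : (fun i => limn (series _)) = fun=> 0); last first.
  apply/funext => i; rewrite (_ : coag_term K _ z i = fun=> 0)//.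
  by apply/funext => j; rewrite /coag_term subrr mulr0 if_same.
rewrite (_ : frag_term F _ z = fun=> 0) ?z0 ?mulr0 ?addr0//.
apply/funext => i; rewrite /frag_term; case: ifP => // _.
rewrite /Rintegral integral0_eq// => y _.
by rewrite /frag_integrand subrr mulr0.
Qed.

Lemma tame_const : tame (fun=> 1) (fun=> 1).
Proof. by split => [|z _]; [exact: measurable_cst|rewrite normr1]. Qed.

Lemma iter_gen_L_mass (h : R -> R) n (z : mseq R) : Omega z ->
  iter n.+1 L (fun z => h (mass z)) z = 0.
Proof.
move=> Oz; rewrite (iter_gen_L_scale (h := h) n.+1 tame_const)//; last first.
  by move=> z' _; rewrite mulr1.
suff -> : iter n.+1 L (fun=> 1) z = 0 by rewrite mulr0.
elim: n z Oz => [|n IH] z Oz; first exact: gen_L_const.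
rewrite iterS (gen_L_local tame_const (c := 0) Oz) ?mul0r// => z' Oz' _.
by rewrite IH// mul0r.
Qed.

End generator_powers.

(** * Exponential series *)

Section exponential_series.
Context {R : realType}.
Notation mu := (@lebesgue_measure R).
Implicit Types (a : nat -> R) (t : R).

Definition expser a t : R :=
  limn (series (fun n => t ^+ n / n`!%:R * a n)).

Lemma expserE a t :
  expser a t = limn (pseries (fun n => a n / n`!%:R) t).
Proof.
congr (limn (series _)); apply/funext => n.
by rewrite /= [RHS]mulrC [RHS]mulrA [RHS]mulrAC.
Qed.

Variables (B M : R).
Hypotheses (B0 : 0 <= B) (M0 : 0 <= M).

Definition geometric_bound a := forall n, `|a n| <= B ^+ n * M.

Lemma expser_term_le a t n : geometric_bound a ->
  `|t ^+ n / n`!%:R * a n| <= M * exp_coeff (B * `|t|) n.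
Proof.
move=> aB; rewrite normrM normrM normfV normr_nat normrX /exp_coeff/= exprMn.
rewrite [leRHS](_ : _ = `|t| ^+ n / n`!%:R * (B ^+ n * M)); last by lra.
by rewrite ler_wpM2l// mulr_ge0 ?exprn_ge0 ?invr_ge0.
Qed.

Lemma expser_cvg a t : geometric_bound a ->
  cvgn (series (fun n => t ^+ n / n`!%:R * a n)).
Proof.
move=> aB; apply: normed_cvg.
apply: (@series_le_cvg _ _ (fun n => M * exp_coeff (B * `|t|) n)).
- by move=> n; exact: normr_ge0.
- by move=> n; rewrite mulr_ge0// exp_coeff_ge0// mulr_ge0.
- by move=> n; exact: expser_term_le.
- by apply: is_cvg_seriesZ; exact: is_cvg_series_exp_coeff.
Qed.

Lemma expser_partial_le a t n : geometric_bound a ->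
  `|series (fun n => t ^+ n / n`!%:R * a n) n| <= M * expR (B * `|t|).
Proof.
move=> aB; have Bt : 0 <= B * `|t| by rewrite mulr_ge0.
rewrite /series/=; apply: (le_trans (ler_norm_sum _ _ _)).
apply: (@le_trans _ _ (\sum_(0 <= k < n) M * exp_coeff (B * `|t|) k)).
  by apply: ler_sum => i _; exact: expser_term_le.
rewrite -mulr_sumr ler_wpM2l// /expR.
apply: (nondecreasing_cvgn_le _ (is_cvg_series_exp_coeff (B * `|t|)) n).
apply/nondecreasing_seqP => m; rewrite seriesSr lerDl exp_coeff_ge0//.
Qed.

Lemma expser_le a t : geometric_bound a -> `|expser a t| <= M * expR (B * `|t|).
Proof.
move=> aB; have ca := expser_cvg (t := t) aB.
rewrite /expser -lim_norm//; apply: limr_le; first exact: is_cvg_norm.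
by apply: nearW => n; exact: expser_partial_le.
Qed.

Lemma pseries_cvg a t : geometric_bound a ->
  cvgn (pseries (fun n => a n / n`!%:R) t).
Proof.
move=> aB; have := @expser_cvg a t aB.
rewrite (_ : (fun n => _ * a n) = (fun n => a n / n`!%:R * t ^+ n))//.
by apply/funext => n; rewrite [RHS]mulrC [RHS]mulrA [RHS]mulrAC.
Qed.

Lemma expser0 a : expser a 0 = a 0%N.
Proof.
rewrite /expser; apply/cvg_lim => //; rewrite -(cvg_shiftS).
rewrite (_ : (fun n => _) = fun=> a 0%N); first exact: cvg_cst.
apply/funext => n; rewrite /series/= big_nat_recl//= expr0 fact0 divr1 mul1r.
by rewrite big1 ?addr0// => i _; rewrite exprS !mul0r.
Qed.

End exponential_series.

Section exponential_series_calculus.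
Context {R : realType}.
Notation mu := (@lebesgue_measure R).
Variables (B M : R).
Hypotheses (B0 : 0 <= B) (M0 : 0 <= M).
Variable a : nat -> R.
Hypothesis aB : geometric_bound B M a.

Lemma geometric_bound_shift : geometric_bound B (B * M) (fun n => a n.+1).
Proof. by move=> n; rewrite mulrA -exprSr. Qed.

Let shift_coef (b : nat -> R) :
  pseries_diffs (fun n => b n / n`!%:R) = (fun n => b n.+1 / n`!%:R).
Proof.
apply/funext => i; rewrite /pseries_diffs factS natrM invfM mulrCA.
by rewrite [_ * (_ / _)]mulrA mulfV ?mul1r// pnatr_eq0.
Qed.

Lemma is_derive_expser (t : R) :
  is_derive t (1 : R) (expser a) (expser (fun n => a n.+1) t).
Proof.
rewrite (_ : expser a = fun t => limn (pseries (fun n => a n / n`!%:R) t)); last first.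
  by apply/funext => s; rewrite expserE.
rewrite expserE -shift_coef.
have B1 := geometric_bound_shift.
have B2 : geometric_bound B (B * (B * M)) (fun n => a n.+2).
  by move=> n; rewrite mulrA -exprSr B1.
apply: (@pseries_snd_diffs _ _ (`|t| + 1)).
- exact: (pseries_cvg B0 M0).
- by rewrite shift_coef; apply: (@pseries_cvg _ B (B * M)) => //; rewrite mulr_ge0.
- rewrite shift_coef (shift_coef (fun n => a n.+1)).
  by apply: (@pseries_cvg _ B (B * (B * M))) => //; rewrite !mulr_ge0.
- by rewrite [ltRHS]ger0_norm ?addr_ge0// ltrDl.
Qed.

Lemma continuous_expser : continuous (expser a).
Proof.
move=> t; have [H _] := is_derive_expser t.
by apply: differentiable_continuous; exact/derivable1_diffP.
Qed.

End exponential_series_calculus.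

Lemma integral_expser (R : realType) (B M : R) (a : nat -> R) (t : R) :
  0 <= B -> 0 <= M -> geometric_bound B M a -> 0 < t ->
  (\int[@lebesgue_measure R]_(s in `[0%R, t]) (expser (fun n => a n.+1) s)%:E =
   (expser a t - a 0%N)%:E)%E.
Proof.
move=> B0 M0 aB t0.
have ca := continuous_expser B0 M0 aB.
rewrite (@continuous_FTC2 _ _ (expser a))//.
- by rewrite expser0 EFinB.
- apply: continuous_subspaceT.
  apply: (@continuous_expser _ B (B * M)) => //; first by rewrite mulr_ge0.
  exact: geometric_bound_shift.
- split.
  + by move=> x _; have [] := is_derive_expser B0 M0 aB x.
  + by apply: cvg_at_right_filter; exact: ca.
  + by apply: cvg_at_left_filter; exact: ca.
- move=> x _; rewrite derive1E.
  by have [_ ->] := is_derive_expser B0 M0 aB x.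
Qed.

(** * Evolution of expectations *)

Section evolution.
Context {R : realType}.
Notation lebesgue := (@lebesgue_measure R).
Variables (lambda C : R) (K F : R -> R -> R).
Hypothesis KF : rate_kernels lambda C K F.
Notation L := (gen_L K F).

Definition cut_off (N M : R) (Phi : mseq R -> R) : Prop :=
  [/\ measurable_fun (@Omega R) Phi, forall z, Omega z -> `|Phi z| <= M &
      forall z, Omega z -> N < mass z -> Phi z = 0].

Definition trunc (N : R) (Phi : mseq R -> R) (z : mseq R) : R :=
  if mass z <= N then Phi z else 0.

Lemma jump_rate_mono m N : 0 <= m <= N -> jump_rate lambda C m <= jump_rate lambda C N.
Proof.
move=> /andP[m0 mN]; rewrite /jump_rate ler_wpM2l ?mulr_ge0 ?(rk_C KF)//.
have l0 : 0 <= 2 + lambda by rewrite addr_ge0 ?(rk_lambda KF).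
by rewrite ge0_ler_powR ?nnegrE ?m0 ?(le_trans m0 mN).
Qed.

Lemma cut_off_tame N M Phi : cut_off N M Phi -> tame Phi (fun=> M).
Proof. by case=> mP bP _; split. Qed.

Lemma cut_off_iter N M Phi n : cut_off N M Phi ->
  cut_off N (jump_rate lambda C N ^+ n * M) (iter n L Phi).
Proof.
move=> cP; have tP := cut_off_tame cP; have [mP bP sP] := cP.
have [mL bL] := tame_iter KF n tP.
have zL z : Omega z -> N < mass z -> iter n L Phi z = 0.
  move=> Oz Nz; rewrite (@iter_gen_L_scale _ _ _ _ _ KF Phi Phi _
    (fun m => if m <= N then 1 else 0) _ tP)//.
    by rewrite leNgt Nz/= mul0r.
  move=> z' Oz'; case: ifPn; rewrite ?mul1r// -ltNge => Nz'.
  by rewrite sP// mul0r.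
split => // z Oz; have [zN|/(zL _ Oz) ->] := leP (mass z) N; last first.
  rewrite normr0 mulr_ge0 ?exprn_ge0 ?(jump_rate_ge0 KF)//.
  exact: le_trans (bP _ Oz).
apply: (le_trans (bL _ Oz)); rewrite ler_wpM2r//; first exact: le_trans (bP _ Oz).
rewrite lerXn2r ?nnegrE ?(jump_rate_ge0 KF)//.
by rewrite jump_rate_mono// zN ltW// mass_gt0.
Qed.

Lemma cut_off_geometric N M Phi z : cut_off N M Phi -> Omega z ->
  geometric_bound (jump_rate lambda C N) M (fun n => iter n L Phi z).
Proof. by move=> cP Oz n; have [_ + _] := cut_off_iter n cP; apply. Qed.

Context d (T : measurableType d) (P : probability T R).
Variable Z : R -> T -> mseq R.

Definition evolves : Prop :=
  [/\ forall t, 0 <= t -> measurable_fun setT (Z t),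
      forall t w, 0 <= t -> Omega (Z t w) &
      forall t N M Phi, 0 <= t -> cut_off N M Phi ->
        (\int[P]_w (Phi (Z t w))%:E = \int[P]_w (exp_op L t Phi (Z 0 w))%:E)%E].

Hypothesis evZ : evolves.

Let mZ := let: And3 h _ _ := evZ in h.
Let OZ := let: And3 _ h _ := evZ in h.
Let expZ := let: And3 _ _ h := evZ in h.

Lemma measurable_comp_Z d' (U : measurableType d') (Phi : mseq R -> U) t :
  0 <= t -> measurable_fun (@Omega R) Phi -> measurable_fun setT (fun w => Phi (Z t w)).
Proof.
move=> t0 mP; apply: (measurable_comp_on measurable_Omega _ mP (mZ t0)).
by move=> w _; exact: OZ.
Qed.

Lemma cut_off_integrable N M Phi t : 0 <= t -> cut_off N M Phi ->
  P.-integrable setT (fun w => (Phi (Z t w))%:E).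
Proof.
move=> t0 [mP bP _].
apply: measurable_bounded_integrable => //.
- by rewrite (le_lt_trans (probability_le1 P _))// ltry.
- exact: measurable_comp_Z.
- exists M; split; first by rewrite num_real.
  by move=> x Mx w _ /=; apply: le_trans (bP _ (OZ w t0)) (ltW Mx).
Qed.

Definition moment_coef Phi (n : nat) : R := (\int[P]_w iter n L Phi (Z 0 w))%R.

Lemma probability_ge0_cst (x : R) : (\int[P]_(w in setT) x%:E = x%:E)%E.
Proof.
rewrite integral_cst//.
by rewrite [X in (_ * X)%E](@probability_setT _ _ _ P) mule1.
Qed.

Lemma moment_coef_bound N M Phi : cut_off N M Phi ->
  geometric_bound (jump_rate lambda C N) M (moment_coef Phi).
Proof.
move=> cP n; have cn := cut_off_iter n cP.
have [mn bn _] := cn.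
apply: (le_trans (le_normr_Rintegral _ (cut_off_integrable (lexx 0) cn))) => //.
set B := _ * M; rewrite -[leRHS]/(fine B%:E) -probability_ge0_cst.
apply: le_Rintegral => //.
- exact: (integrable_norm (cut_off_integrable (lexx 0) cn)).
- exact: finite_measure_integrable_cst.
- by move=> w _; apply: bn; exact: OZ.
Qed.

Lemma expectation_expser N M Phi t : 0 <= t -> cut_off N M Phi ->
  (\int[P]_w (Phi (Z t w))%:E = (expser (moment_coef Phi) t)%:E)%E.
Proof.
move=> t0 cP; rewrite (expZ t0 cP).
have cn n := cut_off_iter n cP.
have [_ bP _] := cP.
set B := jump_rate lambda C N.
have B0 : 0 <= B by exact: jump_rate_ge0 KF _.
have M0 : (0 <= M).
  apply: contrapT => nM; have [w] : exists w : T, True.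
    by exists point.
  by move=> _; apply: nM; exact: le_trans (bP _ (OZ w (lexx 0))).
pose f n w := (series (fun i => t ^+ i / i`!%:R * iter i L Phi (Z 0 w)) n)%:E.
have H : (fun n => \int[P]_w f n w)%E @ \oo -->
    (\int[P]_w (exp_op L t Phi (Z 0 w))%:E)%E.
  apply: (@dominated_cvg _ _ _ P setT measurableT f _
     (fun=> (M * expR (B * `|t|))%:E)) => //.
  - move=> n; apply/measurable_EFinP; rewrite /series /=.
    apply: measurable_sum => i; apply: measurable_funM => //.
    by apply: measurable_comp_Z => //; have [] := cn i.
  - move=> w _; apply: cvg_EFin; first exact: nearW.
    exact: (expser_cvg B0 M0 (cut_off_geometric cP (OZ w (lexx 0)))).
  - exact: finite_measure_integrable_cst.
  - move=> n w _; rewrite lee_fin.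
    exact: (expser_partial_le B0 M0 _ _ (cut_off_geometric cP (OZ w (lexx 0)))).
apply: (cvg_unique _ H) => //.
have -> : (fun n => \int[P]_w f n w)%E =
   (fun n => (series (fun i => t ^+ i / i`!%:R * moment_coef Phi i) n)%:E).
  apply/funext => n; rewrite /f /series/=.
  under eq_integral do rewrite -sumEFin.
  rewrite integral_sum//; last first.
    move=> i; exact: (integrableZl measurableT (t ^+ i / i`!%:R)
      (cut_off_integrable (lexx 0) (cn i))).
  rewrite -sumEFin; apply: eq_bigr => i _.
  under eq_integral do rewrite EFinM.
  rewrite integralZl//; last exact: cut_off_integrable (lexx 0) (cn i).
  rewrite [RHS]EFinM; congr (_ * _)%E; rewrite /moment_coef /Rintegral fineK//.
  exact: integrable_fin_num (cut_off_integrable (lexx 0) (cn i)).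
apply: cvg_EFin; first exact: nearW.
exact: (expser_cvg B0 M0 (moment_coef_bound cP)).
Qed.

Lemma dynkin N M Phi t : 0 < t -> cut_off N M Phi ->
  (\int[lebesgue]_(s in `[0%R, t]) \int[P]_w (L Phi (Z s w))%:E =
   \int[P]_w (Phi (Z t w))%:E - \int[P]_w (Phi (Z 0 w))%:E)%E.
Proof.
move=> t0 cP; have c1 := cut_off_iter 1 cP.
have [_ bP _] := cP.
have B0 : 0 <= jump_rate lambda C N by exact: jump_rate_ge0 KF _.
have M0 : (0 <= M) by exact: le_trans (bP _ (OZ point (lexx 0))).
rewrite (expectation_expser (ltW t0) cP) (expectation_expser (lexx 0) cP) expser0.
rewrite -EFinB -(integral_expser B0 M0 (moment_coef_bound cP) t0).
apply: eq_integral => s /set_mem; rewrite /= in_itv /= => /andP[s0 _].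
rewrite (expectation_expser s0 c1); congr ((expser _ s)%:E).
by apply/funext => n; rewrite /moment_coef; under [RHS]eq_Rintegral do rewrite iterSr.
Qed.

Lemma measurable_expectation_cut N M Phi : cut_off N M Phi ->
  measurable_fun `[(0 : R), +oo[ (fun t => \int[P]_w (Phi (Z t w))%:E)%E.
Proof.
move=> cP; have [_ bP _] := cP.
have B0 : 0 <= jump_rate lambda C N by exact: jump_rate_ge0 KF _.
have M0 : (0 <= M) by exact: le_trans (bP _ (OZ point (lexx 0))).
apply: (@eq_measurable_fun _ _ _ _ _ (fun t => (expser (moment_coef Phi) t)%:E)).
  move=> t /set_mem; rewrite /= in_itv/= andbT => t0.
  by rewrite (expectation_expser t0 cP).
apply/measurable_EFinP; apply: measurable_funTS.
apply: continuous_measurable_fun.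
exact: (continuous_expser B0 M0 (moment_coef_bound cP)).
Qed.

Definition dominated (Psi : mseq R -> \bar R) (D : R) (p : nat) : Prop :=
  measurable_fun (@Omega R) Psi /\
  forall z, Omega z -> (0 <= Psi z <= (D * (1 + mass z) ^+ p)%:E)%E.

Definition cut (N : R) (Psi : mseq R -> \bar R) (z : mseq R) : R :=
  if mass z <= N then fine (Psi z) else 0.

Section dominated.
Variables (Psi : mseq R -> \bar R) (D : R) (p : nat).
Hypothesis dPsi : dominated Psi D p.

Let mPsi := dPsi.1.

Lemma dominated_fin z : Omega z -> Psi z \is a fin_num.
Proof.
move=> Oz; have /andP[P0 Pb] := dPsi.2 _ Oz.
by rewrite ge0_fin_numE// (le_lt_trans Pb)// ltry.
Qed.

Lemma dominated_D : 0 <= D.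
Proof.
have Oz : Omega (Z 0 point) by exact: OZ.
have /andP[P0 Pb] := dPsi.2 _ Oz.
have := le_trans P0 Pb; rewrite lee_fin pmulr_lge0// exprn_gt0//.
by rewrite addr_gt0// mass_gt0.
Qed.

Lemma cut_cut_off N : cut_off N (D * (1 + `|N|) ^+ p) (cut N Psi).
Proof.
have D0 := dominated_D.
split => [|z Oz|z Oz Nz]; last by rewrite /cut leNgt Nz.
- apply: measurable_fun_if => //; first exact: measurable_Omega.
    apply: measurable_fun_ler => //; exact: measurable_mass.
  apply: (@measurable_funS _ _ _ _ (@Omega R)); first exact: measurable_Omega.
    by move=> z [].
  by apply: (@measurableT_comp _ _ _ _ _ _ fine) => //; exact: fine_measurable.
- rewrite /cut; case: ifPn => [zN|_]; last first.
    by rewrite normr0 mulr_ge0// exprn_ge0.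
  have /andP[P0 Pb] := dPsi.2 _ Oz.
  rewrite ger0_norm ?fine_ge0// -lee_fin fineK ?dominated_fin//.
  apply: (le_trans Pb); rewrite lee_fin ler_wpM2l// lerXn2r// ?nnegrE ?addr_ge0//.
    by rewrite ltW// mass_gt0.
  by rewrite lerD2l (le_trans zN)// ler_norm.
Qed.

Lemma cut_nd z : Omega z -> nondecreasing_seq (fun n => (cut n%:R Psi z)%:E).
Proof.
move=> Oz; have /andP[P0 _] := dPsi.2 _ Oz.
move=> m n mn; rewrite lee_fin /cut; case: ifPn => [zm|_].
  by rewrite (le_trans zm)// ler_nat.
by case: ifPn => // _; exact: fine_ge0.
Qed.

Lemma cut_ge0 N z : Omega z -> (0 <= (cut N Psi z)%:E)%E.
Proof.
move=> Oz; have /andP[P0 _] := dPsi.2 _ Oz.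
by rewrite lee_fin /cut; case: ifPn => // _; exact: fine_ge0.
Qed.

Lemma cut_cvg z : Omega z -> (cut n%:R Psi z)%:E @[n --> \oo] --> Psi z.
Proof.
move=> Oz; apply: cvg_near_cst.
exists (Num.bound (mass z)) => // n /= nz.
rewrite /cut ifT ?fineK ?dominated_fin//.
apply: ltW; apply: (lt_le_trans (archi_boundP _)); last by rewrite ler_nat.
by rewrite ltW// mass_gt0.
Qed.

Lemma measurable_cut_Z n t : 0 <= t ->
  measurable_fun setT (fun w => (cut n%:R Psi (Z t w))%:E).
Proof.
move=> t0; apply/measurable_EFinP; apply: measurable_comp_Z => //.
by have [] := cut_cut_off n%:R.
Qed.

Lemma expectation_cut_cvg t : 0 <= t ->
  (\int[P]_w (cut n%:R Psi (Z t w))%:E @[n --> \oo] --> \int[P]_w Psi (Z t w))%E.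
Proof.
move=> t0.
rewrite (eq_integral (fun w => limn (fun n => (cut n%:R Psi (Z t w))%:E))).
  apply: cvg_monotone_convergence => //.
  - by move=> n; exact: measurable_cut_Z.
  - by move=> n w _; apply: cut_ge0; exact: OZ.
  - by move=> w _; apply: cut_nd; exact: OZ.
by move=> w _; apply/esym/cvg_lim => //; apply: cut_cvg; exact: OZ.
Qed.

Lemma expectation_cut_nd t : 0 <= t ->
  nondecreasing_seq (fun n => \int[P]_w (cut n%:R Psi (Z t w))%:E)%E.
Proof.
move=> t0 m n mn; apply: ge0_le_integral => //.
- by move=> w _; apply: cut_ge0; exact: OZ.
- exact: measurable_cut_Z.
- exact: measurable_cut_Z.
- by move=> w _; apply: cut_nd => //; exact: OZ.
Qed.

Lemma expectation_ge0 t : 0 <= t -> (0 <= \int[P]_w Psi (Z t w))%E.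
Proof.
by move=> t0; apply: integral_ge0 => w _; have /andP[] := dPsi.2 _ (OZ w t0).
Qed.

Lemma measurable_expectation :
  measurable_fun `[(0 : R), +oo[ (fun t => \int[P]_w Psi (Z t w))%E.
Proof.
apply: (@emeasurable_fun_cvg _ _ _ _
  (fun n t => \int[P]_w (cut n%:R Psi (Z t w))%:E)%E) => //.
  by move=> n; exact: measurable_expectation_cut (cut_cut_off n%:R).
by move=> t /=; rewrite in_itv/= andbT => /expectation_cut_cvg.
Qed.

End dominated.

Lemma dominated_mass p : dominated (fun z => ((1 + mass z) ^+ p)%:E) 1 p.
Proof.
split.
  apply/measurable_EFinP; apply: measurable_funX; apply: measurable_funD => //.
  exact: measurable_mass.
move=> z Oz; rewrite mul1r lexx andbT lee_fin exprn_ge0// addr_ge0//.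
by rewrite ltW// mass_gt0.
Qed.

Lemma moment_conserved p t : 0 <= t ->
  (\int[P]_w ((1 + mass (Z t w)) ^+ p)%:E = \int[P]_w ((1 + mass (Z 0 w)) ^+ p)%:E)%E.
Proof.
rewrite le_eqVlt => /orP[/eqP<-//|t0].
have dm := dominated_mass p.
apply: (cvg_unique _ (expectation_cut_cvg dm (ltW t0))) => //.
rewrite (_ : (fun n => _) = (fun n => \int[P]_w (cut n%:R
    (fun z => ((1 + mass z) ^+ p)%:E) (Z 0 w))%:E)%E).
  exact: (expectation_cut_cvg dm (lexx 0)).
apply/funext => n; set Phi := cut _ _.
have cP := cut_cut_off dm n%:R.
have := dynkin t0 cP.
rewrite (_ : (\int[_]_(s in _) _)%E = 0%E).
  move/esym/eqP; rewrite sube_eq.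
  - by rewrite add0e => /eqP.
  - exact: integrable_fin_num (cut_off_integrable (ltW t0) cP).
  - by rewrite fin_num_adde_defl// (integrable_fin_num _ (cut_off_integrable (lexx 0) cP)).
apply: integral0_eq => s; rewrite /= in_itv/= => /andP[s0 _].
apply: integral0_eq => w _; congr EFin.
exact: (@iter_gen_L_mass _ _ _ _ _ KF
  (fun m => if m <= n%:R then (1 + m) ^+ p else 0) 0 _ (OZ w s0)).
Qed.

Hypothesis moments : forall p, (\int[P]_w ((1 + mass (Z 0 w)) ^+ p)%:E < +oo)%E.

Section integrability.
Variables (Psi : mseq R -> \bar R) (D : R) (p : nat).
Hypothesis dPsi : dominated Psi D p.

Lemma expectation_le t : 0 <= t ->
  (\int[P]_w Psi (Z t w) <= D%:E * \int[P]_w ((1 + mass (Z 0 w)) ^+ p)%:E)%E.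
Proof.
move=> t0; rewrite -(moment_conserved p t0).
have D0 := dominated_D dPsi.
have [mm _] := dominated_mass p.
have m0 w : (0 <= ((1 + mass (Z t w)) ^+ p)%:E)%E.
  by rewrite lee_fin exprn_ge0// addr_ge0// ltW// mass_gt0//; exact: OZ.
have mZt := measurable_comp_Z t0 mm.
rewrite -ge0_integralZl_EFin//.
apply: ge0_le_integral => //.
- by move=> w _; have /andP[] := dPsi.2 _ (OZ w t0).
- exact: measurable_comp_Z t0 dPsi.1.
- by apply: emeasurable_funM.
- by move=> w _; rewrite -EFinM; have /andP[] := dPsi.2 _ (OZ w t0).
Qed.

Lemma expectation_fin t : 0 <= t -> (\int[P]_w Psi (Z t w))%E \is a fin_num.
Proof.
move=> t0; rewrite ge0_fin_numE; last exact: (expectation_ge0 dPsi).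
apply: (le_lt_trans (expectation_le t0)).
by rewrite lte_mul_pinfty// ?lee_fin ?(dominated_D dPsi)// moments.
Qed.

Lemma expectation_integrable t : 0 <= t ->
  lebesgue.-integrable `[0, t] (fun s => \int[P]_w Psi (Z s w))%E.
Proof.
move=> t0.
have mE : measurable_fun `[0, t] (fun s => \int[P]_w Psi (Z s w))%E.
  apply: measurable_funS (measurable_expectation dPsi) => //.
  by move=> s /=; rewrite !in_itv/= => /andP[->].
set c := (D%:E * \int[P]_w ((1 + mass (Z 0 w)) ^+ p)%:E)%E.
have cfin : c \is a fin_num.
  rewrite ge0_fin_numE; last first.
    exact: le_trans (expectation_ge0 dPsi (lexx 0)) (expectation_le (lexx 0)).
  by rewrite lte_mul_pinfty// ?lee_fin ?(dominated_D dPsi)// moments.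
apply: (@le_integrable _ _ _ lebesgue _ _ _ (fun=> (fine c)%:E)) => //.
  move=> s; rewrite /= in_itv/= => /andP[s0 _].
  rewrite gee0_abs ?(expectation_ge0 dPsi)//.
  apply: (le_trans (expectation_le s0)).
  by rewrite -/c -{1}[c]fineK// lee_fin ler_norm.
apply: measurable_bounded_integrable => //.
  by rewrite /= lebesgue_measure_itv/=; case: ifP => _; rewrite ?ltry// -EFinB ltry.
exists `|fine c|; split; first by rewrite num_real.
by move=> x cx s _ /=; exact: ltW.
Qed.

End integrability.

Lemma time_integral_cut_cvg Psi D p t : dominated Psi D p ->
  (\int[lebesgue]_(s in `[0%R, t]) \int[P]_w (cut n%:R Psi (Z s w))%:E @[n --> \oo] -->
   \int[lebesgue]_(s in `[0%R, t]) \int[P]_w Psi (Z s w))%E.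
Proof.
move=> dPsi.
have sub : `[0, t] `<=` `[(0 : R), +oo[.
  by move=> s /=; rewrite !in_itv/= => /andP[->].
have -> : (\int[lebesgue]_(s in `[0%R, t]) \int[P]_w Psi (Z s w) =
    \int[lebesgue]_(s in `[0%R, t])
      limn (fun n => \int[P]_w (cut n%:R Psi (Z s w))%:E))%E.
  apply: eq_integral => s /set_mem /sub /=; rewrite in_itv/= andbT => s0.
  by apply/esym/cvg_lim => //; exact: (expectation_cut_cvg dPsi).
apply: cvg_monotone_convergence => //.
- move=> n; apply: measurable_funS sub _ => //.
  exact: measurable_expectation_cut (cut_cut_off dPsi n%:R).
- move=> n s /sub /=; rewrite in_itv/= andbT => s0.
  by apply: integral_ge0 => w _; apply: (cut_ge0 dPsi); exact: OZ.
- move=> s /sub /=; rewrite in_itv/= andbT => s0.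
  exact: (expectation_cut_nd dPsi).
Qed.

(* The mass is preserved by the jumps, so [L] commutes with the truncation to
   [mass z <= n]; then [n] tends to infinity. *)
Lemma dynkin_unbounded (G Tp Tm : mseq R -> \bar R) (DG Dp Dm : R) (pG pp pm : nat) t :
  dominated G DG pG -> dominated Tp Dp pp -> dominated Tm Dm pm ->
  (forall z, Omega z -> L (fun z => fine (G z)) z = fine (Tp z) - fine (Tm z)) ->
  0 < t ->
  (\int[P]_w G (Z t w) + \int[lebesgue]_(s in `[0%R, t]) \int[P]_w Tm (Z s w) =
   \int[P]_w G (Z 0 w) + \int[lebesgue]_(s in `[0%R, t]) \int[P]_w Tp (Z s w))%E.
Proof.
move=> dG dp dm LG t0; have t0' := ltW t0.
have cutE n : (\int[P]_w (cut n%:R G (Z t w))%:E +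
    \int[lebesgue]_(s in `[0%R, t]) \int[P]_w (cut n%:R Tm (Z s w))%:E =
    \int[P]_w (cut n%:R G (Z 0 w))%:E +
    \int[lebesgue]_(s in `[0%R, t]) \int[P]_w (cut n%:R Tp (Z s w))%:E)%E.
  have [cG cp cm] := And3 (cut_cut_off dG n%:R) (cut_cut_off dp n%:R)
    (cut_cut_off dm n%:R).
  have LcG z : Omega z -> L (cut n%:R G) z = cut n%:R Tp z - cut n%:R Tm z.
    move=> Oz; rewrite (_ : cut n%:R Tp z - _ =
      (if mass z <= n%:R then 1 else 0) * (fine (Tp z) - fine (Tm z))); last first.
      by rewrite /cut; case: ifP => _; rewrite ?mul1r// mul0r subrr.
    rewrite -LG//.
    apply: (@gen_L_local _ _ _ _ _ KF (fun z => fine (G z))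
      (fun m => DG * (1 + m) ^+ pG)) => //.
      split.
        by apply: (@measurableT_comp _ _ _ _ _ _ fine); [exact: fine_measurable|exact: dG.1].
      move=> z' Oz'; have /andP[P0 Pb] := dG.2 _ Oz'.
      by rewrite ger0_norm ?fine_ge0// -lee_fin fineK ?(dominated_fin dG).
    by move=> z' Oz' zz'; rewrite /cut zz'; case: ifP => _; rewrite ?mul1r// mul0r.
  have fi N M Phi s : 0 <= s -> cut_off N M Phi ->
      (\int[P]_w (Phi (Z s w))%:E)%E \is a fin_num.
    by move=> s0 cP; exact: integrable_fin_num (cut_off_integrable s0 cP).
  have ti N M Phi : cut_off N M Phi ->
      lebesgue.-integrable `[0, t] (fun s => \int[P]_w (Phi (Z s w))%:E)%E.
    move=> cP; have [_ bP _] := cP.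
    apply: (@eq_integrable _ _ _ lebesgue _ _ (fun s => (fine
      (\int[P]_w (Phi (Z s w))%:E)%E)%:E)) => //.
      move=> s /set_mem; rewrite /= in_itv/= => /andP[s0 _].
      by rewrite fineK// (fi _ _ _ _ s0 cP).
    apply: measurable_bounded_integrable => //.
    - by rewrite /= lebesgue_measure_itv/=; case: ifP => _; rewrite ?ltry// -EFinB ltry.
    - apply: (@measurableT_comp _ _ _ _ _ _ fine); first exact: fine_measurable.
      apply: measurable_funS (measurable_expectation_cut cP) => //.
      by move=> s /=; rewrite !in_itv/= => /andP[->].
    - exists M; split; first by rewrite num_real.
      move=> x Mx s; rewrite /= in_itv/= => /andP[s0 _].
      apply: le_trans (ltW Mx).
      have iP := cut_off_integrable s0 cP.
      apply: (le_trans (le_normr_Rintegral measurableT iP)).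
      rewrite -[leRHS]/(fine M%:E) -probability_ge0_cst.
      apply: le_Rintegral => //.
      + exact: (integrable_norm iP).
      + exact: finite_measure_integrable_cst.
      + by move=> w _; apply: bP; exact: OZ.
  have := dynkin t0 cG.
  have -> : (\int[lebesgue]_(s in `[0%R, t]) \int[P]_w (L (cut n%:R G) (Z s w))%:E =
      \int[lebesgue]_(s in `[0%R, t]) \int[P]_w (cut n%:R Tp (Z s w))%:E -
      \int[lebesgue]_(s in `[0%R, t]) \int[P]_w (cut n%:R Tm (Z s w))%:E)%E.
    rewrite -integralB//; [|exact: ti cp|exact: ti cm].
    apply: eq_integral => s /set_mem; rewrite /= in_itv/= => /andP[s0 _].
    rewrite -integralB//; [|exact: cut_off_integrable s0 cp|exact: cut_off_integrable s0 cm].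
    by apply: eq_integral => w _; rewrite LcG//; exact: OZ.
  have mI : measurable (`[0%R, t]%classic : set (measurableTypeR R)) by [].
  have f1 := integrable_fin_num mI (ti _ _ _ cp).
  have f2 := integrable_fin_num mI (ti _ _ _ cm).
  have f3 := fi _ _ _ _ t0' cG.
  have f4 := fi _ _ _ _ (lexx 0) cG.
  move: f1 f2 f3 f4.
  set x := (\int[_]_(_ in _) _)%E; set y := (\int[_]_(_ in _) _)%E.
  set u := (\int[_]_(_ in _) _)%E; set v := (\int[_]_(_ in _) _)%E.
  move: x y u v => [x| |] [y| |] [u| |] [v| |]//= _ _ _ _.
  by rewrite -!EFinB -!EFinD => -[xyuv]; congr EFin; lra.
have l1 : (fun n => \int[P]_w (cut n%:R G (Z t w))%:E +
    \int[lebesgue]_(s in `[0%R, t]) \int[P]_w (cut n%:R Tm (Z s w))%:E)%E @ \oo -->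
    (\int[P]_w G (Z t w) + \int[lebesgue]_(s in `[0%R, t]) \int[P]_w Tm (Z s w))%E.
  apply: cvgeD; [|exact: (expectation_cut_cvg dG)|exact: (time_integral_cut_cvg dm)].
  by rewrite fin_num_adde_defr// (expectation_fin dG).
have l2 : (fun n => \int[P]_w (cut n%:R G (Z 0 w))%:E +
    \int[lebesgue]_(s in `[0%R, t]) \int[P]_w (cut n%:R Tp (Z s w))%:E)%E @ \oo -->
    (\int[P]_w G (Z 0 w) + \int[lebesgue]_(s in `[0%R, t]) \int[P]_w Tp (Z s w))%E.
  apply: cvgeD; [|exact: (expectation_cut_cvg dG)|exact: (time_integral_cut_cvg dp)].
  by rewrite fin_num_adde_defr// (expectation_fin dG).
apply: (cvg_unique _ l1) => //.
by rewrite (_ : (fun n => _) = (fun n => \int[P]_w (cut n%:R G (Z 0 w))%:E +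
    \int[lebesgue]_(s in `[0%R, t]) \int[P]_w (cut n%:R Tp (Z s w))%:E)%E)//; apply/funext.
Qed.

End evolution.

(** * Countable sums of measurable functions *)

Section countable_sums.
Context {R : realType} (I : countType).
Local Open Scope ereal_scope.

Lemma esum_countType (A : set I) (a : I -> \bar R) : (forall i, A i -> 0 <= a i) ->
  \esum_(i in A) a i =
  \sum_(0 <= n <oo) (if pickle_inv n is Some i then
    if i \in A then a i else 0 else 0).
Proof.
move=> a0.
pose c n := (if @pickle_inv I n is Some i then if i \in A then a i else 0 else 0).
have c0 n : 0 <= c n.
  by rewrite /c; case: pickle_inv => // i; case: ifPn => // /set_mem/a0.
rewrite (@nneseries_esumT _ c)// esum_mkcond.
rewrite [RHS](esumID (range (@choice.pickle I)))// [X in _ + X]esum1 ?adde0; last first.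
  move=> n [_ /= nr]; rewrite /c.
  have := @pickle_invK I n; case: pickle_inv => //= i E.
  by exfalso; apply: nr; exists i.
rewrite setTI esum_image; last by move=> i j _ _; exact: (pcan_inj (@pickleK_inv I)).
by apply: eq_esum => i _; rewrite /c pickleK_inv.
Qed.

Context d (T : measurableType d) (D : set T) (mD : measurable D) (A : set I).
Variable g : I -> T -> \bar R.
Hypotheses (g0 : forall i x, A i -> D x -> 0 <= g i x)
  (mg : forall i, A i -> measurable_fun D (g i)).

Let mterm n : measurable_fun D (fun x =>
  if @pickle_inv I n is Some i then if i \in A then g i x else 0 else 0).
Proof.
case: pickle_inv => [i|]; last exact: measurable_cst.
by case: (boolP (i \in A)) => [/set_mem/mg//|_]; exact: measurable_cst.
Qed.

Let term_ge0 n x : D x ->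
  0 <= if @pickle_inv I n is Some i then if i \in A then g i x else 0 else 0.
Proof.
by move=> Dx; case: pickle_inv => // i; case: ifPn => // /set_mem/g0; apply.
Qed.

Lemma measurable_esum : measurable_fun D (fun x => \esum_(i in A) g i x).
Proof.
apply: (@eq_measurable_fun _ _ _ _ _ (fun x =>
  \sum_(n <oo | n \in predT) (if @pickle_inv I n is Some i then
    if i \in A then g i x else 0 else 0))).
  by move=> x /set_mem Dx; rewrite esum_countType// => i Ai; exact: g0.
by apply: ge0_emeasurable_sum => [n x Dx _|n _]; [exact: term_ge0|exact: mterm].
Qed.

Lemma integral_esum (mu : {measure set T -> \bar R}) :
  \int[mu]_(x in D) (\esum_(i in A) g i x) = \esum_(i in A) \int[mu]_(x in D) g i x.
Proof.
rewrite esum_countType; last by move=> i Ai; apply: integral_ge0 => x; exact: g0.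
transitivity (\int[mu]_(x in D) (\sum_(0 <= n <oo)
    (if @pickle_inv I n is Some i then if i \in A then g i x else 0 else 0))).
  by apply: eq_integral => x /set_mem Dx; rewrite esum_countType// => i Ai; exact: g0.
rewrite integral_nneseries//.
apply: eq_eseriesr => n _; case: pickle_inv => [i|]; last by rewrite integral0.
by case: ifP => // _; rewrite integral0.
Qed.

End countable_sums.

(** * The generator on correlation functionals *)

Section insert_more.
Variable T : Type.

Lemma nth_remove_nth (x0 : T) m (s : seq T) i : (m < size s)%N ->
  nth x0 (remove_nth m s) i = if (i < m)%N then nth x0 s i else nth x0 s i.+1.
Proof.
move=> ms; rewrite nth_cat size_takel ?(ltnW ms)//; case: ltnP => im.
  by rewrite nth_take.
by rewrite nth_drop addSn subnKC.
Qed.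

Lemma size_remove_nth m (s : seq T) : (m < size s)%N ->
  size (remove_nth m s) = (size s).-1.
Proof. by move=> ms; rewrite size_cat size_takel ?(ltnW ms)// size_drop; lia. Qed.

Lemma set_nth_ins (x0 : T) l v (s : seq T) : (l < size s)%N ->
  set_nth x0 s l v = ins l v (remove_nth l s).
Proof.
move=> ls; have sr := size_remove_nth ls; apply: (@eq_from_nth _ x0).
  by rewrite size_set_nth size_ins sr; lia.
move=> i _; rewrite nth_set_nth/= nth_ins; last by rewrite sr; lia.
case: (ltngtP i l) => // il; rewrite nth_remove_nth// ?il//.
by rewrite ifF; [congr nth; lia|apply/negbTE; rewrite -leqNgt; lia].
Qed.

Lemma ins_size_cat (a : T) s1 s2 : ins (size s1) a (s1 ++ s2) = s1 ++ a :: s2.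
Proof. by rewrite /ins take_size_cat// drop_size_cat. Qed.

Lemma ins_ins (a b : T) m l s : (m <= l)%N -> (l <= size s)%N ->
  ins m a (ins l b s) = ins l.+1 b (ins m a s).
Proof.
move=> ml ls.
have : exists s1 s2 s3, [/\ s = s1 ++ s2 ++ s3, size s1 = m & size s2 = (l - m)%N].
  exists (take m s), (take (l - m) (drop m s)), (drop (l - m) (drop m s)).
  rewrite !cat_take_drop; split => //; first by rewrite size_takel// (leq_trans ml).
  by rewrite size_takel// size_drop leq_sub2r.
move=> [s1 [s2 [s3 [-> sm sl]]]].
have lE : l = size (s1 ++ s2) by rewrite size_cat sm sl subnKC.
rewrite -{1}sm {1}lE catA ins_size_cat -catA ins_size_cat -catA -sm ins_size_cat.
have -> : l.+1 = size (s1 ++ a :: s2) by rewrite lE !size_cat addnS.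
by rewrite -!cat_cons !catA ins_size_cat -!catA.
Qed.

End insert_more.

Section double_series.
Context {R : realType}.
Variable z : nat -> R.
Hypothesis z0 : forall i, 0 <= z i.

Lemma esum_term_le (I : choiceType) (A : set I) (a : I -> \bar R) i :
  (forall j, 0 <= a j)%E -> A i -> (a i <= \esum_(j in A) a j)%E.
Proof.
move=> a0 Ai; apply: esum_ge; exists [set i].
  by split; [exact: finite_set1|move=> _ ->].
by rewrite fsbig_set1.
Qed.

Lemma nneseries_supp (a : nat -> \bar R) : (forall j, 0 <= a j)%E ->
  (\sum_(0 <= j <oo) (if (0 < z j)%R then a j else 0) = \esum_(j in supp z) a j)%E.
Proof.
move=> a0; rewrite (@nneseries_esumT _ (fun j => if (0 < z j)%R then a j else 0%E)).
  rewrite [RHS]esum_mkcond; apply: eq_esum => j _.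
  rewrite /supp; case: ifPn => zj; first by rewrite mem_set.
  by rewrite memNset//= (negbTE zj).
by move=> j; case: ifP.
Qed.

Definition pair_total (X : nat -> nat -> \bar R) : \bar R :=
  (\esum_(i in supp z) \esum_(j in supp z) (if i != j then X i j else 0))%E.

Definition pair_real (X : nat -> nat -> \bar R) i j : R :=
  if (i != j) && (0 < z i * z j) then fine (X i j) else 0.

Section one.
Variable X : nat -> nat -> \bar R.
Hypothesis X0 : forall i j, (0 <= X i j)%E.
Hypothesis Xfin : (pair_total X < +oo)%E.

Let row i : \bar R := (\esum_(j in supp z) (if i != j then X i j else 0))%E.

Let t0 i j : (0 <= (if i != j then X i j else 0))%E.
Proof. by case: ifP. Qed.

Let row0 i : (0 <= row i)%E. Proof. exact: esum_ge0. Qed.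

Let rowfin i : 0 < z i -> row i \is a fin_num.
Proof.
move=> zi; rewrite ge0_fin_numE//; apply: le_lt_trans Xfin.
exact: (@esum_term_le _ (supp z) row).
Qed.

Let termfin i j : 0 < z i -> 0 < z j -> i != j -> X i j \is a fin_num.
Proof.
move=> zi zj ij; rewrite ge0_fin_numE//.
have := rowfin zi; rewrite ge0_fin_numE//; apply: le_lt_trans.
have := @esum_term_le _ (supp z) (fun j => if i != j then X i j else 0%E) j (t0 i) zj.
by rewrite ij.
Qed.

Lemma pair_real_ge0 i j : 0 <= pair_real X i j.
Proof. by rewrite /pair_real; case: ifP => // _; exact: fine_ge0. Qed.

Lemma sum_pair_real_row i :
  (\sum_(0 <= j <oo) (pair_real X i j)%:E = if (0 < z i)%R then row i else 0)%E.
Proof.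
case: ifPn => zi; last first.
  rewrite eseries0// => j _ _.
  rewrite /pair_real ifF//; apply/negbTE; rewrite negb_and orbC.
  by rewrite -leNgt mulr_le0_ge0//; rewrite leNgt.
rewrite /row -nneseries_supp//; apply: eq_eseriesr => j _.
rewrite /pair_real pmulr_rgt0//; case: (boolP (0 < z j)) => zj; last by rewrite andbF.
by rewrite andbT; case: ifP => // ij; rewrite fineK// termfin.
Qed.

Lemma sum_pair_real :
  (\sum_(0 <= i <oo) (fine (\sum_(0 <= j <oo) (pair_real X i j)%:E))%:E =
   pair_total X)%E.
Proof.
rewrite /pair_total -nneseries_supp//; apply: eq_eseriesr => i _.
rewrite sum_pair_real_row; case: ifP => // zi.
by rewrite fineK// rowfin.
Qed.

Lemma sum_pair_real_row_fin i : (\sum_(0 <= j <oo) (pair_real X i j)%:E < +oo)%E.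
Proof.
rewrite sum_pair_real_row; case: ifP => // zi.
by rewrite -ge0_fin_numE// rowfin.
Qed.

End one.

Lemma lim_double_series (X Y : nat -> nat -> \bar R) :
  (forall i j, 0 <= X i j)%E -> (forall i j, 0 <= Y i j)%E ->
  (pair_total X < +oo)%E -> (pair_total Y < +oo)%E ->
  limn (series (fun i => limn (series (fun j =>
    pair_real X i j - pair_real Y i j)))) =
  fine (pair_total X) - fine (pair_total Y).
Proof.
move=> X0 Y0 Xf Yf.
rewrite (_ : (fun i => _) = (fun i =>
  fine (\sum_(0 <= j <oo) (pair_real X i j)%:E)%E -
  fine (\sum_(0 <= j <oo) (pair_real Y i j)%:E)%E)); last first.
  apply/funext => i; apply: lim_series_diff.
  - by move=> j; exact: pair_real_ge0.
  - by move=> j; exact: pair_real_ge0.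
  - exact: sum_pair_real_row_fin.
  - exact: sum_pair_real_row_fin.
rewrite lim_series_diff ?sum_pair_real//.
- move=> i; apply: fine_ge0; apply: nneseries_ge0 => j _ _.
  by rewrite lee_fin pair_real_ge0.
- move=> i; apply: fine_ge0; apply: nneseries_ge0 => j _ _.
  by rewrite lee_fin pair_real_ge0.
Qed.

End double_series.

Section pointwise_identity.
Context {R : realType}.
Notation mu := (@lebesgue_measure R).
Variables (lambda C : R) (K F : R -> R -> R).
Hypothesis KF : rate_kernels lambda C K F.

Definition corr (k : nat) (h : seq R -> R) (z : nat -> R) : \bar R :=
  \esum_(s in idx k z) (h (map z s))%:E.

Variables (n : nat) (h : seq R -> R).
Hypothesis h0 : forall x, 0 <= h x.
Hypothesis corr_fin : forall z : mseq R, Omega z -> (corr n.+1 h z < +oo)%E.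

Definition coag_sum (z : nat -> R) l : \bar R :=
  \esum_(s in idx n.+2 z) (K (z (nth 0%N s l)) (z (nth 0%N s l.+1)) *
    h (set_nth 0 (map z (remove_nth l.+1 s)) l
      (z (nth 0%N s l) + z (nth 0%N s l.+1))))%:E.

Definition drop_sum (z : nat -> R) l : \bar R :=
  \esum_(s in idx n.+2 z) (K (z (nth 0%N s l)) (z (nth 0%N s l.+1)) *
    h (map z (remove_nth l.+1 s)))%:E.

Definition pair_sum (z : nat -> R) l m : \bar R :=
  \esum_(s in idx n.+1 z) (K (z (nth 0%N s l)) (z (nth 0%N s m)) *
    h (map z s))%:E.

Let hE0 x : (0 <= (h x)%:E)%E. Proof. by rewrite lee_fin. Qed.

Lemma corr_ge0 k z : (0 <= corr k h z)%E.
Proof. exact: esum_ge0. Qed.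

Lemma esum_sub_le (I : choiceType) (A B : set I) (G : I -> \bar R) (c : I -> bool) :
  A `<=` B -> (forall i, 0 <= G i)%E ->
  (\esum_(i in A) (if c i then G i else 0) <= \esum_(i in B) G i)%E.
Proof.
move=> AB G0; rewrite esum_mkcond [leRHS]esum_mkcond; apply: le_esum => i _.
case: ifPn => iA; last by case: ifP.
have -> : i \in B by apply/mem_set/AB/set_mem.
by case: ifP.
Qed.

Section merging.
Variable z : mseq R.
Hypothesis Oz : Omega z.

Let coag_gain i j : \bar R := (\sum_(l < n.+1) \esum_(s in idxN n.+1 z j)
  (if nth 0%N s l == i then (h (set_nth 0 (map z s) l (z i + z j)))%:E else 0))%E.

Let coag_loss i j : \bar R := (\sum_(l < n.+1) \esum_(s in idxN n.+1 z j)
  (if nth 0%N s l == i then (h (map z s))%:E else 0))%E.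

Let coag_loss2 j : \bar R := (\sum_(m < n.+1) \esum_(s in idxN n z j)
  (h (map z (ins m j s)))%:E)%E.

Let idx_merged i j : i != j -> 0 < z i -> 0 < z j ->
  idx n.+1 (merged i j z) = idxN n.+1 z j.
Proof.
move=> ij zi zj; apply/seteqP; split => [s [sk us ws]|s [[sk us zs] /= js]].
  split; last first.
    apply/negP => /ws; rewrite /merged eq_sym (negbTE ij) eqxx.
    by rewrite ltxx.
  split => // m /ws; rewrite /merged.
  case: (eqVneq m i) => [->//|_]; case: ifP => //.
  by rewrite ltxx.
split => // m ms; rewrite /merged; case: ifP => _; first by rewrite addr_gt0.
case: (eqVneq m j) => [mj|_]; last exact: zs.
by rewrite -mj ms in js.
Qed.

Lemma merge_balance i j : i != j -> 0 < z i -> 0 < z j ->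
  (corr n.+1 h (merge_at i j z) + (coag_loss i j + coag_loss2 j) =
   corr n.+1 h z + coag_gain i j)%E.
Proof.
move=> ij zi zj; have [z0 _ zm m0] := OmegaP Oz.
have fw : finite_levels (merged i j z).
  apply: summable_finite_levels; first exact: merged_ge0.
  by rewrite (sum_merged ij z0 zm) ltry.
have E1 : corr n.+1 h (merge_at i j z) =
    (\esum_(s in idxN n.+1 z j) (h (map (merged i j z) s))%:E)%E.
  rewrite -(idx_merged ij zi zj); exact: (esum_idx_rearr fw n.+1 (fun x => (h x)%:E)).
have E2 : corr n.+1 h z =
    (\esum_(s in idxN n.+1 z j) (h (map z s))%:E + coag_loss2 j)%E.
  exact: (@esum_split _ n z j (fun s => (h (map z s))%:E)).
have E3 := @esum_subst _ n.+1 z (merged i j z) i (idxN n.+1 z j)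
  (fun x => (h x)%:E) (fun s => @proj1 _ _) _ hE0.
rewrite E1 addeA [in LHS]/coag_loss E3; last first.
  move=> s m [_ /= js] ms mi; rewrite /merged (negbTE mi) ifF//.
  by apply: contraNF js => /eqP <-.
rewrite E2 -!addeA; congr (_ + _)%E; rewrite addeC; congr (_ + _)%E.
by rewrite /coag_gain /merged eqxx.
Qed.

Let loss_fin i j : 0 < z j -> (coag_loss i j + coag_loss2 j)%E \is a fin_num.
Proof.
move=> zj; have cz := corr_fin Oz.
have cfin : corr n.+1 h z \is a fin_num by rewrite ge0_fin_numE// corr_ge0.
rewrite fin_numD; apply/andP; split.
  rewrite ge0_fin_numE; last first.
    by apply: sume_ge0 => l _; apply: esum_ge0 => s _; case: ifP.
  apply: (@le_lt_trans _ _ (\sum_(l < n.+1) corr n.+1 h z)%E).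
    by apply: lee_sum => l _; apply: esum_sub_le => // s [].
  by apply: lte_sum_pinfty.
move: cfin; rewrite /corr (@esum_split _ n z j (fun s => (h (map z s))%:E))//.
by rewrite fin_numD => /andP[].
Qed.

Let kap i j : R := if (0 < z i) && (0 < z j) then K (z i) (z j) else 0.

Let kap0 i j : 0 <= kap i j.
Proof. by rewrite /kap; case: ifP => // /andP[? ?]; rewrite (rkK_ge0 KF). Qed.

Let kap_sym i j : kap i j = kap j i.
Proof.
rewrite /kap andbC; case: ifP => // /andP[? ?]; exact: (rkK_sym KF).
Qed.

Let kapE k s l m : idx k z s -> (l < k)%N -> (m < k)%N ->
  kap (nth 0%N s l) (nth 0%N s m) = K (z (nth 0%N s l)) (z (nth 0%N s m)).
Proof. by move=> [sk _ zs] lk mk; rewrite /kap !zs// mem_nth// sk. Qed.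

Let X i j := ((kap i j)%:E * coag_gain i j)%E.
Let Y i j := ((kap i j)%:E * (coag_loss i j + coag_loss2 j))%E.

Let coag_termE i j : coag_term K (fun z => fine (corr n.+1 h z)) z i j =
  pair_real z X i j - pair_real z Y i j.
Proof.
rewrite /coag_term /pair_real; case: ifPn => [/andP[ij zij]|_]; last by rewrite subrr.
have [zi zj] := z_pair_gt0 Oz zij.
have [Om _] := merge_at_Omega ij Oz.
have f1 : corr n.+1 h (merge_at i j z) \is a fin_num.
  by rewrite ge0_fin_numE ?corr_ge0// corr_fin.
have f2 : corr n.+1 h z \is a fin_num by rewrite ge0_fin_numE ?corr_ge0// corr_fin.
have f3 := loss_fin i zj.
have E := merge_balance ij zi zj.
have f4 : coag_gain i j \is a fin_num.
  have : (corr n.+1 h z + coag_gain i j)%E \is a fin_num by rewrite -E fin_numD f1.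
  by rewrite fin_numD => /andP[].
have kE : kap i j = K (z i) (z j) by rewrite /kap zi zj.
rewrite /X /Y !fineM// -[fine (kap i j)%:E]/(kap i j) kE -mulrBr; congr (_ * _).
have := congr1 fine E; rewrite (fineD f1 f3) (fineD f2 f4); lra.
Qed.

Let gain_total : pair_total z X = (\sum_(l < n.+1) coag_sum z l)%E.
Proof.
transitivity (\sum_(l < n.+1) \esum_(i in supp z) \esum_(j in supp z)
   (if i != j then \esum_(s in idxN n.+1 z j) (if nth 0%N s l == i then
      (kap i j * h (set_nth 0 (map z s) l (z i + z j)))%:E else 0) else 0))%E.
  have T0 i j (l : 'I_n.+1) : (0 <= (if i != j then
      \esum_(s in idxN n.+1 z j) (if nth 0%N s l == i then
      (kap i j * h (set_nth 0 (map z s) l (z i + z j)))%:E else 0) else 0))%E.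
    case: ifP => // _; apply: esum_ge0 => s _; case: ifP => // _.
    by rewrite lee_fin mulr_ge0.
  rewrite -esum_sum; last by move=> i l _ _; exact: esum_ge0.
  apply: eq_esum => i _; rewrite -esum_sum//; apply: eq_esum => j _.
  case: ifP => ij; last by rewrite big1.
  rewrite /X /coag_gain ge0_sume_distrr; last first.
    by move=> l _; apply: esum_ge0 => s _; case: ifP.
  apply: eq_bigr => l _; rewrite -esumZl//; last by move=> s; case: ifP.
  by apply: eq_esum => s _; case: ifP; rewrite ?mule0.
apply: eq_bigr => l _.
rewrite (@esum_pair_adjacent _ n.+1 z l (fun i j s =>
  (kap i j * h (set_nth 0 (map z s) l (z i + z j)))%:E))//; last first.
  by move=> i j s; rewrite lee_fin mulr_ge0.
apply: eq_esum => s si; have ln := ltn_ord l; rewrite (kapE si)//; lia.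
Qed.

Let loss_total : pair_total z Y =
  (\sum_(l < n.+1) drop_sum z l + \sum_(m < n.+1) (drop_sum z m +
     \sum_(l < n.+1 | l != m) pair_sum z l m))%E.
Proof.
pose Y1 (l : 'I_n.+1) i j : \bar R := \esum_(s in idxN n.+1 z j)
  (if nth 0%N s l == i then (kap i j * h (map z s))%:E else 0)%E.
pose Y2 (m : 'I_n.+1) i j : \bar R := \esum_(s in idxN n z j)
  (kap i j * h (map z (ins m j s)))%:E.
have kh i j x : (0 <= (kap i j * h x)%:E)%E by rewrite lee_fin mulr_ge0.
have Y1_ge0 l i j : (0 <= Y1 l i j)%E by apply: esum_ge0 => s _; case: ifP.
have Y2_ge0 l i j : (0 <= Y2 l i j)%E by exact: esum_ge0.
have YE i j : Y i j = (\sum_(l < n.+1) Y1 l i j + \sum_(m < n.+1) Y2 m i j)%E.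
  rewrite /Y ge0_muleDr; last 2 first.
  - by apply: sume_ge0 => l _; apply: esum_ge0 => s _; case: ifP.
  - by apply: sume_ge0 => l _; exact: esum_ge0.
  congr (_ + _)%E; rewrite ge0_sume_distrr.
  - apply: eq_bigr => l _; rewrite -esumZl//; last by move=> s; case: ifP.
    by apply: eq_esum => s _; case: ifP; rewrite ?mule0.
  - by move=> l _; apply: esum_ge0 => s _; case: ifP.
  - by apply: eq_bigr => m _; rewrite -esumZl.
  - by move=> m _; exact: esum_ge0.
transitivity (\sum_(l < n.+1) pair_total z (Y1 l) +
              \sum_(m < n.+1) pair_total z (Y2 m))%E.
  rewrite -!esum_sum; last 2 first.
  - by move=> i l _ _; apply: esum_ge0 => j _; case: ifP.
  - by move=> i l _ _; apply: esum_ge0 => j _; case: ifP.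
  rewrite -esumD; last 2 first.
  - by move=> i _; apply: sume_ge0 => l _; apply: esum_ge0 => j _; case: ifP.
  - by move=> i _; apply: sume_ge0 => l _; apply: esum_ge0 => j _; case: ifP.
  apply: eq_esum => i _; rewrite -!esum_sum; last 2 first.
  - by move=> j l _ _; case: ifP.
  - by move=> j l _ _; case: ifP.
  rewrite -esumD; last 2 first.
  - by move=> j _; apply: sume_ge0 => l _; case: ifP.
  - by move=> j _; apply: sume_ge0 => l _; case: ifP.
  by apply: eq_esum => j _; case: ifP => _; rewrite ?YE// !big1 ?adde0.
congr (_ + _)%E; apply: eq_bigr => l _.
  rewrite /pair_total (@esum_pair_adjacent _ n.+1 z l (fun i j s =>
    (kap i j * h (map z s))%:E))//.
  apply: eq_esum => s si; have ln := ltn_ord l; rewrite (kapE si)//; lia.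
rewrite /pair_total (@esum_pair_inserted _ n z l (fun i j s =>
    (kap i j * h (map z s))%:E))//; last by rewrite -ltnS.
congr (_ + _)%E.
  apply: eq_esum => s si; have ln := ltn_ord l; rewrite kap_sym (kapE si)//; lia.
by apply: eq_bigr => m _; apply: eq_esum => s si; rewrite (kapE si).
Qed.

Lemma coag_part_corr :
  (\sum_(l < n.+1) coag_sum z l < +oo)%E ->
  (\sum_(l < n.+1) drop_sum z l + \sum_(m < n.+1) (drop_sum z m +
     \sum_(l < n.+1 | l != m) pair_sum z l m) < +oo)%E ->
  coag_part K (fun z => fine (corr n.+1 h z)) z =
  fine (\sum_(l < n.+1) coag_sum z l)%E -
  fine (\sum_(l < n.+1) drop_sum z l + \sum_(m < n.+1) (drop_sum z m +
     \sum_(l < n.+1 | l != m) pair_sum z l m))%E.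
Proof.
rewrite -gain_total -loss_total => fX fY.
rewrite -lim_double_series//.
- congr (limn (series _)); apply/funext => i; congr (limn (series _)).
  by apply/funext => j; rewrite -coag_termE.
- exact: z_ge0.
- move=> i j; rewrite mule_ge0 ?lee_fin// sume_ge0// => l _.
  by apply: esum_ge0 => s _; case: ifP.
- move=> i j; rewrite mule_ge0 ?lee_fin// adde_ge0// sume_ge0// => l _.
    by apply: esum_ge0 => s _; case: ifP.
  exact: esum_ge0.
Qed.

End merging.

End pointwise_identity.

Lemma sum_ord_offdiag (R : realType) n (S : nat -> nat -> \bar R) :
  (\sum_(m < n.+1) \sum_(l < n) (if (l < m)%N then S l m else S m l.+1) =
   \sum_(l < n.+1) \sum_(m < n.+1 | (l < m)%N) S l m +
   \sum_(l < n.+1) \sum_(m < n.+1 | (l < m)%N) S l m)%E.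
Proof.
transitivity (\sum_(m < n.+1) (\sum_(l < n.+1) (if (l < m)%N then S l m else 0) +
   \sum_(l < n.+1) (if (m < l)%N then S m l else 0)))%E.
  apply: eq_bigr => m _.
  rewrite [X in (X + _)%E]big_ord_recr/= ltnNge -ltnS ltn_ord/= adde0.
  rewrite [X in (_ + X)%E]big_ord_recl/= add0e -big_split/=.
  apply: eq_bigr => l _; rewrite /bump/= add1n ltnS.
  by case: (ltnP l m) => _; rewrite ?adde0 ?add0e.
rewrite big_split/=; congr (_ + _)%E.
  rewrite exchange_big/=; apply: eq_bigr => l _; by rewrite -big_mkcond.
by apply: eq_bigr => l _; rewrite -big_mkcond.
Qed.

Lemma sum_ord_neq (R : realType) n (S : nat -> nat -> \bar R) :
  (forall l m, (l < n)%N -> (m < n)%N -> S l m = S m l) ->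
  (\sum_(m < n) \sum_(l < n | l != m) S l m =
   \sum_(l < n) \sum_(m < n | (l < m)%N) S l m +
   \sum_(l < n) \sum_(m < n | (l < m)%N) S l m)%E.
Proof.
move=> Ssym.
transitivity (\sum_(m < n) (\sum_(l < n) (if (l < m)%N then S l m else 0) +
   \sum_(l < n) (if (m < l)%N then S m l else 0)))%E.
  apply: eq_bigr => m _; rewrite big_mkcond/= -big_split/=; apply: eq_bigr => l _.
  rewrite -val_eqE/=; case: (ltngtP l m) => //=; rewrite ?adde0 ?add0e//.
  by rewrite Ssym.
rewrite big_split/=; congr (_ + _)%E.
  rewrite exchange_big/=; apply: eq_bigr => l _; by rewrite -big_mkcond.
by apply: eq_bigr => l _; rewrite -big_mkcond.
Qed.

Section fragmentation.
Context {R : realType}.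
Notation mu := (@lebesgue_measure R).
Variables (lambda C : R) (K F : R -> R -> R).
Hypothesis KF : rate_kernels lambda C K F.
Variables (n : nat) (h : seq R -> R).
Hypothesis h0 : forall x, 0 <= h x.
Hypothesis corr_fin : forall z : mseq R, Omega z -> (corr n.+1 h z < +oo)%E.
Hypothesis mh : forall a (g : R -> seq R),
  (forall y, 0 < y < a -> size (g y) = n.+1 /\ (forall i, (i < n.+1)%N -> 0 < (g y)`_i)) ->
  (forall i, (i < n.+1)%N -> measurable_fun `]0, a[ (fun y => (g y)`_i)) ->
  measurable_fun `]0, a[ (fun y => h (g y)).

Let hE0 x : (0 <= (h x)%:E)%E. Proof. by rewrite lee_fin. Qed.

Definition loss_sum (z : nat -> R) l : \bar R :=
  (\esum_(s in idx n.+1 z) \int[mu]_(y in `]0%R, z (nth 0%N s l)[)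
    (F y (z (nth 0%N s l) - y)%R * h (map z s))%:E)%E.

Definition replace_sum (z : nat -> R) l : \bar R :=
  (\esum_(s in idx n.+1 z) \int[mu]_(y in `]0%R, z (nth 0%N s l)[)
    (F y (z (nth 0%N s l) - y)%R * h (set_nth 0%R (map z s) l y))%:E)%E.

Definition split_sum (z : nat -> R) l m : \bar R :=
  (\esum_(s in idx n z) \int[mu]_(y in `]0%R, z (nth 0%N s l)[)
    (F y (z (nth 0%N s l) - y)%R *
     h (ins m (z (nth 0%N s l) - y)%R (set_nth 0%R (map z s) l y)))%:E)%E.

Section state.
Variable z : mseq R.
Hypothesis Oz : Omega z.

Let split_loss i : \bar R := (\sum_(l < n.+1) \esum_(s in idx n.+1 z)
  (if nth 0%N s l == i then (h (map z s))%:E else 0))%E.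

Let split_gain i y : \bar R := (\sum_(l < n.+1) \esum_(s in idx n.+1 z)
  (if nth 0%N s l == i then (h (set_nth 0%R (map z s) l (z i - y)%R))%:E else 0) +
  \sum_(m < n.+1) (\esum_(s in idx n.+1 z)
    (if nth 0%N s m == i then (h (set_nth 0%R (map z s) m y))%:E else 0) +
   \sum_(l < n) \esum_(s in idx n z) (if nth 0%N s l == i then
     (h (ins m y (set_nth 0%R (map z s) l (z i - y)%R)))%:E else 0)))%E.

Lemma split_balance i y : 0 < y < z i ->
  (corr n.+1 h (split_at i y z) + split_loss i = corr n.+1 h z + split_gain i y)%E.
Proof.
move=> yz; have [z0 _ zm m0] := OmegaP Oz; have /andP[y0 yzi] := yz.
have zi : 0 < z i by exact: lt_trans yzi.
pose w : nat -> R := fragments i y z.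
pose w' := fun j : nat => if j == i then z i - y else z j.
have fw : finite_levels w.
  apply: summable_finite_levels; first exact: fragments_ge0.
  by rewrite (sum_fragments z0 yz zm) ltry.
have w'i : w' i = z i - y by rewrite /w' eqxx.
have w'z j : j != i -> w' j = z j by rewrite /w' => /negbTE ->.
have idxE k : idx k w' = idx k z.
  apply/seteqP; split => s [sk us ws]; split => // j /ws; rewrite /w'.
    by case: (eqVneq j i) => [->|].
  by case: (eqVneq j i) => [_ _|//]; rewrite subr_gt0.
have E1 : corr n.+1 h (split_at i y z) = (\esum_(s in idx n.+1 w) (h (map w s))%:E)%E.
  exact: (esum_idx_rearr fw n.+1 (fun x => (h x)%:E)).
rewrite E1 (@esum_split _ n w 0%N (fun s => (h (map w s))%:E))//.
rewrite (@esum_idx_shift _ _ w w' (fun x => (h x)%:E))// idxE.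
rewrite addeAC {1}/split_loss.
rewrite (@esum_subst _ n.+1 z w' i (idx n.+1 z) (fun x => (h x)%:E))//; last first.
  by move=> s j _ _; exact: w'z.
rewrite w'i -addeA; congr (_ + (_ + _))%E; apply: eq_bigr => m _.
rewrite (eq_esum (b := fun s => (h (ins m y (map w s)))%:E)); last first.
  by move=> s _; rewrite map_ins.
rewrite (@esum_idx_shift _ _ w w' (fun x => (h (ins m y x))%:E))// idxE.
rewrite (@esum_subst_split _ n z w' i (idx n z) (fun x => (h (ins m y x))%:E))//; last first.
  by move=> s j _ _; exact: w'z.
rewrite w'i.
congr (_ + _)%E.
rewrite [RHS](@esum_ins _ n z m)//; last 2 first.
- by rewrite -ltnS.
- by move=> s; case: ifP.
rewrite [RHS](@esum_single _ _ _ i)//; last 2 first.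
- by apply: esum_ge0 => s _; case: ifP.
- move=> j _ ji; apply: esum1 => s [[sk _ _] _].
  by rewrite nth_ins ?ltnn ?eqxx ?(negbTE ji)// sk -ltnS.
transitivity (\esum_(s in idxN n z i) (h (ins m y (map z s)))%:E)%E.
  rewrite /idxN esum_mkcondr; apply: eq_esum => s _.
  case: (boolP (i \in s)) => is_; first by rewrite memNset//= is_.
  by rewrite mem_set.
apply: eq_esum => s [[sk _ _] _]; have ms : (m <= size s)%N by rewrite sk -ltnS.
rewrite nth_ins// ltnn eqxx eqxx map_ins set_nth_ins ?size_ins ?size_map ?ltnS//.
by rewrite remove_nth_ins ?size_map.
Qed.

Let loss_fin i : (split_loss i < +oo)%E.
Proof.
apply: (@le_lt_trans _ _ (\sum_(l < n.+1) corr n.+1 h z)%E).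
  by apply: lee_sum => l _; exact: esum_sub_le.
by apply: lte_sum_pinfty => l _; exact: corr_fin.
Qed.

Let loss_ge0 i : (0 <= split_loss i)%E.
Proof. by apply: sume_ge0 => l _; apply: esum_ge0 => s _; case: ifP. Qed.

Let gain_ge0 i y : (0 <= split_gain i y)%E.
Proof.
apply: adde_ge0; apply: sume_ge0 => l _.
  by apply: esum_ge0 => s _; case: ifP.
apply: adde_ge0; first by apply: esum_ge0 => s _; case: ifP.
by apply: sume_ge0 => m _; apply: esum_ge0 => s _; case: ifP.
Qed.

Let measurable_shift l k s (v : R -> R) a (m : nat) (u : R -> R) :
  idx k z s -> (l < k)%N -> (m <= k)%N -> k.+1 = n.+1 ->
  (forall y, 0 < y < a -> 0 < v y /\ 0 < u y) ->
  measurable_fun `]0, a[ v -> measurable_fun `]0, a[ u ->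
  measurable_fun `]0, a[ (fun y => h (ins m (u y) (set_nth 0 (map z s) l (v y)))).
Proof.
move=> [sk us zs] lk mk [kn] vu mv mu_.
have sz y : size (set_nth 0 (map z s) l (v y)) = k.
  by rewrite size_set_nth size_map sk; exact/maxn_idPr.
apply: mh => [y /vu[v0 u0]|i ik].
  split; first by rewrite size_ins sz kn.
  move=> i ik; rewrite nth_ins ?sz//.
  have pos j : (j < k)%N -> 0 < (set_nth 0 [seq z i | i <- s] l (v y))`_j.
    move=> jk; rewrite nth_set_nth/=; case: eqP => // _.
    by rewrite (nth_map 0%N) ?sk// zs// mem_nth ?sk.
  case: ltnP => im; first by apply: pos; lia.
  by case: eqP => // /eqP; rewrite neq_ltn => /orP[|mi]; [lia|apply: pos; lia].
apply: (@eq_measurable_fun _ _ _ _ _ (fun y => if (i < m)%N then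
   (if i == l then v y else (map z s)`_i) else if i == m then u y else
   (if i.-1 == l then v y else (map z s)`_i.-1))).
  by move=> y _; rewrite nth_ins ?sz// !nth_set_nth.
case: (i < m)%N; first by case: (i == l) => //; exact: measurable_cst.
by case: (i == m) => //; case: (i.-1 == l) => //; exact: measurable_cst.
Qed.

Let measurable_replace l s (v : R -> R) a :
  idx n.+1 z s -> (l < n.+1)%N -> (forall y, 0 < y < a -> 0 < v y) ->
  measurable_fun `]0, a[ v ->
  measurable_fun `]0, a[ (fun y => h (set_nth 0 (map z s) l (v y))).
Proof.
move=> [sk us zs] lk v0 mv.
have sz y : size (set_nth 0 (map z s) l (v y)) = n.+1.
  by rewrite size_set_nth size_map sk; exact/maxn_idPr.
apply: mh => [y /v0 v0y|i ik].
  split => // j jk; rewrite nth_set_nth/=; case: eqP => // _.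
  by rewrite (nth_map 0%N) ?sk// zs// mem_nth ?sk.
apply: (@eq_measurable_fun _ _ _ _ _ (fun y => 
   (if i == l then v y else (map z s)`_i))).
  by move=> y _; rewrite !nth_set_nth.
by case: (i == l) => //; exact: measurable_cst.
Qed.

Section one_index.
Variable i : nat.
Hypothesis zi : 0 < z i.

Let Fi y := F y (z i - y).
Let Fi0 y : `]0%R, z i[%classic y -> 0 <= Fi y.
Proof. by rewrite /= in_itv/= => /(F_total_ge0 KF); rewrite lee_fin. Qed.

Let mFi : measurable_fun `]0, z i[ Fi.
Proof. exact: (measurable_F_section KF). Qed.

Section weighted.
Variables (A : set (seq nat)) (c : seq nat -> bool) (G : seq nat -> R -> R).
Hypothesis G0 : forall s y, 0 <= G s y.
Hypothesis mG : forall s, A s -> c s -> measurable_fun `]0, z i[ (G s).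

Let term s y : \bar R := if c s then (G s y)%:E else 0%E.

Let term_ge0 s y : (0 <= term s y)%E.
Proof. by rewrite /term; case: ifP; rewrite ?lee_fin. Qed.

Let measurable_term s : A s -> measurable_fun `]0, z i[ (term s).
Proof.
move=> As; rewrite /term; case: (boolP (c s)) => cs; last exact: measurable_cst.
by apply/measurable_EFinP; exact: mG.
Qed.

Lemma measurable_weighted : measurable_fun `]0, z i[
  (fun y => (Fi y)%:E * \esum_(s in A) (if c s then (G s y)%:E else 0))%E.
Proof.
apply: emeasurable_funM; first exact/measurable_EFinP.
by apply: (@measurable_esum _ _ _ _ _ A term) => // s As; exact: measurable_term.
Qed.

Lemma integral_weighted :
  (\int[mu]_(y in `]0%R, z i[) ((Fi y)%:E *
    \esum_(s in A) (if c s then (G s y)%:E else 0)) =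
   \esum_(s in A) (if c s then \int[mu]_(y in `]0%R, z i[) (Fi y * G s y)%:E
     else 0))%E.
Proof.
transitivity (\int[mu]_(y in `]0%R, z i[)
    \esum_(s in A) ((Fi y)%:E * term s y))%E.
  by apply: eq_integral => y /set_mem yz; rewrite esumZl//; exact: Fi0.
rewrite integral_esum//.
- apply: eq_esum => s As; rewrite /term; case: (boolP (c s)) => cs.
    by apply: eq_integral => y _; rewrite EFinM.
  by rewrite integral0_eq// => y _; rewrite mule0.
- by move=> s y As yz; rewrite mule_ge0// lee_fin; exact: Fi0.
- move=> s As; apply: emeasurable_funM; first exact/measurable_EFinP.
  exact: measurable_term.
Qed.

End weighted.

Definition frag_gain : \bar R :=
  (\int[mu]_(y in `]0%R, z i[) ((Fi y)%:E * split_gain i y))%E.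

Definition frag_loss : \bar R :=
  (\int[mu]_(y in `]0%R, z i[) ((Fi y)%:E * split_loss i))%E.

Let mreflect l s : idx n.+1 z s -> (l < n.+1)%N ->
  measurable_fun `]0, z i[ (fun y => h (set_nth 0 (map z s) l (z i - y))).
Proof.
move=> si ln; apply: (@measurable_replace l s (fun y => z i - y)) => //.
- by move=> y /andP[_]; rewrite subr_gt0.
- exact: measurable_funB.
Qed.

Let mreplace l s : idx n.+1 z s -> (l < n.+1)%N ->
  measurable_fun `]0, z i[ (fun y => h (set_nth 0 (map z s) l y)).
Proof.
move=> si ln; apply: (@measurable_replace l s (fun y => y)) => //.
by move=> y /andP[].
Qed.

Let msplit l m s : idx n z s -> (l < n)%N -> (m < n.+1)%N ->
  measurable_fun `]0, z i[ (fun y => h (ins m y (set_nth 0 (map z s) l (z i - y)))).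
Proof.
move=> si ln mn; apply: (@measurable_shift l n s (fun y => z i - y) _ m (fun y => y)) => //.
- by move=> y /andP[y0 yz]; rewrite subr_gt0.
- exact: measurable_funB.
Qed.

Let measurable_gain :
  measurable_fun `]0, z i[ (fun y => (Fi y)%:E * split_gain i y)%E.
Proof.
apply: emeasurable_funM; first exact/measurable_EFinP.
have mterm (A : set (seq nat)) (c : seq nat -> bool) (G : seq nat -> R -> R) :
    (forall s y, 0 <= G s y) ->
    (forall s, A s -> measurable_fun `]0, z i[ (G s)) ->
    measurable_fun `]0, z i[
      (fun y => \esum_(s in A) (if c s then (G s y)%:E else 0))%E.
  move=> G0 mG; apply: (@measurable_esum _ _ _ _ _ A
      (fun s y => if c s then (G s y)%:E else 0%E)) => [s y _ _|s As].
    by case: (c s); rewrite ?lee_fin.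
  by case: (c s); [apply/measurable_EFinP; exact: mG|exact: measurable_cst].
apply: emeasurable_funD; apply: emeasurable_sum => l.
  by apply: mterm => // s si; exact: mreflect.
apply: emeasurable_funD.
  by apply: mterm => // s si; exact: mreplace.
by apply: emeasurable_sum => m; apply: mterm => // s si; exact: msplit.
Qed.

Lemma frag_gainE : frag_gain =
  (\sum_(l < n.+1) \esum_(s in idx n.+1 z) (if nth 0%N s l == i then
     \int[mu]_(y in `]0%R, z i[) (Fi y * h (set_nth 0%R (map z s) l (z i - y)))%:E
     else 0) +
   \sum_(m < n.+1) (\esum_(s in idx n.+1 z) (if nth 0%N s m == i then
      \int[mu]_(y in `]0%R, z i[) (Fi y * h (set_nth 0%R (map z s) m y))%:E
      else 0) +
     \sum_(l < n) \esum_(s in idx n z) (if nth 0%N s l == i then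
      \int[mu]_(y in `]0%R, z i[)
        (Fi y * h (ins m y (set_nth 0%R (map z s) l (z i - y))))%:E else 0)))%E.
Proof.
pose W (A : set (seq nat)) (c : seq nat -> bool) (G : seq nat -> R -> R) y :=
  ((Fi y)%:E * \esum_(s in A) (if c s then (G s y)%:E else 0))%E.
have W0 A c (G : seq nat -> R -> R) : (forall s y, 0 <= G s y) ->
    forall y, `]0%R, z i[%classic y -> (0 <= W A c G y)%E.
  move=> G0 y yz; rewrite mule_ge0 ?lee_fin ?Fi0// esum_ge0// => s _.
  by case: ifP; rewrite ?lee_fin.
pose W1 (l : 'I_n.+1) := W (idx n.+1 z) (fun s => nth 0%N s l == i)
  (fun s y => h (set_nth 0%R (map z s) l (z i - y))).
pose W2 (l : 'I_n.+1) := W (idx n.+1 z) (fun s => nth 0%N s l == i)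
  (fun s y => h (set_nth 0%R (map z s) l y)).
pose W3 (m : 'I_n.+1) (l : 'I_n) := W (idx n z) (fun s => nth 0%N s l == i)
  (fun s y => h (ins m y (set_nth 0%R (map z s) l (z i - y)))).
have W1_ge0 l y : `]0%R, z i[%classic y -> (0 <= W1 l y)%E by exact: W0.
have W2_ge0 l y : `]0%R, z i[%classic y -> (0 <= W2 l y)%E by exact: W0.
have W3_ge0 m l y : `]0%R, z i[%classic y -> (0 <= W3 m l y)%E by exact: W0.
have mW1 l : measurable_fun `]0, z i[ (W1 l).
  by apply: measurable_weighted => // s si _; exact: mreflect.
have mW2 l : measurable_fun `]0, z i[ (W2 l).
  by apply: measurable_weighted => // s si _; exact: mreplace.
have mW3 m l : measurable_fun `]0, z i[ (W3 m l).
  by apply: measurable_weighted => // s si _; exact: msplit.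
transitivity (\int[mu]_(y in `]0%R, z i[) (\sum_(l < n.+1) W1 l y +
    \sum_(m < n.+1) (W2 m y + \sum_(l < n) W3 m l y)))%E.
  have t0 (c : bool) x : (0 <= (if c then (h x)%:E else 0))%E by case: c.
  apply: eq_integral => y /set_mem yz; rewrite /split_gain ge0_muleDr; last 2 first.
  - by apply: sume_ge0 => l _; exact: esum_ge0.
  - apply: sume_ge0 => m _; apply: adde_ge0; first exact: esum_ge0.
    by apply: sume_ge0 => l _; exact: esum_ge0.
  rewrite !ge0_sume_distrr; last 2 first.
  - move=> m _; apply: adde_ge0; first exact: esum_ge0.
    by apply: sume_ge0 => l _; exact: esum_ge0.
  - by move=> l _; exact: esum_ge0.
  congr (_ + _)%E; apply: eq_bigr => m _; rewrite ge0_muleDr; last 2 first.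
  - exact: esum_ge0.
  - by apply: sume_ge0 => l _; exact: esum_ge0.
  rewrite ge0_sume_distrr; last by move=> l _; exact: esum_ge0.
  by [].
have WS_ge0 (y : R) : `]0%R, z i[%classic y ->
    forall m : 'I_n.+1, (0 <= W2 m y + \sum_(l < n) W3 m l y)%E.
  move=> yz m; apply: adde_ge0; first exact: W2_ge0.
  by apply: sume_ge0 => l _; exact: W3_ge0.
have mW3S m : measurable_fun `]0, z i[ (fun y : R => \sum_(l < n) W3 m l y)%E.
  by apply: emeasurable_sum => l; exact: mW3.
have mWS m : measurable_fun `]0, z i[
    (fun y : R => W2 m y + \sum_(l < n) W3 m l y)%E.
  exact: emeasurable_funD.
have mWSS : measurable_fun `]0, z i[
    (fun y : R => \sum_(m < n.+1) (W2 m y + \sum_(l < n) W3 m l y))%E.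
  exact: emeasurable_sum.
have mW1S : measurable_fun `]0, z i[ (fun y : R => \sum_(l < n.+1) W1 l y)%E.
  exact: emeasurable_sum.
rewrite ge0_integralD//; last first.
- by move=> y yz; apply: sume_ge0 => m _; exact: WS_ge0.
- by move=> y yz; apply: sume_ge0 => m _; exact: W1_ge0.
rewrite !ge0_integral_sum//; last first.
- by move=> m y yz; exact: WS_ge0.
congr (_ + _)%E; apply: eq_bigr => m _.
  by rewrite integral_weighted// => s si _; exact: mreflect.
rewrite ge0_integralD//; last first.
- exact: mW3S.
- by move=> y yz; apply: sume_ge0 => l _; exact: W3_ge0.
- exact: mW2.
- by move=> y; exact: W2_ge0.
rewrite ge0_integral_sum//; last first.
- by move=> l y; exact: W3_ge0.
- exact: mW3.
congr (_ + _)%E.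
  by rewrite integral_weighted// => s si _; exact: mreplace.
apply: eq_bigr => l _.
by rewrite integral_weighted// => s si _; exact: msplit.
Qed.

Lemma frag_lossE : frag_loss =
  (\sum_(l < n.+1) \esum_(s in idx n.+1 z) (if nth 0%N s l == i then
     \int[mu]_(y in `]0%R, z i[) (Fi y * h (map z s))%:E else 0))%E.
Proof.
have t0 (c : bool) x : (0 <= (if c then (h x)%:E else 0))%E by case: c.
transitivity (\int[mu]_(y in `]0%R, z i[) \sum_(l < n.+1)
    ((Fi y)%:E * \esum_(s in idx n.+1 z)
      (if nth 0%N s l == i then (h (map z s))%:E else 0)))%E.
  apply: eq_integral => y _; rewrite ge0_sume_distrr//.
  by move=> l _; exact: esum_ge0.
rewrite ge0_integral_sum//.
- apply: eq_bigr => l _.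
  exact: (@integral_weighted _ (fun s => nth 0%N s l == i) (fun s _ => h (map z s))).
- move=> l.
  exact: (@measurable_weighted _ (fun s => nth 0%N s l == i) (fun s _ => h (map z s))).
- by move=> l y yz; rewrite mule_ge0 ?lee_fin ?Fi0// esum_ge0.
Qed.

Lemma frag_term_corr : (frag_gain < +oo)%E ->
  (frag_loss < +oo)%E /\
  frag_term F (fun z => fine (corr n.+1 h z)) z i = fine frag_gain - fine frag_loss.
Proof.
move=> gain_fin.
have lossE : frag_loss = (\int[mu]_(y in `]0%R, z i[) (Fi y)%:E * split_loss i)%E.
  rewrite /frag_loss; have lf : split_loss i \is a fin_num.
    by rewrite ge0_fin_numE ?loss_fin.
  rewrite -(fineK lf) muleC -ge0_integralZl_EFin//.
  - by apply: eq_integral => y _; rewrite muleC.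
  - exact/measurable_EFinP.
  - exact: fine_ge0.
have loss_finite : (frag_loss < +oo)%E.
  rewrite lossE lte_mul_pinfty ?loss_ge0 ?loss_fin//.
    by apply: integral_ge0 => y yz; rewrite lee_fin Fi0.
  rewrite ge0_fin_numE; first exact: (F_fin KF).
  by apply: integral_ge0 => y yz; rewrite lee_fin Fi0.
split => //; rewrite /frag_term zi.
have ig : mu.-integrable `]0, z i[ (fun y => (Fi y)%:E * split_gain i y)%E.
  apply/integrableP; split => //; apply: le_lt_trans gain_fin.
  rewrite le_eqVlt; apply/orP; left; apply/eqP; apply: eq_integral => y /set_mem yz.
  by rewrite gee0_abs// mule_ge0// lee_fin Fi0.
have il : mu.-integrable `]0, z i[ (fun y => (Fi y)%:E * split_loss i)%E.
  apply/integrableP; split.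
    by apply: emeasurable_funM => //; exact/measurable_EFinP.
  apply: le_lt_trans loss_finite.
  rewrite le_eqVlt; apply/orP; left; apply/eqP; apply: eq_integral => y /set_mem yz.
  by rewrite gee0_abs// mule_ge0// lee_fin Fi0.
rewrite /frag_gain /frag_loss -fineB; last 2 first.
- exact: integrable_fin_num.
- exact: integrable_fin_num.
rewrite -integralB//; congr fine; apply: eq_integral => y /set_mem yz.
have yz' : 0 < y < z i by move: yz; rewrite /= in_itv.
rewrite /frag_integrand.
have [Os _] := split_at_Omega yz' Oz.
have f1 : corr n.+1 h (split_at i y z) \is a fin_num.
  by rewrite ge0_fin_numE ?corr_ge0// corr_fin.
have f2 : corr n.+1 h z \is a fin_num by rewrite ge0_fin_numE ?corr_ge0// corr_fin.
have f3 : split_loss i \is a fin_num by rewrite ge0_fin_numE ?loss_fin.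
have E := split_balance yz'.
have f4 : split_gain i y \is a fin_num.
  have : (corr n.+1 h z + split_gain i y)%E \is a fin_num by rewrite -E fin_numD f1.
  by rewrite fin_numD => /andP[].
rewrite -(fineK f3) -(fineK f4) -!EFinM -EFinB -mulrBr; congr (_ * _)%:E.
have := congr1 fine E; rewrite (fineD f1 f3) (fineD f2 f4); lra.
Qed.

End one_index.

Let weighted_ge0 i (G : R -> R) : (forall y, 0 <= G y) ->
  (0 <= \int[mu]_(y in `]0%R, z i[) (F y (z i - y)%R * G y)%:E)%E.
Proof.
move=> G0; apply: integral_ge0 => y; rewrite /= in_itv/= => yz.
by rewrite EFinM mule_ge0 ?lee_fin//; exact: (F_total_ge0 KF).
Qed.

Lemma loss_total :
  (\esum_(i in supp z) frag_loss i = \sum_(l < n.+1) loss_sum z l)%E.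
Proof.
transitivity (\esum_(i in supp z) \sum_(l < n.+1) \esum_(s in idx n.+1 z)
   (if nth 0%N s l == i then
     \int[mu]_(y in `]0%R, z i[) (F y (z i - y)%R * h (map z s))%:E else 0))%E.
  by apply: eq_esum => i zi; rewrite frag_lossE.
rewrite esum_sum => [|i l _ _]; last first.
  by apply: esum_ge0 => s _; case: ifP => // _; exact: weighted_ge0.
apply: eq_bigr => l _; rewrite (@esum_nth _ n.+1 z l _ (fun i s =>
  \int[mu]_(y in `]0%R, z i[) (F y (z i - y)%R * h (map z s))%:E)%E)//.
by move=> i s; exact: weighted_ge0.
Qed.

Let reflected l s : idx n.+1 z s -> (l < n.+1)%N -> 
  (\int[mu]_(y in `]0%R, z (nth 0%N s l)[) (F y (z (nth 0%N s l) - y)%R *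
      h (set_nth 0%R (map z s) l (z (nth 0%N s l) - y)%R))%:E =
   \int[mu]_(y in `]0%R, z (nth 0%N s l)[) (F y (z (nth 0%N s l) - y)%R *
      h (set_nth 0%R (map z s) l y))%:E)%E.
Proof.
move=> si ln; set x := z _.
rewrite [RHS]ge0_integral_reflect; first last.
- move=> y yx; rewrite EFinM mule_ge0 ?lee_fin//.
  exact: (F_total_ge0 KF).
- apply/measurable_EFinP; apply: measurable_funM.
    exact: (measurable_F_section KF).
  apply: (@measurable_replace l s (fun y => y)) => //.
  by move=> y /andP[].
apply: eq_integral => y /set_mem; rewrite /= in_itv/= => /andP[y0 yx].
rewrite (_ : x - (x - y) = y) ?(rkF_sym KF y0) ?subr_gt0//; lra.
Qed.

Let split_term l m : (m < n.+1)%N -> (l < n)%N ->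
  (\esum_(s in idx n z) \int[mu]_(y in `]0%R, z (nth 0%N s l)[)
    (F y (z (nth 0%N s l) - y)%R *
     h (ins m y (set_nth 0%R (map z s) l (z (nth 0%N s l) - y)%R)))%:E =
   if (l < m)%N then split_sum z l m else split_sum z m l.+1)%E.
Proof.
move=> mn ln; case: ltnP => lm.
  apply: eq_esum => s si; set x := z _.
  rewrite [LHS]ge0_integral_reflect; first last.
  - move=> y yx; rewrite EFinM mule_ge0 ?lee_fin//.
    exact: (F_total_ge0 KF).
  - apply/measurable_EFinP; apply: measurable_funM.
      exact: (measurable_F_section KF).
    apply: (@measurable_shift l n s (fun y => x - y) _ m (fun y => y)) => //.
      by move=> y /andP[y0 yz]; rewrite subr_gt0.
    exact: measurable_funB.
  apply: eq_integral => y /set_mem; rewrite /= in_itv/= => /andP[y0 yx].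
  by rewrite (_ : x - (x - y) = y) ?(rkF_sym KF y0) ?subr_gt0//; lra.
have [n' nE] : exists n', n = n'.+1 by exists n.-1; lia.
have G0 i m' (g1 g2 : R -> R) (x : seq R) : (0 <= \int[mu]_(y in `]0%R, z i[)
    (F y (z i - y)%R * h (ins m' (g1 y) (set_nth 0%R x l (g2 y))))%:E)%E.
  exact: weighted_ge0.
rewrite /split_sum nE (@esum_ins _ n' z l); last 2 first.
- by lia.
- by move=> s; exact: weighted_ge0.
rewrite (@esum_ins _ n' z m); last 2 first.
- by lia.
- by move=> s; exact: weighted_ge0.
apply: eq_esum => j zj; apply: eq_esum => s [[sk us zs] _].
have ls : (l <= size s)%N by rewrite sk; lia.
have ms : (m <= size s)%N by rewrite sk; lia.
rewrite !nth_ins// !ltnn !eqxx; apply: eq_integral => y _.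
rewrite !map_ins !set_nth_ins ?size_ins ?size_map ?ltnS//.
by rewrite !remove_nth_ins ?size_map// ins_ins ?size_map.
Qed.

Lemma gain_total :
  (\esum_(i in supp z) frag_gain i =
   (\sum_(l < n.+1) replace_sum z l + \sum_(l < n.+1) replace_sum z l) +
   (\sum_(l < n.+1) \sum_(m < n.+1 | (l < m)%N) split_sum z l m +
    \sum_(l < n.+1) \sum_(m < n.+1 | (l < m)%N) split_sum z l m))%E.
Proof.
pose G1 (l : 'I_n.+1) i s := (\int[mu]_(y in `]0%R, z i[) (F y (z i - y)%R *
  h (set_nth 0%R (map z s) l (z i - y)))%:E)%E.
pose G2 (l : 'I_n.+1) i s := (\int[mu]_(y in `]0%R, z i[) (F y (z i - y)%R *
  h (set_nth 0%R (map z s) l y))%:E)%E.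
pose G3 (m : 'I_n.+1) (l : 'I_n) i s := (\int[mu]_(y in `]0%R, z i[)
  (F y (z i - y)%R * h (ins m y (set_nth 0%R (map z s) l (z i - y))))%:E)%E.
have G1_ge0 l i s : (0 <= G1 l i s)%E by exact: weighted_ge0.
have G2_ge0 l i s : (0 <= G2 l i s)%E by exact: weighted_ge0.
have G3_ge0 m l i s : (0 <= G3 m l i s)%E by exact: weighted_ge0.
pose T1 (l : 'I_n.+1) i := (\esum_(s in idx n.+1 z) if nth 0%N s l == i then G1 l i s else 0)%E.
pose T2 (l : 'I_n.+1) i := (\esum_(s in idx n.+1 z) if nth 0%N s l == i then G2 l i s else 0)%E.
pose T3 (m : 'I_n.+1) (l : 'I_n) i := (\esum_(s in idx n z) if nth 0%N s l == i then G3 m l i s else 0)%E.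
have T1_ge0 l i : (0 <= T1 l i)%E by apply: esum_ge0 => s _; case: ifP.
have T2_ge0 l i : (0 <= T2 l i)%E by apply: esum_ge0 => s _; case: ifP.
have T3_ge0 m l i : (0 <= T3 m l i)%E by apply: esum_ge0 => s _; case: ifP.
have S3_ge0 m i : (0 <= \sum_(l < n) T3 m l i)%E by apply: sume_ge0.
have S23_ge0 m i : (0 <= T2 m i + \sum_(l < n) T3 m l i)%E by apply: adde_ge0.
transitivity (\esum_(i in supp z) (\sum_(l < n.+1) T1 l i +
  \sum_(m < n.+1) (T2 m i + \sum_(l < n) T3 m l i)))%E.
  by apply: eq_esum => i zi; rewrite frag_gainE.
rewrite esumD; last 2 first.
- by move=> i _; exact: sume_ge0.
- by move=> i _; exact: sume_ge0.
rewrite !esum_sum//.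
have E2 l : (\esum_(i in supp z) T2 l i = replace_sum z l)%E.
  by rewrite (@esum_nth _ n.+1 z l _ (G2 l)).
have E1 l : (\esum_(i in supp z) T1 l i = replace_sum z l)%E.
  rewrite (@esum_nth _ n.+1 z l _ (G1 l))//.
  by apply: eq_esum => s si; exact: reflected.
have E3 m l : (\esum_(i in supp z) T3 m l i =
    if (l < m)%N then split_sum z l m else split_sum z m l.+1)%E.
  by rewrite (@esum_nth _ n z l _ (G3 m l))//; exact: split_term.
rewrite (eq_bigr _ (fun l _ => E1 l)) -addeA -sum_ord_offdiag; congr (_ + _)%E.
rewrite -big_split/=; apply: eq_bigr => m _; rewrite esumD// E2; congr (_ + _)%E.
by rewrite esum_sum//; apply: eq_bigr => l _; exact: E3.
Qed.

Lemma lim_frag_term_corr :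
  (\esum_(i in supp z) frag_gain i < +oo)%E ->
  (\sum_(l < n.+1) loss_sum z l < +oo)%E ->
  limn (series (frag_term F (fun z => fine (corr n.+1 h z)) z)) =
  fine (\esum_(i in supp z) frag_gain i)%E - fine (\sum_(l < n.+1) loss_sum z l)%E.
Proof.
rewrite -loss_total => gfin lfin.
have g0 i : (0 <= frag_gain i)%E.
  apply: integral_ge0 => y; rewrite /= in_itv/= => yz; rewrite mule_ge0//.
  exact: (F_total_ge0 KF).
have l0 i : (0 <= frag_loss i)%E.
  apply: integral_ge0 => y; rewrite /= in_itv/= => yz; rewrite mule_ge0//.
  exact: (F_total_ge0 KF).
have gi i : 0 < z i -> (frag_gain i < +oo)%E.
  by move=> zi; apply: le_lt_trans gfin; exact: esum_term_le.
have li i : 0 < z i -> (frag_loss i < +oo)%E.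
  by move=> zi; have [] := frag_term_corr zi (gi _ zi).
pose b (X : nat -> \bar R) i := if 0 < z i then fine (X i) else 0.
have bE (X : nat -> \bar R) : (forall i, 0 <= X i)%E ->
    (forall i, (0 < z i)%R -> X i < +oo)%E ->
    (\sum_(0 <= i <oo) (b X i)%:E = \esum_(i in supp z) X i)%E.
  move=> X0 Xf; rewrite -nneseries_supp//; apply: eq_eseriesr => i _.
  rewrite /b; case: (boolP (0 < z i)) => // zi.
  by rewrite fineK// ge0_fin_numE// Xf.
rewrite -!bE// -lim_series_diff ?bE//.
- congr (limn (series _)); apply/funext => i; rewrite /b.
  case: (boolP (0 < z i)) => zi; first by have [] := frag_term_corr zi (gi _ zi).
  by rewrite subrr /frag_term (negbTE zi).
- by move=> i; rewrite /b; case: ifP => // _; exact: fine_ge0.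
- by move=> i; rewrite /b; case: ifP => // _; exact: fine_ge0.
Qed.

End state.

Definition gain_sum (z : nat -> R) : \bar R :=
  (2^-1%:E * \sum_(l < n.+1) coag_sum K n h z l +
   (\sum_(l < n.+1) replace_sum z l +
    \sum_(l < n.+1) \sum_(m < n.+1 | (l < m)%N) split_sum z l m))%E.

Definition lost_sum (z : nat -> R) : \bar R :=
  (2^-1%:E * \sum_(l < n.+1) loss_sum z l +
   (\sum_(l < n.+1) drop_sum K n h z l +
    \sum_(l < n.+1) \sum_(m < n.+1 | (l < m)%N) pair_sum K n h z l m))%E.

Lemma gen_L_corr (z : mseq R) : Omega z ->
  (gain_sum z < +oo)%E -> (lost_sum z < +oo)%E ->
  gen_L K F (fun z => fine (corr n.+1 h z)) z =
  fine (gain_sum z) - fine (lost_sum z).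
Proof.
move=> Oz gfin lfin.
have Kh0 k s l m x : idx k z s -> (l < k)%N -> (m < k)%N ->
    (0 <= (K (z (nth 0%N s l)) (z (nth 0%N s m)) * h x)%:E)%E.
  move=> [sk us zs] lk mk; rewrite lee_fin mulr_ge0//.
  by rewrite (rkK_ge0 KF) ?zs// mem_nth ?sk.
have Fh0 k s l (G : R -> R) : idx k z s -> (forall y, 0 <= G y) ->
    (0 <= \int[mu]_(y in `]0%R, z (nth 0%N s l)[)
      (F y (z (nth 0%N s l) - y)%R * G y)%:E)%E.
  move=> si G0; apply: integral_ge0 => y; rewrite /= in_itv/= => yz.
  by rewrite EFinM mule_ge0 ?lee_fin//; exact: (F_total_ge0 KF).
set A := (\sum_(l < n.+1) coag_sum K n h z l)%E.
set B := (\sum_(l < n.+1) replace_sum z l)%E.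
set D := (\sum_(l < n.+1) \sum_(m < n.+1 | (l < m)%N) split_sum z l m)%E.
set A' := (\sum_(l < n.+1) loss_sum z l)%E.
set B' := (\sum_(l < n.+1) drop_sum K n h z l)%E.
set D' := (\sum_(l < n.+1) \sum_(m < n.+1 | (l < m)%N) pair_sum K n h z l m)%E.
have A0 : (0 <= A)%E.
  apply: sume_ge0 => l _; apply: esum_ge0 => s si.
  by apply: (Kh0 _ _ _ _ _ si); have := ltn_ord l; lia.
have B'0 : (0 <= B')%E.
  apply: sume_ge0 => l _; apply: esum_ge0 => s si.
  by apply: (Kh0 _ _ _ _ _ si); have := ltn_ord l; lia.
have D'0 : (0 <= D')%E.
  apply: sume_ge0 => l _; apply: sume_ge0 => m _; apply: esum_ge0 => s si.
  exact: (Kh0 _ _ _ _ _ si).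
have B0 : (0 <= B)%E.
  by apply: sume_ge0 => l _; apply: esum_ge0 => s si; exact: (Fh0 _ _ _ _ si).
have A'0 : (0 <= A')%E.
  by apply: sume_ge0 => l _; apply: esum_ge0 => s si; exact: (Fh0 _ _ _ _ si).
have D0 : (0 <= D)%E.
  apply: sume_ge0 => l _; apply: sume_ge0 => m _; apply: esum_ge0 => s si.
  exact: (Fh0 _ _ _ _ si).
have h2 : (0 < 2^-1 :> R) by [].
have half_ge0 (x : \bar R) : (0 <= x -> 0 <= 2^-1%:E * x)%E.
  by move=> x0; rewrite mule_ge0// lee_fin.
have half_fin (x : \bar R) : (0 <= x -> 2^-1%:E * x < +oo -> x \is a fin_num)%E.
  move=> x0 xf; rewrite ge0_fin_numE//; case: x x0 xf => // [r _ _|_]; first by rewrite ltry.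
  by rewrite gt0_muley ?lte_fin.
have gf : (2^-1%:E * A + (B + D) \is a fin_num)%E.
  by rewrite ge0_fin_numE// !adde_ge0// half_ge0.
have lf : (2^-1%:E * A' + (B' + D') \is a fin_num)%E.
  by rewrite ge0_fin_numE// !adde_ge0// half_ge0.
have [Af Bf Df] : [/\ A \is a fin_num, B \is a fin_num & D \is a fin_num].
  move: gf; rewrite !fin_numD => /and3P[Af -> ->]; split => //.
  by apply: half_fin => //; rewrite -ge0_fin_numE ?half_ge0.
have [A'f B'f D'f] : [/\ A' \is a fin_num, B' \is a fin_num & D' \is a fin_num].
  move: lf; rewrite !fin_numD => /and3P[Af' -> ->]; split => //.
  by apply: half_fin => //; rewrite -ge0_fin_numE ?half_ge0.
have pairE : (\sum_(m < n.+1) (drop_sum K n h z m +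
     \sum_(l < n.+1 | l != m) pair_sum K n h z l m) = B' + (D' + D'))%E.
  rewrite big_split/=; congr (_ + _)%E; rewrite -sum_ord_neq// => l m ln mn.
  apply: eq_esum => s [sk us zs]; congr (_ * _)%:E.
  by rewrite (rkK_sym KF)// zs// mem_nth ?sk.
have gE := gain_total z; rewrite -/B -/D in gE.
set Phi := (fun z => _).
transitivity (2^-1 * coag_part K Phi z + 2^-1 * limn (series (frag_term F Phi z))) => //.
have cE : coag_part K Phi z = fine A - fine (B' + (B' + (D' + D')))%E.
  rewrite -pairE; apply: (coag_part_corr KF h0 corr_fin Oz).
    by rewrite -ge0_fin_numE.
  rewrite [X in (_ + X)%E]pairE -ge0_fin_numE ?fin_numD ?B'f ?D'f//.
  by rewrite !adde_ge0.
rewrite cE lim_frag_term_corr//; last 2 first.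
- by rewrite gE -ge0_fin_numE ?fin_numD ?Bf ?Df// !adde_ge0.
- by rewrite -ge0_fin_numE.
rewrite gE /gain_sum /lost_sum -/A -/B -/D -/A' -/B' -/D'.
rewrite -(fineK Af) -(fineK Bf) -(fineK Df) -(fineK A'f) -(fineK B'f) -(fineK D'f).
rewrite -!(EFinD, EFinM)/=; lra.
Qed.

End fragmentation.

Section tuples.
Context {R : realType}.
Implicit Types k l : nat.

Definition tup k (x : seq R) : k.-tuple R := [tuple x`_i | i < k].

Lemma nth_mktuple_nat k (g : nat -> R) i : (i < k)%N ->
  [tuple g i | i < k]`_i = g i.
Proof. by move=> ik; rewrite -(tnth_nth 0 _ (Ordinal ik)) tnth_mktuple. Qed.

Lemma nth_tup k (x : seq R) i : (i < k)%N -> (tup k x)`_i = x`_i.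
Proof. by move=> ik; rewrite (nth_mktuple_nat (nth 0 x)). Qed.

Lemma posP k (z : k.-tuple R) : pos k z <-> forall i, (i < k)%N -> 0 < z`_i.
Proof.
split => [zp i ik|zp i]; last by rewrite (tnth_nth 0); exact: zp.
by have := zp (Ordinal ik); rewrite (tnth_nth 0).
Qed.

Lemma measurable_nth_tuple k i (D : set (k.-tuple R)) :
  measurable_fun D (fun z : k.-tuple R => z`_i).
Proof.
apply: measurable_funTS; case: (ltnP i k) => ik.
  apply: (@eq_measurable_fun _ _ _ _ _ (fun z : k.-tuple R => tnth z (Ordinal ik))).
    by move=> z _; rewrite (tnth_nth 0).
  exact: measurable_tnth.
apply: (@eq_measurable_fun _ _ _ _ _ (fun _ : k.-tuple R => 0 : R)); last exact: measurable_cst.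
by move=> z _; rewrite nth_default// size_tuple.
Qed.

Lemma measurable_mktuple d (T : measurableType d) k (g : T -> nat -> R) :
  (forall i, (i < k)%N -> measurable_fun setT (fun x => g x i)) ->
  measurable_fun setT (fun x => [tuple g x i | i < k]).
Proof.
move=> mg; apply/measurable_fun_tnthP => i.
apply: (@eq_measurable_fun _ _ _ _ _ (fun x => g x i)); last exact: mg.
by move=> x _; rewrite /= tnth_mktuple.
Qed.

Lemma measurable_pos k : measurable (@pos R k).
Proof.
have -> : pos k = \bigcap_(i in [set: 'I_k]) [set z : k.-tuple R | 0 < tnth z i].
  by apply/seteqP; split => [z zp i _|z zp i]; [exact: zp|exact: (zp i)].
apply: fin_bigcap_measurable => [|i _]; first exact: finite_finset.
have := @measurable_tnth _ _ k i measurableT _ (@measurable_itv R `]0, +oo[).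
by rewrite setTI; congr measurable; apply/seteqP; split => z /=; rewrite in_itv/= andbT.
Qed.

Lemma measurable_coag k l : measurable_fun setT (@coag R k l).
Proof.
apply: (@measurable_mktuple _ _ k (fun (z : k.+1.-tuple R) i =>
  if (i < l)%N then z`_i else if i == l then z`_l + z`_l.+1 else z`_i.+1)) => i ik.
case: (i < l)%N; first exact: measurable_nth_tuple.
case: (i == l); last exact: measurable_nth_tuple.
by apply: measurable_funD; exact: measurable_nth_tuple.
Qed.

Lemma measurable_drop_coord k m l : measurable_fun setT (@drop_coord R k m l).
Proof.
apply: (@measurable_mktuple _ _ k (fun (z : m.-tuple R) i =>
  if (i < l)%N then z`_i else z`_i.+1)) => i ik.
by case: (i < l)%N; exact: measurable_nth_tuple.
Qed.

Lemma measurable_nth_fst k i :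
  measurable_fun setT (fun p : k.-tuple R * R => p.1`_i).
Proof.
apply: (measurableT_comp (@measurable_nth_tuple k i setT)).
exact: measurable_fst.
Qed.

Lemma measurable_replace_coord k l :
  measurable_fun setT (fun p : k.-tuple R * R => replace_coord l p.2 p.1).
Proof.
apply: (@measurable_mktuple _ _ k (fun (p : k.-tuple R * R) i => if i == l then p.2 else p.1`_i)) => i ik.
by case: (i == l); [exact: measurable_snd|exact: measurable_nth_fst].
Qed.

Lemma measurable_frag n l m :
  measurable_fun setT (fun p : n.-tuple R * R => @frag R n.+1 l m p.2 p.1).
Proof.
apply: (@measurable_mktuple _ _ n.+1 (fun (p : n.-tuple R * R) i => if i == l then p.2 else
  if (i < m)%N then p.1`_i else if i == m then p.1`_l - p.2 else p.1`_i.-1)) => i ik.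
case: (i == l); first exact: measurable_snd.
case: (i < m)%N; first exact: measurable_nth_fst.
case: (i == m); last exact: measurable_nth_fst.
by apply: measurable_funB; [exact: measurable_nth_fst|exact: measurable_snd].
Qed.

Lemma nth_coag k l (z : k.+1.-tuple R) i : (i < k)%N ->
  (coag l z)`_i = if (i < l)%N then z`_i else if i == l then z`_l + z`_l.+1
                  else z`_i.+1.
Proof. by move=> ik; rewrite (nth_mktuple_nat (fun i => if (i < l)%N then z`_i else if i == l then z`_l + z`_l.+1 else z`_i.+1)). Qed.

Lemma nth_drop_coord k m l (z : m.-tuple R) i : (i < k)%N ->
  (drop_coord k l z)`_i = if (i < l)%N then z`_i else z`_i.+1.
Proof. by move=> ik; rewrite (nth_mktuple_nat (fun i => if (i < l)%N then z`_i else z`_i.+1)). Qed.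

Lemma nth_replace_coord k l y (z : k.-tuple R) i : (i < k)%N ->
  (replace_coord l y z)`_i = if i == l then y else z`_i.
Proof. by move=> ik; rewrite (nth_mktuple_nat (fun i => if i == l then y else z`_i)). Qed.

Lemma nth_frag n l m y (z : n.-tuple R) i : (i < n.+1)%N ->
  (@frag R n.+1 l m y z)`_i = if i == l then y else if (i < m)%N then z`_i else
     if i == m then z`_l - y else z`_i.-1.
Proof. by move=> ik; rewrite (nth_mktuple_nat (fun i => if i == l then y else if (i < m)%N then z`_i else
     if i == m then z`_l - y else z`_i.-1)). Qed.

Lemma pos_coag k l (z : k.+1.-tuple R) : (l < k)%N -> pos k.+1 z -> pos k (coag l z).
Proof.
move=> lk /posP zp; apply/posP => i ik; rewrite nth_coag//.
case: ifP => _; first by apply: zp; lia.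
by case: ifP => _; [apply: addr_gt0|]; apply: zp; lia.
Qed.

Lemma pos_drop_coord k l (z : k.+1.-tuple R) : pos k.+1 z -> pos k (drop_coord k l z).
Proof.
move=> /posP zp; apply/posP => i ik; rewrite nth_drop_coord//.
by case: ifP => _; apply: zp; lia.
Qed.

Lemma pos_replace_coord k l y (z : k.-tuple R) : 0 < y -> pos k z ->
  pos k (replace_coord l y z).
Proof.
move=> y0 /posP zp; apply/posP => i ik; rewrite nth_replace_coord//.
by case: ifP => _ //; apply: zp; lia.
Qed.

Lemma pos_frag n l m y (z : n.-tuple R) : (l < m < n.+1)%N -> pos n z -> 0 < y < z`_l ->
  pos n.+1 (@frag R n.+1 l m y z).
Proof.
move=> /andP[lm mn] /posP zp /andP[y0 yz]; apply/posP => i ik; rewrite nth_frag//.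
case: ifP => // _; case: (ltngtP i m) => im; last by rewrite subr_gt0.
  by apply: zp; lia.
by apply: zp; lia.
Qed.

(** * Test functions *)

Lemma compact_in_pos_lb k (S : set (k.-tuple R)) : compact_in_pos S ->
  exists2 e : R, 0 < e <= 1 & forall z, S z -> forall i, (i < k)%N -> e <= z`_i.
Proof.
move=> [Sp cS].
have /choice[e eP] : forall i : 'I_k, exists e : R,
    0 < e /\ forall z, S z -> e <= tnth z i.
  move=> i.
  pose pr : prod_topology (fun _ : 'I_k => R) -> R := proj i.
  have cI : compact [set pr x | x in
      [set (tnth z : prod_topology (fun _ : 'I_k => R)) | z in S]].
    by apply: continuous_compact => //; apply: continuous_subspaceT; exact: proj_continuous.
  have clI := compact_closed (@Rhausdorff R) cI.
  have n0 : ~ [set pr x | x in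
      [set (tnth z : prod_topology (fun _ : 'I_k => R)) | z in S]] 0.
    by move=> [_ [z Sz <-]] zi0; have := Sp _ Sz i; rewrite -[tnth z i]/(pr _) zi0 ltxx.
  have := open_nbhs_nbhs (conj (closed_openC clI) n0).
  move=> /nbhs_ballP[e /= e0 eP]; exists e; split => // z Sz.
  rewrite leNgt; apply/negP => ze; apply: (eP (tnth z i)).
    by rewrite /ball/= sub0r normrN gtr0_norm// Sp.
  by exists (tnth z) => //; exists z.
exists (\big[Num.min/1]_i e i).
  rewrite bigmin_le_id andbT; apply: lt_bigmin => // i _; by have [] := eP i.
move=> z Sz i ik; apply: le_trans (bigmin_le _ (Ordinal ik) _) _.
by have [_ /(_ _ Sz)] := eP (Ordinal ik); rewrite (tnth_nth 0).
Qed.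

Lemma test_function_bound k (f : k.-tuple R -> R) : test_function f ->
  exists M e, [/\ 0 <= M, 0 < e <= 1, forall z, pos k z -> f z <= M &
    forall z, pos k z -> f z != 0 -> forall i, (i < k)%N -> e <= z`_i].
Proof.
move=> [mf f0 [M fM] [S [cS fS]]]; have [e e01 eP] := compact_in_pos_lb cS.
exists `|M|, e; split => // [z zp|z zp fz i ik].
  exact: le_trans (fM _ zp) (ler_norm _).
by apply: eP => //; apply: contrapT => nSz; rewrite fS ?eqxx in fz.
Qed.

End tuples.

Section correlation_sums.
Context {R : realType}.
Notation lebesgue := (@lebesgue_measure R).

Definition corr_sum k (Q : k.-tuple R -> \bar R) (z : mseq R) : \bar R :=
  (\esum_(s in idx k z) Q (tup k (map z s)))%E.

Lemma nth_tup_map k (z : nat -> R) s i : size s = k -> (i < k)%N ->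
  (tup k (map z s))`_i = z (nth 0%N s i).
Proof. by move=> sk ik; rewrite nth_tup// (nth_map 0%N) ?sk. Qed.

Lemma pos_tup_idx k (z : nat -> R) s : idx k z s -> pos k (tup k (map z s)).
Proof.
move=> [sk us zs]; apply/posP => i ik.
by rewrite nth_tup_map// zs// mem_nth ?sk.
Qed.

Lemma measurable_tup_map k s :
  measurable_fun setT (fun z : mseq R => tup k (map z s)).
Proof.
apply: (@measurable_mktuple _ _ _ k (fun (z : mseq R) i => (map z s)`_i)) => i ik.
case: (ltnP i (size s)) => is_.
  apply: (@eq_measurable_fun _ _ _ _ _ (fun z : mseq R => z (nth 0%N s i))).
    by move=> z _; rewrite (nth_map 0%N).
  exact: measurable_coord.
apply: (@eq_measurable_fun _ _ _ _ _ (fun z : mseq R => 0 : R)); last exact: measurable_cst.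
by move=> z _; rewrite nth_default// size_map.
Qed.

Lemma prod_tup_map k (z : nat -> R) s : size s = k ->
  \prod_(i < k) (tup k (map z s))`_i = \prod_(n <- s) z n.
Proof.
move=> sk; rewrite [RHS](big_nth 0%N) big_mkord sk.
by apply: eq_bigr => i _; rewrite nth_tup_map.
Qed.

Definition dom (Psi : mseq R -> \bar R) : Prop := exists D p, dominated Psi D p.

Section domination.
Variables (k : nat) (Q : k.-tuple R -> \bar R).
Hypotheses (mQ : measurable_fun (pos k) Q) (Q0 : forall z, pos k z -> (0 <= Q z)%E).

Lemma measurable_corr_sum : measurable_fun (@Omega R) (corr_sum Q).
Proof.
pose D s : set (mseq R) := [set z | pos k (tup k (map z s))].
have mD s : measurable (D s).
  rewrite -[D s]setTI.
  exact: (@measurable_tup_map k s measurableT _ (@measurable_pos R k)).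
apply: (@eq_measurable_fun _ _ _ _ _ (fun z : mseq R =>
    \esum_(s in [set s : seq nat | size s = k /\ uniq s])
      ((fun z => Q (tup k (map z s))) \_ (D s)) z)%E).
  move=> z _; rewrite /corr_sum.
  rewrite (_ : idx k z = [set s | size s = k /\ uniq s] `&`
    [set s | D s z]); last first.
    apply/seteqP; split => [s si|s [[sk us] /= /posP zs]].
      by case: (si) => sk us _; split => //; exact: pos_tup_idx.
    split => // n ns; have ik : (index n s < k)%N by rewrite -sk index_mem.
    by have := zs _ ik; rewrite nth_tup_map// nth_index.
  rewrite [RHS]esum_mkcondr; apply: eq_esum => s _; rewrite patchE.
  by congr (if _ then _ else _); apply/idP/idP => /set_mem ?; exact: mem_set.
apply: (@measurable_esum _ _ _ _ _ _ (fun s => (fun z => Q (tup k (map z s))) \_ (D s))).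
  move=> s z _ _; rewrite patchE; case: (boolP (z \in D s)) => // /set_mem; exact: Q0.
move=> s _; apply: measurable_funTS.
apply: ((measurable_restrictT (fun z : mseq R => Q (tup k (map z s))) (mD s)).1).
apply: (measurable_comp_on (@measurable_pos R k) _ mQ); first by [].
by apply: measurable_funTS; exact: measurable_tup_map.
Qed.

Variables (B : R) (p : nat).
Hypothesis B0 : 0 <= B.

Lemma dominated_corr_sum :
  (forall z, pos k z ->
    (Q z <= (B * (1 + \sum_(i < k) z`_i) ^+ p * \prod_(i < k) z`_i)%:E)%E) ->
  dominated (corr_sum Q) (B * (1 + k%:R) ^+ p) (p + k).
Proof.
move=> QB; split; first exact: measurable_corr_sum.
move=> z Oz; apply/andP; split.
  by apply: esum_ge0 => s si; apply: Q0; exact: pos_tup_idx.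
have m0 := mass_gt0 Oz; set m := mass z in m0 *.
set c := B * ((1 + k%:R) * (1 + m)) ^+ p.
have c0 : 0 <= c by rewrite mulr_ge0// exprn_ge0// mulr_ge0 ?addr_ge0// ltW.
apply: (@le_trans _ _ (\esum_(s in idx k z) (c%:E * (\prod_(n <- s) z n)%:E))%E).
  apply: le_esum => s si; apply: (le_trans (QB _ (pos_tup_idx si))).
  have [sk us zs] := si; rewrite prod_tup_map// -EFinM lee_fin.
  apply: ler_wpM2r; first by apply: prodr_ge0 => n _; exact: z_ge0.
  rewrite /c ler_wpM2l// lerXn2r ?nnegrE//.
  - by rewrite addr_ge0// sumr_ge0// => i _; apply/ltW; move/posP: (pos_tup_idx si); apply.
  - by rewrite mulr_ge0// addr_ge0// ltW.
  have sle : \sum_(i < k) (tup k (map z s))`_i <= k%:R * m.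
    apply: (@le_trans _ _ (\sum_(i < k) m)); last first.
      by rewrite sumr_const card_ord mulr_natl.
    by apply: ler_sum => i _; rewrite nth_tup_map// z_le_mass.
  have k0 : 0 <= k%:R :> R by [].
  rewrite (_ : _ * _ = 1 + m + k%:R + k%:R * m); last by lra.
  by rewrite -!addrA lerD2l; lra.
rewrite esumZl//; last by move=> s; rewrite lee_fin prodr_ge0// => n _; exact: z_ge0.
apply: (@le_trans _ _ (c%:E * (m ^+ k)%:E)%E).
  rewrite lee_wpmul2l ?lee_fin//; apply: esum_idx_prod_le; first exact: z_ge0.
  by have [_ _ <-] := OmegaP Oz.
rewrite -EFinM lee_fin /c exprMn exprD !mulrA ler_wpM2l//.
  by rewrite !mulr_ge0// ?exprn_ge0// ?addr_ge0// ltW.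
by rewrite lerXn2r ?nnegrE// ?addr_ge0 ?lerDr// ltW.
Qed.


(* Coordinates on which the integrand is supported away from 0 may be inserted
   into the product. *)
Lemma prod_insert (S : pred nat) e (z : k.-tuple R) : 0 < e <= 1 -> pos k z ->
  (forall i, (i < k)%N -> ~~ S i -> e <= z`_i) ->
  \prod_(i < k | S i) z`_i <= e ^- k * \prod_(i < k) z`_i.
Proof.
move=> /andP[e0 e1] /posP zp zS; have e_ge0 := ltW e0.
rewrite mulrC ler_pdivlMr ?exprn_gt0//.
rewrite [leRHS](bigID (fun i : 'I_k => S i))/= ler_wpM2l ?prodr_ge0//.
  by move=> i _; apply/ltW/zp.
rewrite big_mkcond/= -[k in e ^+ k]card_ord -prodr_const; apply: ler_prod => i _.
rewrite e_ge0/=; case: ifPn => // Si; exact: zS.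
Qed.

End domination.

Lemma dom_corr_sum k (Q : k.-tuple R -> \bar R) (B : R) p (S : pred nat) e :
  measurable_fun (pos k) Q -> (forall z, pos k z -> (0 <= Q z)%E) ->
  0 <= B -> 0 < e <= 1 ->
  (forall z, pos k z -> Q z != 0%E -> forall i, (i < k)%N -> ~~ S i -> e <= z`_i) ->
  (forall z, pos k z ->
    (Q z <= (B * (1 + \sum_(i < k) z`_i) ^+ p * \prod_(i < k | S i) z`_i)%:E)%E) ->
  dom (corr_sum Q).
Proof.
move=> mQ Q0 B0 e01 supQ QB; have /andP[e0 _] := e01.
have e_ge0 : 0 <= e ^- k by rewrite invr_ge0 exprn_ge0// ltW.
exists (B * e ^- k * (1 + k%:R) ^+ p), (p + k)%N.
apply: (dominated_corr_sum mQ Q0); first exact: mulr_ge0.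
move=> z zp; have z0 i : (i < k)%N -> 0 <= z`_i.
  by move=> ik; apply/ltW; move/posP : zp; apply.
have s0 : 0 <= 1 + \sum_(i < k) z`_i by rewrite addr_ge0// sumr_ge0// => i _; exact: z0.
have [->|Qz] := eqVneq (Q z) 0%E.
  rewrite lee_fin !mulr_ge0// ?exprn_ge0// prodr_ge0// => i _; exact: z0.
apply: (le_trans (QB _ zp)); rewrite lee_fin.
rewrite (_ : _ * _ * _ * _ = B * (1 + \sum_(i < k) z`_i) ^+ p *
  (e ^- k * \prod_(i < k) z`_i)); last by lra.
by rewrite ler_wpM2l ?mulr_ge0 ?exprn_ge0//; apply: prod_insert => //; exact: supQ.
Qed.

Lemma dominatedD (Psi1 Psi2 : mseq R -> \bar R) D1 D2 p1 p2 :
  dominated Psi1 D1 p1 -> dominated Psi2 D2 p2 -> 0 <= D1 -> 0 <= D2 ->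
  dominated (fun z => Psi1 z + Psi2 z)%E (D1 + D2) (maxn p1 p2).
Proof.
move=> [m1 b1] [m2 b2] D10 D20; split; first exact: emeasurable_funD.
move=> z Oz; have /andP[u1 v1] := b1 _ Oz; have /andP[u2 v2] := b2 _ Oz.
rewrite adde_ge0//=; apply: (le_trans (leeD v1 v2)).
have m0 := mass_gt0 Oz; have m1' : 1 <= 1 + mass z by rewrite lerDl ltW.
rewrite -EFinD lee_fin mulrDl.
by rewrite lerD// ler_wpM2l// ler_weXn2l// ?leq_maxl ?leq_maxr.
Qed.

End correlation_sums.

Section expectations.
Context {R : realType}.
Notation lebesgue := (@lebesgue_measure R).
Variables (lambda C : R) (K F : R -> R -> R).
Hypothesis KF : rate_kernels lambda C K F.
Context d (T : measurableType d) (P : probability T R).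
Variable Z : R -> T -> mseq R.
Hypothesis evZ : evolves K F P Z.
Hypothesis moments : forall p, (\int[P]_w ((1 + mass (Z 0 w)) ^+ p)%:E < +oo)%E.

Let OZ := let: And3 _ h _ := evZ in h.

Lemma domD (Psi1 Psi2 : mseq R -> \bar R) : dom Psi1 -> dom Psi2 ->
  dom (fun z => Psi1 z + Psi2 z)%E.
Proof.
move=> [D1 [p1 d1]] [D2 [p2 d2]]; exists (D1 + D2), (maxn p1 p2).
by apply: dominatedD => //; [exact: (dominated_D evZ d1)|exact: (dominated_D evZ d2)].
Qed.

Lemma dom0 : dom (fun _ : mseq R => 0%E).
Proof.
by exists 0, 0%N; split => [|z _]; [exact: measurable_cst|rewrite mul0r lexx].
Qed.

Lemma domZ c (Psi : mseq R -> \bar R) : 0 <= c -> dom Psi -> dom (fun z => c%:E * Psi z)%E.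
Proof.
move=> c0 [D [p [mPsi bPsi]]]; exists (c * D), p; split.
  by apply: emeasurable_funM => //; exact: measurable_cst.
move=> z Oz; have /andP[u v] := bPsi _ Oz.
by rewrite mule_ge0//= -mulrA EFinM lee_wpmul2l.
Qed.

Lemma dom_sum (I : Type) (r : seq I) (c : pred I) (Psi : I -> mseq R -> \bar R) :
  (forall i, c i -> dom (Psi i)) -> dom (fun z => \sum_(i <- r | c i) Psi i z)%E.
Proof.
move=> dPsi; elim: r => [|i r IH].
  by under eq_fun do rewrite big_nil; exact: dom0.
under eq_fun do rewrite big_cons; case: (boolP (c i)) => // ci.
by apply: domD => //; exact: dPsi.
Qed.

Definition time_integral (t : R) (Psi : mseq R -> \bar R) : \bar R :=
  (\int[lebesgue]_(s in `[0%R, t]) \int[P]_w Psi (Z s w))%E.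

Lemma dom_measurable (Psi : mseq R -> \bar R) s : dom Psi -> 0 <= s ->
  measurable_fun setT (fun w => Psi (Z s w)).
Proof. by move=> [D [p [mPsi _]]] s0; exact: (measurable_comp_Z evZ). Qed.

Lemma dom_ge0 (Psi : mseq R -> \bar R) s w : dom Psi -> 0 <= s -> (0 <= Psi (Z s w))%E.
Proof. by move=> [D [p [_ bPsi]]] s0; have /andP[] := bPsi _ (OZ w s0). Qed.

Lemma expectationD (Psi1 Psi2 : mseq R -> \bar R) s : dom Psi1 -> dom Psi2 -> 0 <= s ->
  (\int[P]_w (Psi1 (Z s w) + Psi2 (Z s w)) =
   \int[P]_w Psi1 (Z s w) + \int[P]_w Psi2 (Z s w))%E.
Proof.
move=> d1 d2 s0; rewrite ge0_integralD//.
- by move=> w _; exact: dom_ge0.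
- exact: dom_measurable.
- by move=> w _; exact: dom_ge0.
- exact: dom_measurable.
Qed.

Lemma time_integralD t (Psi1 Psi2 : mseq R -> \bar R) : dom Psi1 -> dom Psi2 ->
  (time_integral t (fun z => Psi1 z + Psi2 z) =
   time_integral t Psi1 + time_integral t Psi2)%E.
Proof.
move=> d1 d2; rewrite /time_integral.
transitivity (\int[lebesgue]_(s in `[0%R, t]) (\int[P]_w Psi1 (Z s w) +
   \int[P]_w Psi2 (Z s w)))%E.
  apply: eq_integral => s /set_mem; rewrite /= in_itv/= => /andP[s0 _].
  exact: expectationD.
have sub : `[0, t] `<=` `[(0 : R), +oo[.
  by move=> s /=; rewrite !in_itv/= => /andP[->].
have mE Psi : dom Psi -> measurable_fun `[0, t] (fun s => \int[P]_w Psi (Z s w))%E.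
  by move=> [D [p dPsi]]; apply: measurable_funS sub (measurable_expectation KF evZ dPsi).
have E0 Psi s : dom Psi -> `[0, t]%classic s -> (0 <= \int[P]_w Psi (Z s w))%E.
  move=> dPsi /sub; rewrite /= in_itv/= andbT => s0.
  by apply: integral_ge0 => w _; exact: dom_ge0.
rewrite ge0_integralD//.
- by move=> s; exact: E0.
- exact: mE.
- by move=> s; exact: E0.
- exact: mE.
Qed.

Lemma time_integralZ t c (Psi : mseq R -> \bar R) : 0 <= c -> dom Psi ->
  (time_integral t (fun z => c%:E * Psi z) = c%:E * time_integral t Psi)%E.
Proof.
move=> c0 dPsi; rewrite /time_integral.
have sub : `[0, t] `<=` `[(0 : R), +oo[.
  by move=> s /=; rewrite !in_itv/= => /andP[->].
rewrite -ge0_integralZl_EFin//; last 2 first.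
- move=> s /sub; rewrite /= in_itv/= andbT => s0.
  by apply: integral_ge0 => w _; exact: dom_ge0.
- have [D [p dP]] := dPsi.
  by apply: measurable_funS sub (measurable_expectation KF evZ dP).
apply: eq_integral => s /set_mem; rewrite /= in_itv/= => /andP[s0 _].
rewrite ge0_integralZl_EFin//.
- by move=> w _; exact: dom_ge0.
- exact: dom_measurable.
Qed.

Lemma time_integral0 t : time_integral t (fun=> 0%E) = 0%E.
Proof.
rewrite /time_integral integral0_eq// => s _; exact: integral0.
Qed.

Lemma time_integral_sum t (I : Type) (r : seq I) (c : pred I) (Psi : I -> mseq R -> \bar R) :
  (forall i, c i -> dom (Psi i)) ->
  (time_integral t (fun z => \sum_(i <- r | c i) Psi i z) =
   \sum_(i <- r | c i) time_integral t (Psi i))%E.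
Proof.
move=> dPsi; elim: r => [|i r IH].
  by rewrite big_nil; under eq_fun do rewrite big_nil; exact: time_integral0.
rewrite big_cons; under eq_fun do rewrite big_cons; case: (boolP (c i)) => // ci.
rewrite time_integralD ?IH//; first exact: dPsi.
exact: dom_sum.
Qed.

Lemma time_integral_fin t (Psi : mseq R -> \bar R) : 0 <= t -> dom Psi ->
  time_integral t Psi \is a fin_num.
Proof.
move=> t0 [D [p dPsi]]; apply: integrable_fin_num => //.
exact: (expectation_integrable KF evZ moments dPsi).
Qed.

End expectations.

Section dominated_terms.
Context {R : realType}.
Notation lebesgue := (@lebesgue_measure R).
Implicit Types k l : nat.

Lemma powR_le_exprn (x s a : R) : 0 <= x <= s -> 0 <= a ->
  x `^ a <= (1 + s) ^+ Num.bound a.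
Proof.
move=> /andP[x0 xs] a0; have s0 := le_trans x0 xs.
have s1 : 1 <= 1 + s by rewrite lerDl.
have s10 := le_trans ler01 s1.
apply: (@le_trans _ _ ((1 + s) `^ a)).
  by rewrite ge0_ler_powR ?nnegrE// (le_trans xs)// lerDr.
rewrite -powR_mulrn// ler_powR//.
exact/ltW/archi_boundP.
Qed.

Section tuple_bounds.
Variables (k : nat) (z : k.-tuple R).
Hypothesis zp : pos k z.

Lemma tuple_ge0 i : (i < k)%N -> 0 <= z`_i.
Proof. by move=> ik; apply/ltW; move/posP: zp; apply. Qed.

Lemma tuple_le_sum i : (i < k)%N -> z`_i <= \sum_(i < k) z`_i.
Proof.
move=> ik; rewrite (bigD1 (Ordinal ik))//= lerDl sumr_ge0// => j _.
exact: tuple_ge0.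
Qed.

Lemma tuple_le_sum2 i j : (i < k)%N -> (j < k)%N -> i != j ->
  z`_i + z`_j <= \sum_(i < k) z`_i.
Proof.
move=> ik jk ij; rewrite (bigD1 (Ordinal ik))//= lerD2l.
rewrite (bigD1 (Ordinal jk))//=; last by rewrite -val_eqE/= eq_sym.
by rewrite lerDl sumr_ge0// => m _; exact: tuple_ge0.
Qed.

Lemma prod_pair i j : (i < k)%N -> (j < k)%N -> i != j ->
  \prod_(m < k | [|| m == i :> nat | m == j :> nat]) z`_m = z`_i * z`_j.
Proof.
move=> ik jk ij; rewrite (bigD1 (Ordinal ik))//= ?eqxx//; congr (_ * _).
rewrite (bigD1 (Ordinal jk))/=; last by rewrite eqxx orbT -val_eqE/= eq_sym.
rewrite big1 ?mulr1// => m /andP[/andP[+ mi] mj].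
by rewrite -!val_eqE/= in mi mj; rewrite (negbTE mi) (negbTE mj).
Qed.

Lemma prod_single i : (i < k)%N -> \prod_(m < k | m == i :> nat) z`_m = z`_i.
Proof. by move=> ik; rewrite (big_pred1 (Ordinal ik))// => m; rewrite -val_eqE. Qed.

End tuple_bounds.

Section pair.
Variables (lambda C : R) (K : R -> R -> R).
Hypotheses (l0 : 0 <= lambda) (C0 : 0 <= C)
  (K0 : forall x y, 0 < x -> 0 < y -> 0 <= K x y)
  (KC : forall x y, 0 < x -> 0 < y -> K x y <= C * (x * y) * (x + y) `^ lambda)
  (mK : measurable_fun (@quadrant R) (fun p : R * R => K p.1 p.2)).
Variables (k a b : nat) (phi : k.-tuple R -> R) (e M : R).
Hypotheses (ak : (a < k)%N) (bk : (b < k)%N) (ab : a != b) (e01 : 0 < e <= 1)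
  (mphi : measurable_fun (pos k) phi)
  (phi0 : forall z, pos k z -> 0 <= phi z) (phiM : forall z, pos k z -> phi z <= M)
  (phie : forall z, pos k z -> phi z != 0 -> forall i, (i < k)%N ->
    i != a -> i != b -> e <= z`_i).

Definition pair_weight (z : k.-tuple R) : \bar R := (K z`_a z`_b * phi z)%:E.

Lemma measurable_pair_weight : measurable_fun (pos k) pair_weight.
Proof.
apply/measurable_EFinP; apply: measurable_funM => //.
apply: (@measurable_comp_on _ _ _ _ _ _ (@quadrant R) (fun p : R * R => K p.1 p.2) _
    (fun z : k.-tuple R => (z`_a, z`_b))) => //.
- exact: measurable_quadrant.
- by move=> z /posP zp; split; exact: zp.
- by apply: measurable_fun_pair_on; exact: measurable_nth_tuple.
Qed.

Lemma pair_weight_ge0 z : pos k z -> (0 <= pair_weight z)%E.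
Proof.
by move=> zp; have /posP zp' := zp; rewrite lee_fin mulr_ge0 ?K0 ?phi0// ?zp'.
Qed.

Lemma dom_pair_weight : 0 <= M -> dom (corr_sum pair_weight).
Proof.
move=> M0.
apply: (@dom_corr_sum _ _ _ (C * M) (Num.bound lambda)
  (fun m => [|| m == a | m == b]) e) => //.
- exact: measurable_pair_weight.
- exact: pair_weight_ge0.
- exact: mulr_ge0.
- move=> z zp Qz i ik; rewrite negb_or => /andP[ia ib]; apply: phie => //.
  by apply: contraNneq Qz => pz; rewrite /pair_weight pz mulr0.
- move=> z zp; have /posP zp' := zp; rewrite prod_pair// lee_fin.
  have za := zp' _ ak; have zb := zp' _ bk.
  have le1 : K z`_a z`_b * phi z <= C * (z`_a * z`_b) * (z`_a + z`_b) `^ lambda * M.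
    by apply: ler_pM; rewrite ?K0 ?phi0 ?KC ?phiM.
  apply: (le_trans le1).
  rewrite (_ : C * M * _ * _ = C * (z`_a * z`_b) *
    (1 + \sum_(i < k) z`_i) ^+ Num.bound lambda * M); last by lra.
  rewrite ler_wpM2r// ler_wpM2l ?mulr_ge0 ?(ltW za) ?(ltW zb)//.
  apply: powR_le_exprn => //; rewrite addr_ge0 ?(ltW za) ?(ltW zb)//=.
  exact: tuple_le_sum2.
Qed.

End pair.

Section single.
Variables (k l : nat) (e M : R).
Hypotheses (lk : (l < k)%N) (e01 : 0 < e <= 1) (M0 : 0 <= M).

Lemma dom_moment_weight (a : R) (phi : k.-tuple R -> R) : 0 <= a ->
  measurable_fun (pos k) phi ->
  (forall z, pos k z -> 0 <= phi z) -> (forall z, pos k z -> phi z <= M) ->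
  (forall z, pos k z -> phi z != 0 -> forall i, (i < k)%N -> i != l -> e <= z`_i) ->
  dom (corr_sum (fun z : k.-tuple R => (z`_l * Num.max (z`_l `^ a) 1 * phi z)%:E)).
Proof.
move=> a0 mphi phi0 phiM phie.
apply: (@dom_corr_sum _ _ _ M (Num.bound a) (fun m => m == l) e) => //.
- apply/measurable_EFinP; apply: measurable_funM => //.
  apply: measurable_funM; first exact: measurable_nth_tuple.
  apply: measurable_maxr; last exact: measurable_cst.
  apply: (measurableT_comp (measurable_powR a)); exact: measurable_nth_tuple.
- move=> z zp; have /posP zp' := zp; rewrite lee_fin !mulr_ge0 ?phi0//.
  by apply/ltW/zp'.
- move=> z zp Qz i ik il; apply: phie => //.
  by apply: contraNneq Qz => pz; rewrite pz mulr0.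
- move=> z zp; have /posP zp' := zp; have zl := zp' _ lk.
  rewrite prod_single// lee_fin.
  rewrite [leRHS](_ : _ = z`_l * (1 + \sum_(i < k) z`_i) ^+ Num.bound a * M); last by lra.
  have s0 : 0 <= \sum_(i < k) z`_i by rewrite sumr_ge0// => i _; exact: tuple_ge0.
  have m0 : 0 <= Num.max (z`_l `^ a) 1 by rewrite le_max ler01 orbT.
  apply: ler_pM; rewrite ?phi0 ?phiM ?mulr_ge0 ?(ltW zl)//.
  rewrite ler_wpM2l ?(ltW zl)// ge_max; apply/andP; split.
    by apply: powR_le_exprn => //; rewrite ltW//= tuple_le_sum.
  by rewrite exprn_ege1// lerDl.
Qed.

Variables (lambda C : R) (K F : R -> R -> R).
Hypothesis KF : rate_kernels lambda C K F.
Variable phi : k.-tuple R -> R -> R.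
Hypotheses
  (mphi : measurable_fun (undergraph (pos k) (fun z : k.-tuple R => z`_l))
    (fun p => phi p.1 p.2))
  (phi0 : forall z y, pos k z -> 0 < y < z`_l -> 0 <= phi z y)
  (phiM : forall z y, pos k z -> 0 < y < z`_l -> phi z y <= M)
  (phie : forall z y, pos k z -> 0 < y < z`_l -> phi z y != 0 ->
    forall i, (i < k)%N -> i != l -> e <= z`_i).

Definition frag_weight (z : k.-tuple R) : \bar R :=
  (\int[lebesgue]_(y in `]0%R, z`_l[) (F y (z`_l - y)%R * phi z y)%:E)%E.

Lemma measurable_frag_weight : measurable_fun (pos k) frag_weight.
Proof.
apply: (measurable_ge0_param_integral (@measurable_pos R k)
  (@measurable_nth_tuple R k l (pos k))) => [z y zp yz|].
  by rewrite EFinM mule_ge0 ?(F_total_ge0 KF)// lee_fin phi0.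
apply/measurable_EFinP; apply: measurable_funM => //.
apply: (@measurable_comp_on _ _ _ _ _ _ (@quadrant R) (fun p : R * R => F p.1 p.2) _
    (fun p : k.-tuple R * R => (p.2, p.1`_l - p.2))).
- exact: measurable_quadrant.
- by move=> [z y] [/= zp /andP[y0 yz]]; split => //=; rewrite subr_gt0.
- exact: rkF_mes KF.
- apply: measurable_fun_pair_on; first exact: measurable_funTS.
  apply: measurable_funB; apply: measurable_funTS => //.
  exact: measurable_nth_fst.
Qed.

Lemma frag_weight_ge0 z : pos k z -> (0 <= frag_weight z)%E.
Proof.
move=> zp; apply: integral_ge0 => y; rewrite /= in_itv/= => yz.
by rewrite EFinM mule_ge0 ?(F_total_ge0 KF)// lee_fin phi0.
Qed.

Lemma measurable_frag_section z : pos k z ->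
  measurable_fun `]0, z`_l[ (fun y => (F y (z`_l - y) * phi z y)%:E).
Proof.
move=> zp; apply/measurable_EFinP; apply: measurable_funM.
  exact: (measurable_F_section KF).
apply: (@measurable_comp_on _ _ _ _ _ _ _
  (fun p : k.-tuple R * R => phi p.1 p.2) _ (fun y => (z, y))
  (measurable_undergraph (@measurable_pos R k)
    (@measurable_nth_tuple R k l (pos k))) _ mphi).
  by move=> y /=; rewrite in_itv/= => yz; split.
apply: measurable_funTS; exact: pair1_measurable.
Qed.

Lemma dom_frag_weight : dom (corr_sum frag_weight).
Proof.
have C0 := rk_C KF; have L0 := rk_lambda KF.
apply: (@dom_corr_sum _ _ _ (C * M) (Num.bound (1 + lambda)) (fun m => m == l) e) => //.
- exact: measurable_frag_weight.
- exact: frag_weight_ge0.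
- exact: mulr_ge0.
- move=> z zp Qz i ik il.
  have [y [yz pz]] : exists y, 0 < y < z`_l /\ phi z y != 0.
    apply: contrapT => nex; move/negP: Qz; apply; apply/eqP.
    apply: integral0_eq => y; rewrite /= in_itv/= => yz.
    have [->|pz] := eqVneq (phi z y) 0; first by rewrite mulr0.
    by exfalso; apply: nex; exists y.
  exact: phie pz _ ik il.
- move=> z zp; have /posP zp' := zp; have zl := zp' _ lk.
  rewrite prod_single//.
  apply: (@le_trans _ _ (\int[lebesgue]_(y in `]0%R, z`_l[)
      (M%:E * (F y (z`_l - y)%R)%:E))%E).
    apply: ge0_le_integral => //.
    + move=> y; rewrite /= in_itv/= => yz.
      by rewrite EFinM mule_ge0 ?(F_total_ge0 KF)// lee_fin phi0.
    + exact: measurable_frag_section.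
    + apply: emeasurable_funM => //; apply/measurable_EFinP.
      exact: (measurable_F_section KF).
    + move=> y; rewrite /= in_itv/= => yz.
      rewrite -EFinM lee_fin mulrC ler_wpM2r ?phiM//.
      by rewrite -lee_fin (F_total_ge0 KF).
  rewrite ge0_integralZl_EFin//; last 2 first.
  + by move=> y; rewrite /= in_itv/= => yz; rewrite (F_total_ge0 KF).
  + by apply/measurable_EFinP; exact: (measurable_F_section KF).
  apply: (@le_trans _ _ (M%:E * (C * z`_l `^ (2 + lambda))%:E)%E).
    by rewrite lee_wpmul2l ?lee_fin//; exact: (rkF_le KF zl).
  rewrite -EFinM lee_fin.
  have -> : z`_l `^ (2 + lambda) = z`_l * z`_l `^ (1 + lambda).
    rewrite (_ : 2 + lambda = 1 + (1 + lambda)); last by lra.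
    rewrite powRD ?powRr1 ?ltW//.
    by apply/implyP => _; rewrite gt_eqF.
  rewrite [leRHS](_ : _ = M * (C * (z`_l *
    (1 + \sum_(i < k) z`_i) ^+ Num.bound (1 + lambda)))); last by lra.
  rewrite !ler_wpM2l// ?(ltW zl)//.
  apply: powR_le_exprn; last by rewrite addr_ge0.
  by rewrite (ltW zl)//= tuple_le_sum.
Qed.

End single.

End dominated_terms.

(** * Correlation measures *)

Section correlation_measure.
Context {R : realType} d (T : measurableType d) (P : probability T R).
Variables (k : nat) (X : T -> mseq R).
Hypotheses (mX : measurable_fun setT X).

Let entry (s : seq nat) (w : T) : k.-tuple R := tup k (map (X w) s).

Let measurable_entry s : measurable_fun setT (entry s).
Proof.
exact: (measurable_comp measurableT _ (@measurable_tup_map R k s) mX).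
Qed.

Let part (s : seq nat) : {measure set (k.-tuple R) -> \bar R} :=
  mrestr (push_measure P (measurable_entry s)) (@measurable_pos R k).

Let part_nat (n : nat) : {measure set (k.-tuple R) -> \bar R} :=
  if @pickle_inv (seq nat) n is Some s then
    if (size s == k) && uniq s then part s else mzero else mzero.

Definition corr_measure : {measure set (k.-tuple R) -> \bar R} :=
  mseries part_nat 0.

Let integral_part s (Q : k.-tuple R -> \bar R) :
  measurable_fun (pos k) Q -> (forall z, pos k z -> 0 <= Q z)%E ->
  (\int[part s]_(z in pos k) Q z = \int[P]_(w in entry s @^-1` pos k) Q (entry s w))%E.
Proof.
move=> mQ Q0; rewrite (eq_measure_integral (pushforward P (entry s))).
  rewrite (ge0_integral_pushforward (measurable_entry s))//.
  - exact: measurable_pos.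
  - by move=> z /set_mem; exact: Q0.
by move=> A mA Ak; rewrite /part/= /mrestr setIidl.
Qed.

Lemma integral_corr_measure (Q : k.-tuple R -> \bar R) :
  (forall w, Omega (X w)) ->
  measurable_fun (pos k) Q -> (forall z, pos k z -> 0 <= Q z)%E ->
  (\int[corr_measure]_(z in pos k) Q z = \int[P]_w corr_sum Q (X w))%E.
Proof.
move=> OX mQ Q0; rewrite ge0_integral_measure_series//; last exact: measurable_pos.
pose A := [set s : seq nat | size s = k /\ uniq s].
pose D s := entry s @^-1` pos k.
have mD s : measurable (D s).
  by rewrite -[D s]setTI; exact: (measurable_entry s measurableT (@measurable_pos R k)).
pose G s := (fun w => Q (entry s w)) \_ (D s).
have G0 s w : (0 <= G s w)%E.
  by rewrite /G patchE; case: (boolP (w \in D s)) => // /set_mem; exact: Q0.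
have mG s : measurable_fun setT (G s).
  apply: ((measurable_restrictT (fun w => Q (entry s w)) (mD s)).1).
  apply: (measurable_comp_on (@measurable_pos R k) _ mQ); first by [].
  by apply: measurable_funTS; exact: measurable_entry.
transitivity (\int[P]_w \esum_(s in A) G s w)%E; last first.
  apply: eq_integral => w _; rewrite /corr_sum.
  rewrite (_ : idx k (X w) = A `&` [set s | D s w]); last first.
    apply/seteqP; split => [s si|s [[sk us] /= /posP zs]].
      by case: (si) => sk us _; split => //; exact: pos_tup_idx.
    split => // n ns; have ik : (index n s < k)%N by rewrite -sk index_mem.
    by have := zs _ ik; rewrite nth_tup_map// nth_index.
  rewrite [RHS]esum_mkcondr; apply: eq_esum => s _; rewrite /G patchE.
  by congr (if _ then _ else _); apply/idP/idP => /set_mem ?; exact: mem_set.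
rewrite integral_esum// esum_countType; last by move=> s _; exact: integral_ge0.
apply: eq_eseriesr => n _; rewrite /part_nat.
case: (pickle_inv n) => [s|]; last by rewrite integral_measure_zero.
case: (boolP (_ && _)) => [/andP[/eqP sk us]|sn].
  by rewrite mem_set// integral_part// [LHS]integral_mkcond.
rewrite integral_measure_zero memNset//.
by move=> [sk us]; move: sn; rewrite sk eqxx us.
Qed.

Lemma factorial_measureE (z : mseq R) (A : set (k.-tuple R)) :
  factorial_measure z A = corr_sum (fun x => (\1_A x)%:E) z.
Proof.
rewrite /factorial_measure /corr_sum.
rewrite (@reindex_esum _ _ _ [set i : k.-tuple nat | uniq i /\ all (fun n => 0 < z n) i]
   _ (fun i : k.-tuple nat => tval i)); last first.
  split.
  - move=> i /= [ui /allP zi]; split => //; exact: size_tuple.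
  - by move=> i j _ _; exact: val_inj.
  - move=> s [sk us zs]; exists (tcast sk (in_tuple s)); last by rewrite val_tcast.
    by split; rewrite val_tcast//; apply/allP.
apply: eq_esum => i _; congr (\1_A _)%:E; apply: eq_from_tnth => j.
by rewrite tnth_mktuple (tnth_nth 0).
Qed.

Lemma corr_measureP : (forall w, Omega (X w)) -> is_correlation_measure P X corr_measure.
Proof.
move=> OX A mA.
have -> : corr_measure A = (\int[corr_measure]_(z in pos k) (\1_A z)%:E)%E.
  rewrite integral_indic//; last exact: measurable_pos.
  apply: eq_eseriesr => n _; rewrite /part_nat.
  case: (pickle_inv n) => [s|//]; case: ifP => // _.
  by rewrite /part/= /mrestr -setIA setIid.
rewrite integral_corr_measure//; last by apply/measurable_EFinP; exact: measurable_indic.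
by apply: eq_integral => w _; rewrite factorial_measureE.
Qed.

End correlation_measure.

Section test_weights.
Context {R : realType}.
Notation lebesgue := (@lebesgue_measure R).
Implicit Types k l m n : nat.

Lemma test_function_indic k (S : set (k.-tuple R)) : measurable S -> compact_in_pos S ->
  test_function (\1_S : k.-tuple R -> R).
Proof.
move=> mS cS; split.
- exact: measurable_indic.
- by move=> z _.
- by exists 1 => z _; rewrite indicE; case: (_ \in _).
- by exists S; split => // z _ nSz; rewrite indicE memNset.
Qed.

Section one_function.
Variables (k : nat) (f : k.-tuple R -> R).
Hypothesis tf : test_function f.

Let mf : measurable_fun (pos k) f. Proof. by have [] := tf. Qed.
Let f0 z : pos k z -> 0 <= f z. Proof. by have [_ + _ _] := tf; apply. Qed.

Lemma dom_test : dom (corr_sum (fun z => (f z)%:E)).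
Proof.
have [M [e [M0 e01 fM fe]]] := test_function_bound tf.
apply: (@dom_corr_sum _ k (fun z => (f z)%:E) M 0%N (fun=> false) e) => //.
- exact/measurable_EFinP.
- by move=> z zp Qz i ik _; apply: fe => //; apply: contraNneq Qz => ->.
- by move=> z zp; rewrite expr0 mulr1 big_pred0// mulr1 lee_fin fM.
Qed.

Lemma measurable_test_coag l : (l < k)%N ->
  measurable_fun (pos k.+1) (fun z : k.+1.-tuple R => f (coag l z)).
Proof.
move=> lk; apply: (measurable_comp_on (@measurable_pos R k) _ mf).
  by move=> z; exact: pos_coag.
apply: measurable_funTS; exact: measurable_coag.
Qed.

Lemma measurable_test_drop l :
  measurable_fun (pos k.+1) (fun z : k.+1.-tuple R => f (drop_coord k l z)).
Proof.
apply: (measurable_comp_on (@measurable_pos R k) _ mf).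
  by move=> z; exact: pos_drop_coord.
apply: measurable_funTS; exact: measurable_drop_coord.
Qed.

Lemma measurable_test_fst l :
  measurable_fun (undergraph (pos k) (fun z : k.-tuple R => z`_l))
    (fun p : k.-tuple R * R => f p.1).
Proof.
apply: (measurable_comp_on (@measurable_pos R k) _ mf); first by move=> p [].
by apply: measurable_funTS; exact: measurable_fst.
Qed.

Lemma measurable_test_replace l :
  measurable_fun (undergraph (pos k) (fun z : k.-tuple R => z`_l))
    (fun p : k.-tuple R * R => f (replace_coord l p.2 p.1)).
Proof.
apply: (@measurable_comp_on _ _ _ _ _ _ (pos k) f _
    (fun p : k.-tuple R * R => replace_coord l p.2 p.1)) => //.
- exact: measurable_pos.
- by move=> [z y] [zp /andP[y0 _]]; exact: pos_replace_coord.
- by apply: measurable_funTS; exact: measurable_replace_coord.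
Qed.

Section pair_kernel.
Variables (lambda C : R) (K : R -> R -> R).
Hypotheses (l0 : 0 <= lambda) (C0 : 0 <= C)
  (K0 : forall x y, 0 < x -> 0 < y -> 0 <= K x y)
  (KC : forall x y, 0 < x -> 0 < y -> K x y <= C * (x * y) * (x + y) `^ lambda)
  (mK : measurable_fun (@quadrant R) (fun p : R * R => K p.1 p.2)).

Lemma dom_coag_weight l : (l < k)%N ->
  dom (corr_sum (pair_weight K l l.+1 (fun z : k.+1.-tuple R => f (coag l z)))).
Proof.
move=> lk; have [M [e [M0 e01 fM fe]]] := test_function_bound tf.
apply: (dom_pair_weight l0 C0 K0 KC mK (e := e) (M := M)) => //.
- by lia.
- by rewrite neq_ltn ltnSn.
- exact: measurable_test_coag.
- by move=> z zp; apply/f0/pos_coag.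
- by move=> z zp; apply/fM/pos_coag.
- move=> z zp fz i ik il il1; have cp := pos_coag lk zp.
  case: (ltnP i l) => il'.
    have ik' : (i < k)%N by lia.
    by have := fe _ cp fz _ ik'; rewrite nth_coag// il'.
  have ik' : (i.-1 < k)%N by lia.
  have := fe _ cp fz _ ik'; rewrite nth_coag// ifF; last by lia.
  by rewrite ifF ?prednK//; lia.
Qed.

Lemma dom_drop_weight l : (l < k)%N ->
  dom (corr_sum (pair_weight K l l.+1
    (fun z : k.+1.-tuple R => f (drop_coord k l.+1 z)))).
Proof.
move=> lk; have [M [e [M0 e01 fM fe]]] := test_function_bound tf.
apply: (dom_pair_weight l0 C0 K0 KC mK (e := e) (M := M)) => //.
- by lia.
- by rewrite neq_ltn ltnSn.
- exact: measurable_test_drop.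
- by move=> z zp; apply/f0/pos_drop_coord.
- by move=> z zp; apply/fM/pos_drop_coord.
- move=> z zp fz i ik il il1; have cp := pos_drop_coord l.+1 zp.
  case: (ltnP i l.+1) => il'.
    have ik' : (i < k)%N by lia.
    by have := fe _ cp fz _ ik'; rewrite nth_drop_coord// il'.
  have ik' : (i.-1 < k)%N by lia.
  have := fe _ cp fz _ ik'; rewrite nth_drop_coord// ifF; last by lia.
  by rewrite prednK//; lia.
Qed.

Lemma dom_both_weight l m : (l < m < k)%N -> dom (corr_sum (pair_weight K l m f)).
Proof.
move=> /andP[lm mk]; have [M [e [M0 e01 fM fe]]] := test_function_bound tf.
apply: (dom_pair_weight l0 C0 K0 KC mK (e := e) (M := M)) => //.
- exact: ltn_trans mk.
- by rewrite neq_ltn lm.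
- by move=> z zp fz i ik _ _; exact: fe.
Qed.

End pair_kernel.

Section frag_kernel.
Variables (lambda C : R) (K F : R -> R -> R).
Hypothesis KF : rate_kernels lambda C K F.

Lemma dom_loss_weight l : (l < k)%N -> dom (corr_sum (frag_weight l F (fun z _ => f z))).
Proof.
move=> lk; have [M [e [M0 e01 fM fe]]] := test_function_bound tf.
apply: (dom_frag_weight lk e01 M0 KF).
- exact: measurable_test_fst.
- by move=> z y zp _; exact: f0.
- by move=> z y zp _; exact: fM.
- by move=> z y zp _ fz i ik _; exact: fe.
Qed.

Lemma dom_replace_weight l : (l < k)%N ->
  dom (corr_sum (frag_weight l F (fun z y => f (replace_coord l y z)))).
Proof.
move=> lk; have [M [e [M0 e01 fM fe]]] := test_function_bound tf.
have rp (z : k.-tuple R) y : pos k z -> 0 < y < z`_l -> pos k (replace_coord l y z).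
  by move=> zp /andP[y0 _]; exact: pos_replace_coord.
apply: (dom_frag_weight lk e01 M0 KF).
- exact: measurable_test_replace.
- by move=> z y zp yz; apply/f0/rp.
- by move=> z y zp yz; apply/fM/rp.
- move=> z y zp yz fz i ik il.
  by have := fe _ (rp _ _ zp yz) fz _ ik; rewrite nth_replace_coord// (negbTE il).
Qed.

End frag_kernel.

End one_function.

Lemma measurable_test_frag n (f : n.+1.-tuple R -> R) l m :
  test_function f -> (l < m < n.+1)%N ->
  measurable_fun (undergraph (pos n) (fun z : n.-tuple R => z`_l))
    (fun p : n.-tuple R * R => f (@frag R n.+1 l m p.2 p.1)).
Proof.
move=> [mf _ _ _] lmn.
apply: (@measurable_comp_on _ _ _ _ _ _ (pos n.+1) f _
    (fun p : n.-tuple R * R => @frag R n.+1 l m p.2 p.1)) => //.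
- exact: measurable_pos.
- by move=> [z y] [zp yz]; exact: pos_frag.
- by apply: measurable_funTS; exact: measurable_frag.
Qed.

Lemma dom_split_weight n (f : n.+1.-tuple R -> R) (lambda C : R) (K F : R -> R -> R) l m :
  test_function f -> rate_kernels lambda C K F -> (l < m < n.+1)%N ->
  dom (corr_sum (frag_weight l F (fun z y => f (@frag R n.+1 l m y z)))).
Proof.
move=> tf KF lmn; have [M [e [M0 e01 fM fe]]] := test_function_bound tf.
have /andP[lm mn] := lmn; have ln : (l < n)%N by lia.
have [mf f0 _ _] := tf.
have rp (z : n.-tuple R) y : pos n z -> 0 < y < z`_l -> pos n.+1 (@frag R n.+1 l m y z).
  exact: pos_frag.
apply: (dom_frag_weight ln e01 M0 KF).
- exact: measurable_test_frag.
- by move=> z y zp yz; apply/f0/rp.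
- by move=> z y zp yz; apply/fM/rp.
- move=> z y zp yz fz i ik il.
  have cp := rp _ _ zp yz.
  case: (ltnP i m) => im.
    have ik' : (i < n.+1)%N by lia.
    by have := fe _ cp fz _ ik'; rewrite nth_frag// (negbTE il) im.
  have ik' : (i.+1 < n.+1)%N by lia.
  have := fe _ cp fz _ ik'; rewrite nth_frag// !ifF//; lia.
Qed.

Lemma dom_drop_moment n (g : n.-tuple R -> R) (a : R) l : 0 <= a ->
  test_function g -> (l < n.+1)%N ->
  dom (corr_sum (fun z : n.+1.-tuple R => (z`_l * Num.max (z`_l `^ a) 1 *
    (if n.+1 == 1%N then 1 else g (drop_coord n l z)))%:E)).
Proof.
move=> a0 tg ln; have [M [e [M0 e01 fM fe]]] := test_function_bound tg.
case: eqP => [[n0]|_].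
  apply: (@dom_moment_weight _ n.+1 l 1 1) => //; first by rewrite ltr01 lexx.
  by move=> z zp _ i ik il; lia.
have [mf f0 _ _] := tg.
apply: (@dom_moment_weight _ n.+1 l e M) => //.
- exact: measurable_test_drop.
- by move=> z zp; apply/f0/pos_drop_coord.
- by move=> z zp; apply/fM/pos_drop_coord.
- move=> z zp fz i ik il; have cp := pos_drop_coord l zp.
  case: (ltnP i l) => il'.
    have ik' : (i < n)%N by lia.
    by have := fe _ cp fz _ ik'; rewrite nth_drop_coord// il'.
  have ik' : (i.-1 < n)%N by lia.
  have := fe _ cp fz _ ik'; rewrite nth_drop_coord// ifF; last by lia.
  by rewrite prednK//; lia.
Qed.

End test_weights.

Section positive_extension.
Context {R : realType}.
Variables (k : nat) (f : k.-tuple R -> R).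

Definition on_seq (x : seq R) : R :=
  if (size x == k) && all (fun a => 0 < a) x then f (tup k x) else 0.

Lemma on_seqE (x : seq R) (z : k.-tuple R) : pos k z -> size x = k ->
  (forall i, (i < k)%N -> x`_i = z`_i) -> on_seq x = f z.
Proof.
move=> /posP zp sk xz; rewrite /on_seq sk eqxx/= ifT.
  congr f; apply: eq_from_tnth => i; rewrite !(tnth_nth 0) nth_tup// xz//.
by apply/(all_nthP 0) => i; rewrite sk => ik; rewrite xz// zp.
Qed.

Hypothesis tf : test_function f.

Lemma on_seq_ge0 x : 0 <= on_seq x.
Proof.
have [_ f0 _ _] := tf; rewrite /on_seq; case: ifP => // /andP[/eqP sk /all_nthP xp].
by apply: f0; apply/posP => i ik; rewrite nth_tup// xp// sk.
Qed.

Lemma measurable_on_seq (a : R) (g : R -> seq R) :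
  (forall y, 0 < y < a -> size (g y) = k /\ (forall i, (i < k)%N -> 0 < (g y)`_i)) ->
  (forall i, (i < k)%N -> measurable_fun `]0, a[ (fun y => (g y)`_i)) ->
  measurable_fun `]0, a[ (fun y => on_seq (g y)).
Proof.
move=> gp mg; have [mf _ _ _] := tf.
pose G y : k.-tuple R := [tuple ((fun y => (g y)`_i) \_ `]0, a[) y | i < k].
have mG : measurable_fun setT G.
  apply: (@measurable_mktuple _ _ _ k
    (fun y i => ((fun y => (g y)`_i) \_ `]0, a[) y)) => i ik.
  by apply: ((measurable_restrictT _ _).1 (mg _ ik)).
have GE y : `]0, a[%classic y -> pos k (G y) /\ on_seq (g y) = f (G y).
  move=> ya; have ya' : 0 < y < a by move: ya; rewrite /= in_itv.
  have [sg gy] := gp _ ya'.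
  have E i : (i < k)%N -> (G y)`_i = (g y)`_i.
    move=> ik; rewrite (nth_mktuple_nat (fun i => ((fun y => (g y)`_i) \_ `]0, a[) y))//.
    by rewrite patchE mem_set.
  have pG : pos k (G y) by apply/posP => i ik; rewrite E// gy.
  by split => //; apply: on_seqE => // i ik; rewrite E.
apply: (@eq_measurable_fun _ _ _ _ _ (fun y => f (G y))).
  by move=> y /set_mem /GE[_ ->].
apply: (measurable_comp_on (@measurable_pos R k) _ mf); first by move=> y /GE[].
exact: measurable_funTS.
Qed.

Lemma corr_on_seq (z : mseq R) : corr k on_seq z = corr_sum (fun z => (f z)%:E) z.
Proof.
apply: eq_esum => s si; have [sk us zs] := si; congr _%:E.
apply: on_seqE; [exact: pos_tup_idx|by rewrite size_map|].
by move=> i ik; rewrite nth_tup.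
Qed.

End positive_extension.

Section sums_as_weights.
Context {R : realType}.
Notation lebesgue := (@lebesgue_measure R).
Variables (K F : R -> R -> R) (n : nat) (f : n.+1.-tuple R -> R) (z : mseq R).
Local Notation h := (on_seq f).

Lemma coag_sumE l : (l < n.+1)%N -> coag_sum K n h z l =
  corr_sum (pair_weight K l l.+1 (fun z : n.+2.-tuple R => f (coag l z))) z.
Proof.
move=> ln; apply: eq_esum => s si; have [sk us zs] := si; have tp := pos_tup_idx si.
rewrite /pair_weight !nth_tup_map//; last by lia.
congr (_ * _)%:E; have sr : size (remove_nth l.+1 s) = n.+1.
  by rewrite size_remove_nth sk//; lia.
apply: on_seqE; first exact: pos_coag.
  by rewrite size_set_nth size_map sr; exact/maxn_idPr.
move=> i ik; rewrite nth_coag// nth_set_nth/= !nth_tup_map//; try by lia.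
rewrite (nth_map 0%N) ?sr// nth_remove_nth ?sk; last by lia.
by case: (ltngtP i l) => il //; rewrite ltnS ?(ltnW il)// leqNgt il.
Qed.

Lemma drop_sumE l : (l < n.+1)%N -> drop_sum K n h z l =
  corr_sum (pair_weight K l l.+1
    (fun z : n.+2.-tuple R => f (drop_coord n.+1 l.+1 z))) z.
Proof.
move=> ln; apply: eq_esum => s si; have [sk us zs] := si; have tp := pos_tup_idx si.
rewrite /pair_weight !nth_tup_map//; last by lia.
congr (_ * _)%:E; have sr : size (remove_nth l.+1 s) = n.+1.
  by rewrite size_remove_nth sk//; lia.
apply: on_seqE; [exact: pos_drop_coord|by rewrite size_map|].
move=> i ik; rewrite nth_drop_coord// !nth_tup_map//; try by lia.
rewrite (nth_map 0%N) ?sr// nth_remove_nth ?sk; last by lia.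
by case: ifP.
Qed.

Lemma pair_sumE l m : (l < n.+1)%N -> (m < n.+1)%N ->
  pair_sum K n h z l m = corr_sum (pair_weight K l m f) z.
Proof.
move=> ln mn; apply: eq_esum => s si; have [sk us zs] := si.
rewrite /pair_weight !nth_tup_map//; congr (_ * _)%:E.
apply: on_seqE; [exact: pos_tup_idx|by rewrite size_map|].
by move=> i ik; rewrite nth_tup.
Qed.

Lemma loss_sumE l : (l < n.+1)%N -> loss_sum F n h z l =
  corr_sum (frag_weight l F (fun z _ => f z)) z.
Proof.
move=> ln; apply: eq_esum => s si; have [sk us zs] := si.
rewrite /frag_weight !nth_tup_map//; apply: eq_integral => y _; congr (_ * _)%:E.
apply: on_seqE; [exact: pos_tup_idx|by rewrite size_map|].
by move=> i ik; rewrite nth_tup.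
Qed.

Lemma replace_sumE l : (l < n.+1)%N -> replace_sum F n h z l =
  corr_sum (frag_weight l F (fun z y => f (replace_coord l y z))) z.
Proof.
move=> ln; apply: eq_esum => s si; have [sk us zs] := si.
rewrite /frag_weight !nth_tup_map//; apply: eq_integral => y /set_mem.
rewrite /= in_itv/= => /andP[y0 _]; congr (_ * _)%:E.
apply: on_seqE; first by apply: pos_replace_coord => //; exact: pos_tup_idx.
  by rewrite size_set_nth size_map sk; exact/maxn_idPr.
by move=> i ik; rewrite nth_replace_coord// nth_set_nth/= nth_tup.
Qed.

Lemma split_sumE l m : (l < m < n.+1)%N -> split_sum F n h z l m =
  corr_sum (frag_weight l F (fun (z : n.-tuple R) y => f (@frag R n.+1 l m y z))) z.
Proof.
move=> lmn; have /andP[lm mn] := lmn; have ln : (l < n)%N by lia.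
apply: eq_esum => s si; have [sk us zs] := si; have tp := pos_tup_idx si.
rewrite /frag_weight !nth_tup_map//; apply: eq_integral => y /set_mem.
rewrite /= in_itv/= => yz; congr (_ * _)%:E.
have sr : size (set_nth 0 (map z s) l y) = n.
  by rewrite size_set_nth size_map sk; exact/maxn_idPr.
apply: on_seqE.
- by apply: pos_frag => //; rewrite nth_tup_map.
- by rewrite size_ins sr.
- move=> i ik; rewrite nth_frag// nth_ins ?sr// !nth_set_nth/=.
  case: (ltnP i m) => im.
    by case: eqP => // il; rewrite nth_tup//; lia.
  have il : (i == l) = false by lia.
  rewrite il; case: eqP => im'; first by rewrite nth_tup_map.
  rewrite ifF; last by lia.
  by rewrite nth_tup//; lia.
Qed.

Definition gain_weights : \bar R :=
  (2^-1%:E * \sum_(l < n.+1)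
     corr_sum (pair_weight K l l.+1 (fun z : n.+2.-tuple R => f (coag l z))) z +
   (\sum_(l < n.+1)
     corr_sum (frag_weight l F (fun z y => f (replace_coord l y z))) z +
    \sum_(l < n.+1) \sum_(m < n.+1 | (l < m)%N)
     corr_sum (frag_weight l F (fun (z : n.-tuple R) y => f (@frag R n.+1 l m y z))) z))%E.

Definition lost_weights : \bar R :=
  (2^-1%:E * \sum_(l < n.+1) corr_sum (frag_weight l F (fun z _ => f z)) z +
   (\sum_(l < n.+1)
     corr_sum (pair_weight K l l.+1
       (fun z : n.+2.-tuple R => f (drop_coord n.+1 l.+1 z))) z +
    \sum_(l < n.+1) \sum_(m < n.+1 | (l < m)%N)
     corr_sum (pair_weight K l m f) z))%E.

Lemma gain_sumE : gain_sum K F n h z = gain_weights.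
Proof.
congr (_ * _ + (_ + _))%E; apply: eq_bigr => l _.
- exact: coag_sumE.
- exact: replace_sumE.
- by apply: eq_bigr => m lm; apply: split_sumE; rewrite lm/=.
Qed.

Lemma lost_sumE : lost_sum K F n h z = lost_weights.
Proof.
congr (_ * _ + (_ + _))%E; apply: eq_bigr => l _.
- exact: loss_sumE.
- exact: drop_sumE.
- by apply: eq_bigr => m lm; exact: pair_sumE.
Qed.

End sums_as_weights.

(** * The hierarchical equation *)

Lemma balance_difference (R : realType) (a b x1 x2 x3 y1 y2 y3 : \bar R) (c : R) :
  a \is a fin_num -> b \is a fin_num ->
  x1 \is a fin_num -> x2 \is a fin_num -> x3 \is a fin_num ->
  y1 \is a fin_num -> y2 \is a fin_num -> y3 \is a fin_num ->
  (a + (c%:E * y1 + (y2 + y3)) = b + (c%:E * x1 + (x2 + x3)) ->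
   a - b = c%:E * x1 - c%:E * y1 - y2 + x2 - y3 + x3)%E.
Proof.
move=> /fineK <- /fineK <- /fineK <- /fineK <- /fineK <- /fineK <- /fineK <- /fineK <-.
rewrite -!(EFinM, EFinD, EFinN) => -[E]; congr _%:E; lra.
Qed.

Section hierarchy.
Context {R : realType}.
Notation lebesgue := (@lebesgue_measure R).
Variables (lambda C : R) (K F : R -> R -> R).
Hypothesis KF : rate_kernels lambda C K F.
Context d (T : measurableType d) (P : probability T R).
Variable Z : R -> T -> mseq R.
Hypothesis evZ : evolves K F P Z.
Hypothesis moments : forall p, (\int[P]_w ((1 + mass (Z 0 w)) ^+ p)%:E < +oo)%E.

Let OZ := let: And3 _ h _ := evZ in h.
Let mZ := let: And3 h _ _ := evZ in h.

Definition corr_family : measure_family R := fun t k =>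
  if pselect (0 <= t) is left t0 then corr_measure P k (mZ t0) else mzero.

Lemma corr_familyP t k : 0 <= t -> is_correlation_measure P (Z t) (corr_family t k).
Proof.
move=> t0; rewrite /corr_family; case: pselect => // t0'.
by apply: corr_measureP => w; exact: OZ.
Qed.

Lemma integral_corr_family t k (Q : k.-tuple R -> \bar R) : 0 <= t ->
  measurable_fun (pos k) Q -> (forall z, pos k z -> 0 <= Q z)%E ->
  (\int[corr_family t k]_(z in pos k) Q z = \int[P]_w corr_sum Q (Z t w))%E.
Proof.
move=> t0 mQ Q0; rewrite /corr_family; case: pselect => // t0'.
by apply: integral_corr_measure => // w; exact: OZ.
Qed.

Lemma locally_integrable_corr k (Q : k.-tuple R -> \bar R) :
  measurable_fun (pos k) Q -> (forall z, pos k z -> 0 <= Q z)%E ->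
  dom (corr_sum Q) ->
  locally_integrable0 (fun t => \int[corr_family t k]_(z in pos k) Q z)%E.
Proof.
move=> mQ Q0 [D [p dQ]] t t0.
have mD : measurable (`[0, t] : set R) by [].
apply: (@eq_integrable _ _ R lebesgue `[0, t] mD (fun s => \int[P]_w corr_sum Q (Z s w))%E) => //.
  move=> s /set_mem; rewrite /= in_itv/= => /andP[s0 _].
  by rewrite integral_corr_family.
exact: (expectation_integrable KF evZ moments dQ).
Qed.

Lemma corr_family_admissible : admissible lambda corr_family.
Proof.
have l0 := rk_lambda KF; split => [t k S t0 _ mS cS|[//|n] f g l _ tf tg ln].
  have tS := test_function_indic mS cS; have [D [p dS]] := dom_test tS.
  have [Spos _] := cS.
  rewrite -[X in corr_family t k X](setIidl Spos) -integral_indic//; last exact: measurable_pos.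
  have [mI I0 _ _] := tS.
  rewrite integral_corr_family//; last exact/measurable_EFinP.
  rewrite -ge0_fin_numE; first exact: (expectation_fin KF evZ moments dS).
  by apply: integral_ge0 => w _; apply: (dom_ge0 evZ) => //; exists D, p.
have [mf f0 _ _] := tf; have [mg g0 _ _] := tg.
split.
- apply: locally_integrable_corr; last exact: dom_test.
    exact/measurable_EFinP.
  by move=> z zp; rewrite lee_fin f0.
- have K0 x y : 0 < x -> 0 < y -> 0 <= x * y :> R.
    by move=> x0 y0; rewrite mulr_ge0 ?ltW.
  have KC (x y : R) : 0 < x -> 0 < y -> x * y <= 1 * (x * y) * (x + y) `^ 0.
    by rewrite powRr0 mulr1 mul1r.
  have mK : measurable_fun (@quadrant R) (fun p : R * R => p.1 * p.2).
    by apply: measurable_funM; apply: measurable_funTS;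
      [exact: measurable_fst|exact: measurable_snd].
  apply: (@locally_integrable_corr _ (pair_weight (fun x y => x * y) l l.+1
    (fun z : n.+2.-tuple R => f (coag l z)))).
  + have l1 : (l < n.+2)%N := ltnW ln.
    have l2 : (l.+1 < n.+2)%N := ln.
    have m2 := measurable_pair_weight mK l1 l2 (measurable_test_coag tf ln).
    exact m2.
  + move=> z zp; have /posP zp' := zp; have cp := pos_coag ln zp.
    by rewrite lee_fin mulr_ge0 ?f0// K0 ?zp'// ltnW.
  + exact: (dom_coag_weight tf (lexx 0) ler01 K0 KC mK ln).
- apply: locally_integrable_corr; last by apply: dom_drop_moment => //; rewrite addr_ge0.
    apply/measurable_EFinP; apply: measurable_funM.
      apply: measurable_funM; first exact: measurable_nth_tuple.
      apply: measurable_maxr; last exact: measurable_cst.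
      apply: (measurableT_comp (measurable_powR _)); exact: measurable_nth_tuple.
    by case: eqP => // _; exact: measurable_test_drop.
  move=> z zp; have /posP zp' := zp; rewrite lee_fin !mulr_ge0//.
  + exact/ltW/zp'.
  + by case: eqP => // _; apply: g0; exact: pos_drop_coord.
Qed.

Local Notation Is := (time_integral P Z).

Lemma time_integral_corr_family t k (Q : k.-tuple R -> \bar R) :
  measurable_fun (pos k) Q -> (forall z, pos k z -> 0 <= Q z)%E ->
  (\int[lebesgue]_(s in `[0%R, t]) \int[corr_family s k]_(z in pos k) Q z =
   Is t (corr_sum Q))%E.
Proof.
move=> mQ Q0; apply: eq_integral => s /set_mem; rewrite /= in_itv/= => /andP[s0 _].
by rewrite integral_corr_family.
Qed.

Lemma time_integral_pair t k (l m : nat) (phi : k.-tuple R -> R) :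
  (l < k)%N -> (m < k)%N -> measurable_fun (pos k) phi ->
  (forall z, pos k z -> 0 <= phi z) ->
  (\int[lebesgue]_(s in `[0%R, t]) \int[corr_family s k]_(z in pos k)
     (K z`_l z`_m * phi z)%:E = Is t (corr_sum (pair_weight K l m phi)))%E.
Proof.
move=> lk mk mphi phi0; have mQ := measurable_pair_weight (rkK_mes KF) lk mk mphi.
apply: (time_integral_corr_family _ mQ) => z zp; have /posP zp' := zp.
by rewrite lee_fin mulr_ge0 ?phi0// (rkK_ge0 KF)// zp'.
Qed.

Lemma time_integral_frag t k (l : nat) (phi : k.-tuple R -> R -> R) :
  measurable_fun (undergraph (pos k) (fun z : k.-tuple R => z`_l))
    (fun p => phi p.1 p.2) ->
  (forall z y, pos k z -> 0 < y < z`_l -> 0 <= phi z y) ->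
  (\int[lebesgue]_(s in `[0%R, t]) \int[corr_family s k]_(z in pos k)
     \int[lebesgue]_(y in `]0%R, z`_l[) (F y (z`_l - y)%R * phi z y)%:E =
   Is t (corr_sum (frag_weight l F phi)))%E.
Proof.
move=> mphi phi0; have mQ := measurable_frag_weight KF mphi phi0.
by apply: (time_integral_corr_family _ mQ) => z zp; exact: (frag_weight_ge0 KF).
Qed.

Section weak.
Variables (n : nat) (f : n.+1.-tuple R -> R).
Hypothesis tf : test_function f.

Let mf : measurable_fun (pos n.+1) f. Proof. by have [] := tf. Qed.
Let f0 z : pos n.+1 z -> 0 <= f z. Proof. by have [_ + _ _] := tf; apply. Qed.

Let l0 := rk_lambda KF.
Let C0 := rk_C KF.
Let K0 := rkK_ge0 KF.
Let KC := rkK_le KF.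
Let mK := rkK_mes KF.

Lemma corr_test_fin (z : mseq R) : Omega z -> (corr n.+1 (on_seq f) z < +oo)%E.
Proof.
move=> Oz; have [D [p dP]] := dom_test tf.
rewrite corr_on_seq -ge0_fin_numE ?(dominated_fin dP Oz)//.
by have /andP[] := dP.2 _ Oz.
Qed.

Let dom_coag (l : nat) : (l < n.+1)%N -> _ :=
  @dom_coag_weight R n.+1 f tf lambda C K l0 C0 K0 KC mK l.
Let dom_drop (l : nat) : (l < n.+1)%N -> _ :=
  @dom_drop_weight R n.+1 f tf lambda C K l0 C0 K0 KC mK l.
Let dom_both (l m : nat) : (l < m < n.+1)%N -> _ :=
  @dom_both_weight R n.+1 f tf lambda C K l0 C0 K0 KC mK l m.
Let dom_loss (l : nat) : (l < n.+1)%N -> _ :=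
  @dom_loss_weight R n.+1 f tf lambda C K F KF l.
Let dom_replace (l : nat) : (l < n.+1)%N -> _ :=
  @dom_replace_weight R n.+1 f tf lambda C K F KF l.
Let dom_split (l m : nat) : (l < m < n.+1)%N -> _ :=
  @dom_split_weight R n f lambda C K F l m tf KF.

Let half_ge0 : 0 <= 2^-1 :> R. Proof. by []. Qed.


Lemma weak_corr_balance t : 0 < t ->
  (\int[P]_w corr_sum (fun z => (f z)%:E) (Z t w) +
   (2^-1%:E * (\sum_(l < n.+1) Is t (corr_sum (frag_weight l F (fun z _ => f z)))) +
    (\sum_(l < n.+1) Is t (corr_sum (pair_weight K l l.+1
       (fun z : n.+2.-tuple R => f (drop_coord n.+1 l.+1 z)))) +
     \sum_(l < n.+1) \sum_(m < n.+1 | (l < m)%N)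
       Is t (corr_sum (pair_weight K l m f)))) =
   \int[P]_w corr_sum (fun z => (f z)%:E) (Z 0 w) +
   (2^-1%:E * (\sum_(l < n.+1) Is t (corr_sum (pair_weight K l l.+1
       (fun z : n.+2.-tuple R => f (coag l z))))) +
    (\sum_(l < n.+1) Is t (corr_sum (frag_weight l F
       (fun z y => f (replace_coord l y z)))) +
     \sum_(l < n.+1) \sum_(m < n.+1 | (l < m)%N) Is t (corr_sum (frag_weight l F
       (fun (z : n.-tuple R) y => f (@frag R n.+1 l m y z)))))))%E.
Proof.
move=> t0.
have dG := dom_test tf.
have d1 : dom (fun z => \sum_(l < n.+1) corr_sum (pair_weight K l l.+1
    (fun z : n.+2.-tuple R => f (coag l z))) z)%E.
  by apply: (dom_sum evZ) => l _; exact: dom_coag.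
have d2 : dom (fun z => \sum_(l < n.+1) corr_sum (frag_weight l F
    (fun z y => f (replace_coord l y z))) z)%E.
  by apply: (dom_sum evZ) => l _; exact: dom_replace.
have d3' l : dom (fun z => \sum_(m < n.+1 | (l < m)%N) corr_sum (frag_weight l F
    (fun (z : n.-tuple R) y => f (@frag R n.+1 l m y z))) z)%E.
  by apply: (dom_sum evZ) => m lm; apply: dom_split; rewrite lm/=.
have d3 : dom (fun z => \sum_(l < n.+1) \sum_(m < n.+1 | (l < m)%N)
    corr_sum (frag_weight l F
    (fun (z : n.-tuple R) y => f (@frag R n.+1 l m y z))) z)%E.
  by apply: (dom_sum evZ) => l _; exact: d3'.
have e1 : dom (fun z => \sum_(l < n.+1) corr_sum (frag_weight l F (fun z _ => f z)) z)%E.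
  by apply: (dom_sum evZ) => l _; exact: dom_loss.
have e2 : dom (fun z => \sum_(l < n.+1) corr_sum (pair_weight K l l.+1
    (fun z : n.+2.-tuple R => f (drop_coord n.+1 l.+1 z))) z)%E.
  by apply: (dom_sum evZ) => l _; exact: dom_drop.
have e3' (l : 'I_n.+1) : dom (fun z => \sum_(m < n.+1 | (l < m)%N)
    corr_sum (pair_weight K l m f) z)%E.
  by apply: (dom_sum evZ) => m lm; apply: dom_both; rewrite lm/=.
have e3 : dom (fun z => \sum_(l < n.+1) \sum_(m < n.+1 | (l < m)%N)
    corr_sum (pair_weight K l m f) z)%E.
  by apply: (dom_sum evZ) => l _; exact: e3'.
have dp : dom (gain_weights K F f).
  by apply: (domD evZ); [exact: domZ|exact: (domD evZ)].
have dm : dom (lost_weights K F f).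
  by apply: (domD evZ); [exact: domZ|exact: (domD evZ)].
have Ip : Is t (gain_weights K F f) =
   (2^-1%:E * (\sum_(l < n.+1) Is t (corr_sum (pair_weight K l l.+1
       (fun z : n.+2.-tuple R => f (coag l z))))) +
    (\sum_(l < n.+1) Is t (corr_sum (frag_weight l F
       (fun z y => f (replace_coord l y z)))) +
     \sum_(l < n.+1) \sum_(m < n.+1 | (l < m)%N) Is t (corr_sum (frag_weight l F
       (fun (z : n.-tuple R) y => f (@frag R n.+1 l m y z))))))%E.
  rewrite (time_integralD KF evZ t (domZ half_ge0 d1) (domD evZ d2 d3)).
  rewrite (time_integralD KF evZ t d2 d3) (time_integralZ KF evZ t half_ge0 d1).
  rewrite (time_integral_sum KF evZ t) => [|l _]; last by exact: dom_coag.
  rewrite (time_integral_sum KF evZ t) => [|l _]; last by exact: dom_replace.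
  rewrite (time_integral_sum KF evZ t) => [|l _]; last by exact: d3'.
  congr (_ + (_ + _))%E; apply: eq_bigr => l _.
  by rewrite (time_integral_sum KF evZ t)// => m lm; apply: dom_split; rewrite lm/=.
have Im : Is t (lost_weights K F f) =
   (2^-1%:E * (\sum_(l < n.+1) Is t (corr_sum (frag_weight l F (fun z _ => f z)))) +
    (\sum_(l < n.+1) Is t (corr_sum (pair_weight K l l.+1
       (fun z : n.+2.-tuple R => f (drop_coord n.+1 l.+1 z)))) +
     \sum_(l < n.+1) \sum_(m < n.+1 | (l < m)%N)
       Is t (corr_sum (pair_weight K l m f))))%E.
  rewrite (time_integralD KF evZ t (domZ half_ge0 e1) (domD evZ e2 e3)).
  rewrite (time_integralD KF evZ t e2 e3) (time_integralZ KF evZ t half_ge0 e1).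
  rewrite (time_integral_sum KF evZ t) => [|l _]; last by exact: dom_loss.
  rewrite (time_integral_sum KF evZ t) => [|l _]; last by exact: dom_drop.
  rewrite (time_integral_sum KF evZ t) => [|l _]; last by exact: e3'.
  congr (_ + (_ + _))%E; apply: eq_bigr => l _.
  by rewrite (time_integral_sum KF evZ t)// => m lm; apply: dom_both; rewrite lm/=.
suff : (\int[P]_w corr_sum (fun z => (f z)%:E) (Z t w) + Is t (lost_weights K F f) =
    \int[P]_w corr_sum (fun z => (f z)%:E) (Z 0 w) + Is t (gain_weights K F f))%E.
  by rewrite Ip Im.
have [DG [pG hG]] := dG; have [Dp [pp hp]] := dp; have [Dm [pm hm]] := dm.
apply: (dynkin_unbounded KF evZ moments hG hp hm) => // z Oz.
rewrite -gain_sumE -lost_sumE.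
rewrite -(gen_L_corr KF (on_seq_ge0 tf) corr_test_fin (measurable_on_seq tf) Oz).
- by congr (gen_L K F _ z); apply/funext => z'; rewrite corr_on_seq.
- rewrite gain_sumE -ge0_fin_numE ?(dominated_fin hp Oz)//.
  by have /andP[] := hp.2 _ Oz.
- rewrite lost_sumE -ge0_fin_numE ?(dominated_fin hm Oz)//.
  by have /andP[] := hm.2 _ Oz.
Qed.

End weak.

Lemma corr_family_weak_solution : weak_solution K F corr_family.
Proof.
move=> t [//|n] f t0 _ tf lebesgue'; rewrite {}/lebesgue'.
have tge0 := ltW t0.
have [mf f0 _ _] := tf.
transitivity
  (2^-1%:E * (\sum_(l < n.+1) Is t (corr_sum (pair_weight K l l.+1
       (fun z : n.+2.-tuple R => f (coag l z))))) -
   2^-1%:E * (\sum_(l < n.+1) Is t (corr_sum (frag_weight l F (fun z _ => f z)))) -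
   (\sum_(l < n.+1) Is t (corr_sum (pair_weight K l l.+1
       (fun z : n.+2.-tuple R => f (drop_coord n.+1 l.+1 z))))) +
   (\sum_(l < n.+1) Is t (corr_sum (frag_weight l F
       (fun z y => f (replace_coord l y z))))) -
   (\sum_(l < n.+1) \sum_(m < n.+1 | (l < m)%N)
       Is t (corr_sum (pair_weight K l m f))) +
   (\sum_(l < n.+1) \sum_(m < n.+1 | (l < m)%N) Is t (corr_sum (frag_weight l F
       (fun (z : n.-tuple R) y => f (@frag R n.+1 l m y z))))))%E; last first.
  have empty (X : 'I_n.+1 -> 'I_n.+1 -> \bar R) : (2 <= n.+1)%N = false ->
      (\sum_(l < n.+1) \sum_(m < n.+1 | (l < m)%N) X l m = 0)%E.
    by move=> n0; rewrite big1// => l _; rewrite big1// => m; have := ltn_ord m; lia.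
  apply: f_equal2; last first.
    case: (boolP (2 <= n.+1)%N) => [n2|/negbTE n2]; last exact: empty.
    apply: eq_bigr => l _; apply: eq_bigr => m lm.
    have mn := ltn_ord m; have ln : (l < n)%N by lia.
    have lmn : (l < m < n.+1)%N by rewrite lm.
    rewrite (@time_integral_frag _ n _
      (fun (z : n.-tuple R) y => f (@frag R n.+1 l m y z)))//.
      exact: measurable_test_frag.
    by move=> z y zp yz; apply/f0/pos_frag.
  apply: f_equal2; last first; [congr (- _)%E|].
    case: (boolP (2 <= n.+1)%N) => [n2|/negbTE n2]; last exact: empty.
    by apply: eq_bigr => l _; apply: eq_bigr => m lm; rewrite time_integral_pair.
  apply: f_equal2; last first.
    apply: eq_bigr => l _.
    rewrite (@time_integral_frag _ _ _ (fun z y => f (replace_coord l y z)))//.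
      exact: measurable_test_replace.
    by move=> z y zp /andP[y0 _]; apply/f0/pos_replace_coord.
  apply: f_equal2; last first; [congr (- _)%E|].
    apply: eq_bigr => l _; rewrite time_integral_pair//.
    - by rewrite ltnS ltnW.
    - by rewrite ltnS.
    - exact: measurable_test_drop.
    - by move=> z zp; apply/f0/pos_drop_coord.
  apply: f_equal2; last first; [congr (- _)%E|]; congr (_ * _)%E.
    apply: eq_bigr => l _; rewrite (@time_integral_frag _ _ _ (fun z _ => f z))//.
      exact: measurable_test_fst.
    by move=> z y zp _; exact: f0.
  apply: eq_bigr => l _; rewrite time_integral_pair//.
  - by rewrite ltnS ltnW.
  - by rewrite ltnS.
  - exact: measurable_test_coag.
  - by move=> z zp; apply/f0/pos_coag.
have mfE : measurable_fun (pos n.+1) (fun z => (f z)%:E) by exact/measurable_EFinP.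
have f0E z : pos n.+1 z -> (0 <= (f z)%:E)%E by move=> zp; rewrite lee_fin f0.
rewrite !integral_corr_family//.
have fin_sum (c : pred 'I_n.+1) (X : 'I_n.+1 -> \bar R) :
    (forall i, c i -> X i \is a fin_num) -> (\sum_(i < n.+1 | c i) X i)%E \is a fin_num.
  move=> Xf; apply: (big_ind (fun x : \bar R => x \is a fin_num)) => // x y xf yf.
  by rewrite fin_numD xf.
have If Psi : dom Psi -> Is t Psi \is a fin_num.
  exact: (time_integral_fin KF evZ moments tge0).
have G s : 0 <= s -> (\int[P]_w corr_sum (fun z => (f z)%:E) (Z s w))%E \is a fin_num.
  by have [D [p dP]] := dom_test tf; exact: (expectation_fin KF evZ moments dP).
have fS : (\sum_(l < n.+1) \sum_(m < n.+1 | (l < m)%N) Is t (corr_sum (frag_weight l F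
     (fun (z : n.-tuple R) y => f (@frag R n.+1 l m y z)))))%E \is a fin_num.
  apply: (fin_sum) => l _; apply: (fin_sum) => m lm; apply: (If).
  by apply: (dom_split_weight tf KF); rewrite lm/=.
have fP : (\sum_(l < n.+1) \sum_(m < n.+1 | (l < m)%N)
    Is t (corr_sum (pair_weight K l m f)))%E \is a fin_num.
  apply: (fin_sum) => l _; apply: (fin_sum) => m lm; apply: (If).
  apply: (dom_both_weight tf (rk_lambda KF) (rk_C KF) (rkK_ge0 KF) (rkK_le KF) (rkK_mes KF)).
  by rewrite lm/=.
have fR : (\sum_(l < n.+1) Is t (corr_sum (frag_weight l F
    (fun z y => f (replace_coord l y z)))))%E \is a fin_num.
  by apply: (fin_sum) => l _; apply: (If); exact: (dom_replace_weight tf KF).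
have fD : (\sum_(l < n.+1) Is t (corr_sum (pair_weight K l l.+1
    (fun z : n.+2.-tuple R => f (drop_coord n.+1 l.+1 z)))))%E \is a fin_num.
  apply: (fin_sum) => l _; apply: (If).
  exact: (dom_drop_weight tf (rk_lambda KF) (rk_C KF) (rkK_ge0 KF) (rkK_le KF) (rkK_mes KF)).
have fL : (\sum_(l < n.+1) Is t (corr_sum (frag_weight l F (fun z _ => f z))))%E
    \is a fin_num.
  by apply: (fin_sum) => l _; apply: (If); exact: (dom_loss_weight tf KF).
have fC : (\sum_(l < n.+1) Is t (corr_sum (pair_weight K l l.+1
    (fun z : n.+2.-tuple R => f (coag l z)))))%E \is a fin_num.
  apply: (fin_sum) => l _; apply: (If).
  exact: (dom_coag_weight tf (rk_lambda KF) (rk_C KF) (rkK_ge0 KF) (rkK_le KF) (rkK_mes KF)).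
have G1 := G _ tge0; have G0 := G _ (lexx 0).
exact (balance_difference G1 G0 fC fR fS fL fD fP (weak_corr_balance tf t0)).
Qed.

End hierarchy.

(** * Unit mass *)

Section simplex.
Context {R : realType}.
Notation lebesgue := (@lebesgue_measure R).

Lemma measurable_simplex2 : measurable (@simplex2 R).
Proof.
have -> : @simplex2 R = @quadrant R `&` (fun p : R * R => p.1 + p.2) @^-1` `]-oo, 1].
  apply/seteqP; split => [p [p1 p2 p3]|p [[p1 p2] p3]].
    by split => //=; rewrite in_itv.
  by split => //; move: p3; rewrite /= in_itv.
have mD : measurable_fun (@quadrant R) (fun p : R * R => p.1 + p.2).
  by apply: measurable_funD; apply: measurable_funTS.
by apply: mD => //; exact: measurable_quadrant.
Qed.

Lemma measurable_ext_simplex2 (Q : R -> R -> R) : bounded_rate Q ->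
  measurable_fun setT (fun p : R * R => ext_simplex2 Q p.1 p.2).
Proof.
move=> [_ _ mQ _].
have mr := (measurable_restrictT (fun p : R * R => Q p.1 p.2) measurable_simplex2).1 mQ.
apply: eq_measurable_fun mr => p _; rewrite patchE /ext_simplex2.
case: (boolP [&& 0 < p.1, 0 < p.2 & p.1 + p.2 <= 1]) => [/and3P[p1 p2 p3]|np].
  by rewrite mem_set.
by rewrite memNset// => -[p1 p2 p3]; move: np; rewrite p1 p2 p3.
Qed.

Lemma ext_simplex2_bound (Q : R -> R -> R) : bounded_rate Q ->
  exists2 M : R, 0 <= M & forall x y, 0 <= ext_simplex2 Q x y <= M.
Proof.
move=> [Q0 _ _ [M QM]]; exists `|M| => // x y; rewrite /ext_simplex2.
case: (boolP [&& 0 < x, 0 < y & x + y <= 1]) => [/and3P[x0 y0 xy]|_]; last by rewrite lexx /=.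
by rewrite Q0//= (le_trans (QM _ _ _))// ler_norm.
Qed.

Lemma ext_simplex2_sym (Q : R -> R -> R) x y : bounded_rate Q ->
  ext_simplex2 Q x y = ext_simplex2 Q y x.
Proof.
move=> [_ Qs _ _]; rewrite /ext_simplex2 [y + x]addrC.
case: (boolP (0 < x)) => x0; case: (boolP (0 < y)) => y0 //=.
by case: ifP => // xy; exact: Qs.
Qed.

Lemma bounded_rate_kernels (Qhat Qcheck : R -> R -> R) :
  bounded_rate Qhat -> bounded_rate Qcheck ->
  exists C, rate_kernels 0 C (coag_kernel (ext_simplex2 Qhat))
    (frag_kernel (ext_simplex2 Qcheck)).
Proof.
move=> bh bc; have [A A0 hA] := ext_simplex2_bound bh.
have [B B0 hB] := ext_simplex2_bound bc; exists (A + B).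
have Bx x : 0 < x -> forall y, 0 < y < x ->
    frag_kernel (ext_simplex2 Qcheck) y (x - y) <= x * (A + B).
  move=> x0 y /andP[y0 yx]; rewrite /frag_kernel addrC subrK.
  have /andP[_ hM] := hB y (x - y).
  by rewrite ler_wpM2l ?(ltW x0)// (le_trans hM)// lerDr.
have mF : measurable_fun (@quadrant R)
    (fun p : R * R => frag_kernel (ext_simplex2 Qcheck) p.1 p.2).
  apply: measurable_funM.
    by apply: measurable_funD; apply: measurable_funTS.
  by apply: measurable_funTS; exact: measurable_ext_simplex2.
split => //.
- exact: addr_ge0.
- move=> x y x0 y0; have /andP[h0 _] := hA x y.
  by rewrite /coag_kernel !mulr_ge0// ltW.
- by move=> x y _ _; rewrite /coag_kernel (ext_simplex2_sym x y bh) [x * y]mulrC.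
- move=> x y x0 y0; rewrite powRr0 mulr1 /coag_kernel mulrC ler_wpM2r ?mulr_ge0 ?(ltW x0) ?(ltW y0)//.
  by have /andP[_ hM] := hA x y; rewrite (le_trans hM)// lerDl.
- apply: measurable_funM.
    by apply: measurable_funM; apply: measurable_funTS.
  by apply: measurable_funTS; exact: measurable_ext_simplex2.
- move=> x y x0 y0; have /andP[h0 _] := hB x y.
  by rewrite /frag_kernel mulr_ge0// addr_ge0// ltW.
- by move=> x y _ _; rewrite /frag_kernel (ext_simplex2_sym x y bc) [x + y]addrC.
- move=> x x0.
  apply: (@le_trans _ _ (\int[lebesgue]_(y in `]0%R, x[) (x * (A + B))%:E)%E).
    apply: ge0_le_integral => //.
    + move=> y; rewrite /= in_itv/= => /andP[y0 yx].
      have /andP[h0 _] := hB y (x - y).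
      by rewrite lee_fin /frag_kernel mulr_ge0// addr_ge0 ?subr_ge0// ltW.
    + apply/measurable_EFinP.
      apply: (@measurable_comp_on _ _ _ _ _ _ (@quadrant R)
        (fun p : R * R => frag_kernel (ext_simplex2 Qcheck) p.1 p.2) _
        (fun y : R => (y, x - y))) => //.
      * exact: measurable_quadrant.
      * by move=> y /=; rewrite in_itv/= => /andP[y0 yx]; split => //=; rewrite subr_gt0.
      * by apply: measurable_fun_pair_on => //; exact: measurable_funB.
    + by move=> y; rewrite /= in_itv/= => yx; rewrite lee_fin Bx.
  rewrite integral_cst//= lebesgue_measure_itv/= lte_fin x0 -EFinB -EFinM lee_fin.
  by rewrite (addr0 (2 : R)) powR_mulrn ?(ltW x0)// expr2 subr0 mulrAC mulrC.
Qed.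

Lemma Rintegral_rescale (x : R) (f : R -> R) : 0 < x ->
  lebesgue.-integrable `]0, x[ (fun y => (f y)%:E) ->
  \int[lebesgue]_(y in `]0, x[) f y = x * \int[lebesgue]_(u in `]0, 1[) f (u * x).
Proof.
move=> x0 fi; have mf : measurable_fun `]0, x[ (fun y => (f y)%:E) by exact: measurable_int fi.
rewrite /Rintegral integralE [in RHS]integralE.
have resc (g : R -> \bar R) : measurable_fun `]0, x[ g ->
    (forall y, 0 <= g y)%E -> (\int[lebesgue]_(y in `]0%R, x[) g y =
     x%:E * \int[lebesgue]_(u in `]0%R, 1%R[) g (u * x)%R)%E.
  by move=> mg g0; apply: ge0_integral_rescale => // y _.
have p0 y : (0 <= (EFin \o f)^\+ y)%E by rewrite funepos_ge0.
have n0 y : (0 <= (EFin \o f)^\- y)%E by rewrite funeneg_ge0.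
have Ep := resc _ (measurable_funepos mf) p0.
have En := resc _ (measurable_funeneg mf) n0.
have pf : (\int[lebesgue]_(y in `]0%R, x[) (fun y => (f y)%:E)^\+ y)%E \is a fin_num.
  exact: integrable_pos_fin_num.
have nf : (\int[lebesgue]_(y in `]0%R, x[) (fun y => (f y)%:E)^\- y)%E \is a fin_num.
  exact: integrable_neg_fin_num.
rewrite fineB// Ep En.
have fin (a : \bar R) : (0 <= a -> x%:E * a \is a fin_num -> a \is a fin_num)%E.
  by case: a => // _; rewrite gt0_muley ?lte_fin.
have p1 : (\int[lebesgue]_(u in `]0%R, 1%R[) (EFin \o f)^\+ (u * x)%R)%E \is a fin_num.
  by apply: fin; [exact: integral_ge0|rewrite -Ep].
have n1 : (\int[lebesgue]_(u in `]0%R, 1%R[) (EFin \o f)^\- (u * x)%R)%E \is a fin_num.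
  by apply: fin; [exact: integral_ge0|rewrite -En].
rewrite !fineM// -mulrBr -fineB//; congr (_ * fine (_ - _)%E).
  by apply: eq_integral => u _; rewrite !funeposE.
by apply: eq_integral => u _; rewrite !funenegE.
Qed.

End simplex.

Section unit_mass.
Context {R : realType}.
Notation lebesgue := (@lebesgue_measure R).
Variables (C : R) (K F : R -> R -> R).
Hypothesis KF : rate_kernels 0 C K F.

Lemma gen_L1_ext (Phi Psi : mseq R -> R) (x : mseq R) : Omega1 x ->
  (forall z, Omega1 z -> Phi z = Psi z) -> gen_L1 K F Phi x = gen_L1 K F Psi x.
Proof.
move=> [Ox mx] E; have Ex : Phi x = Psi x by exact: E.
congr (_ * _ + _ * _).
  congr (limn (series _)); apply/funext => i; congr (limn (series _)).
  apply/funext => j; case: (boolP ((i != j) && _)) => // /andP[ij _].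
  by have [Om mm] := merge_at_Omega ij Ox; rewrite Ex E//; split => //=; rewrite mm.
congr (limn (series _)); apply/funext => i; case: (boolP (0 < x i)) => // xi.
congr (_ * _); apply: eq_Rintegral => u /set_mem; rewrite /= in_itv/= => /andP[u0 u1].
have ux : 0 < u * x i < x i by rewrite mulr_gt0//= gtr_pMl.
by have [Om mm] := split_at_Omega ux Ox; rewrite Ex E//; split => //=; rewrite mm.
Qed.

Lemma gen_L1_L (Phi : mseq R -> R) b (x : mseq R) : Omega1 x -> tame Phi b ->
  gen_L1 K F Phi x = gen_L K F Phi x.
Proof.
move=> [Ox mx] [mPhi bPhi]; congr (_ + _ * _); congr (limn (series _)).
apply/funext => i; case: (boolP (0 < x i)) => // xi.
rewrite [RHS](Rintegral_rescale xi (frag_integrable KF mPhi bPhi Ox xi)).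
congr (_ * _); apply: eq_Rintegral => u _; rewrite /frag_integrand.
by rewrite (_ : (1 - u) * x i = x i - u * x i)//; lra.
Qed.

Lemma iter_gen_L1 (Phi : mseq R -> R) b m (x : mseq R) : Omega1 x -> tame Phi b ->
  iter m (gen_L1 K F) Phi x = iter m (gen_L K F) Phi x.
Proof.
move=> + tPhi; elim: m x => [//|m IH] x Ox; rewrite !iterS.
rewrite (gen_L1_ext Ox IH); exact: gen_L1_L (tame_iter KF m tPhi).
Qed.

Context d (T : measurableType d) (P : probability T R).
Variable X : R -> T -> mseq R.
Hypothesis mjX : markov_jump_process P (@Omega1 R) (gen_L1 K F) X.

Lemma unit_mass_evolves : evolves K F P X.
Proof.
have [mX OX _ markov] := mjX; split => //; first by move=> t w t0; have [] := OX t w t0.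
move=> t N M Phi t0 cP; have [mP bP _] := cP.
have bb : bounded_borel (@Omega1 R) Phi.
  split; first by apply: measurable_funS measurable_Omega _ mP => z [].
  by exists M => z [Oz _]; exact: bP.
have h0 : history X 0 setT.
  have [e0 eC _] := @smallest_sigma_algebra _ setT
    (\bigcup_(u in `[0, 0]) preimage_set_system setT (X u) measurable).
  by rewrite -(setD0 setT); exact: eC.
have := markov 0 t Phi setT (lexx 0) t0 bb h0; rewrite add0r => ->.
apply: eq_integral => w _; congr (_%:E); congr (limn (series _)).
apply/funext => m; congr (_ * _); apply: (iter_gen_L1 _ _ (cut_off_tame cP)).
exact: OX.
Qed.

Lemma unit_mass_moments p : (\int[P]_w ((1 + mass (X 0 w)) ^+ p)%:E < +oo)%E.
Proof.
have [_ OX _ _] := mjX.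
rewrite (eq_integral (fun=> (2 ^+ p)%:E)); last first.
  by move=> w _; have [_ ->] := OX 0 w (lexx 0).
by rewrite probability_ge0_cst ltry.
Qed.

End unit_mass.

(** * The time change by a power of the mass *)

Section random_time.
Context {R : realType} d (T : measurableType d) (P : probability T R).
Variable tau : T -> R.
Hypotheses (tau0 : forall w, 0 <= tau w) (mtau : measurable_fun setT tau).

(* Strictly later than [tau], so that the right-continuity of the paths applies. *)
Definition grid_time n w : R := (Num.trunc (n.+1%:R * tau w)).+1%:R / n.+1%:R.

Definition grid_cell n j : set T :=
  [set w | j%:R <= n.+1%:R * tau w < j.+1%:R].

Lemma grid_time_bounds n w : tau w < grid_time n w <= tau w + n.+1%:R^-1.
Proof.
have n0 : 0 < n.+1%:R :> R by rewrite ltr0n.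
have u0 : 0 <= n.+1%:R * tau w by rewrite mulr_ge0.
have /andP[u1 u2] := truncn_itv u0.
rewrite /grid_time ltr_pdivlMr// mulrC u2/= ler_pdivrMr// mulrDl mulVf ?gt_eqF//.
by rewrite -[leLHS]natr1 lerD2r [leRHS]mulrC.
Qed.

Lemma grid_time_ge0 n w : 0 <= grid_time n w.
Proof. by rewrite mulr_ge0 ?invr_ge0. Qed.

Lemma grid_time_cvg w : grid_time n w @[n --> \oo] --> tau w.
Proof.
apply: (@squeeze_cvgr _ _ _ _ (fun=> tau w) (fun n => tau w + n.+1%:R^-1)).
- by apply: nearW => n; have /andP[/ltW -> ->] := grid_time_bounds n w.
- exact: cvg_cst.
- rewrite -[X in _ --> X]addr0; apply: cvgD; first exact: cvg_cst.
  exact: cvg_harmonic.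
Qed.

Lemma grid_time_cell n j w : grid_cell n j w -> grid_time n w = j.+1%:R / n.+1%:R.
Proof. by move=> /truncn_def; rewrite /grid_time => ->. Qed.

Lemma cover_grid_cell n : \bigcup_j grid_cell n j = setT.
Proof.
apply/seteqP; split => // w _; exists (Num.trunc (n.+1%:R * tau w)) => //.
by apply: truncn_itv; rewrite mulr_ge0.
Qed.

Lemma trivIset_grid_cell n : trivIset setT (grid_cell n).
Proof. by move=> i j _ _ [w [/truncn_def <- /truncn_def <-]]. Qed.

Lemma measurable_grid_cell n j : measurable (grid_cell n j).
Proof.
have mt : measurable_fun setT (fun w => n.+1%:R * tau w) by exact: measurable_funM.
rewrite [X in measurable X](_ : _ =
  setT `&` (fun w => n.+1%:R * tau w) @^-1` `[j%:R, j.+1%:R[).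
  by apply: mt => //; exact: measurable_itv.
by rewrite setTI; apply/seteqP; split => w /=; rewrite in_itv.
Qed.

Lemma measurable_grid (g : R -> T -> R) n :
  (forall s, 0 <= s -> measurable_fun setT (g s)) ->
  measurable_fun setT (fun w => g (grid_time n w) w).
Proof.
move=> mg _ B mB; rewrite setTI.
rewrite [X in measurable X](_ : _ = \bigcup_j
  (grid_cell n j `&` g (j.+1%:R / n.+1%:R) @^-1` B)).
  apply: bigcup_measurable => j _; apply: measurableI.
    exact: measurable_grid_cell.
  by rewrite -[X in measurable X]setTI; apply: mg => //; rewrite mulr_ge0 ?invr_ge0.
apply/seteqP; split => [w wB|w [j _ [wj wB]]]; last first.
  by rewrite /preimage/= (grid_time_cell wj).
have : (\bigcup_j grid_cell n j) w by rewrite cover_grid_cell.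
by move=> [j _ wj]; exists j => //; split => //; rewrite /preimage/= -(grid_time_cell wj).
Qed.

Lemma measurable_random_time (g : R -> T -> R) :
  (forall s, 0 <= s -> measurable_fun setT (g s)) ->
  (forall w, g (grid_time n w) w @[n --> \oo] --> g (tau w) w) ->
  measurable_fun setT (fun w => g (tau w) w).
Proof.
move=> mg cg; apply: (@measurable_fun_cvg _ _ _ _ (fun n w => g (grid_time n w) w)) => //.
by move=> n; exact: measurable_grid.
Qed.

Lemma bounded_grid_integrable (g : R -> T -> R) B n :
  (forall s, 0 <= s -> measurable_fun setT (g s)) ->
  (forall w, `|g (grid_time n w) w| <= B) ->
  P.-integrable setT (fun w => (g (grid_time n w) w)%:E).
Proof.
move=> mg gB; apply: measurable_bounded_integrable => //.
- by rewrite (le_lt_trans (probability_le1 P _))// ltry.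
- exact: measurable_grid.
- exists B; split; first by rewrite num_real.
  by move=> x Bx w _; exact: le_trans (ltW Bx).
Qed.

Lemma integral_grid (g : R -> T -> R) B n :
  (forall s, 0 <= s -> measurable_fun setT (g s)) ->
  (forall w, `|g (grid_time n w) w| <= B) ->
  (\int[P]_w (g (grid_time n w) w)%:E =
   \sum_(0 <= j <oo) \int[P]_(w in grid_cell n j) (g (j.+1%:R / n.+1%:R) w)%:E)%E.
Proof.
move=> mg gB; rewrite -(cover_grid_cell n) integral_bigcup.
- apply: eq_eseriesr => j _; apply: eq_integral => w /set_mem wj.
  by rewrite (grid_time_cell wj).
- exact: trivIset_grid_cell.
- exact: measurable_grid_cell.
- by rewrite cover_grid_cell; exact: bounded_grid_integrable gB.
Qed.

Lemma integral_random_time (g : R -> T -> R) B :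
  (forall s, 0 <= s -> measurable_fun setT (g s)) ->
  (forall n w, `|g (grid_time n w) w| <= B) ->
  (forall w, g (grid_time n w) w @[n --> \oo] --> g (tau w) w) ->
  (\int[P]_w (g (grid_time n w) w)%:E @[n --> \oo] --> \int[P]_w (g (tau w) w)%:E)%E.
Proof.
move=> mg gB cg; apply: (@dominated_cvg _ _ _ P setT measurableT
    (fun n w => (g (grid_time n w) w)%:E) _ (fun=> B%:E)) => //.
- by move=> n; apply/measurable_EFinP; exact: measurable_grid.
- by move=> w _; apply: cvg_EFin; [exact: nearW|exact: cg].
- exact: finite_measure_integrable_cst.
- by move=> n w _; rewrite lee_fin.
Qed.

Lemma eq_integral_random_time (g h : R -> T -> R) B :
  (forall s, 0 <= s -> measurable_fun setT (g s)) ->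
  (forall s, 0 <= s -> measurable_fun setT (h s)) ->
  (forall n w, `|g (grid_time n w) w| <= B) ->
  (forall n w, `|h (grid_time n w) w| <= B) ->
  (forall w, g (grid_time n w) w @[n --> \oo] --> g (tau w) w) ->
  (forall w, h (grid_time n w) w @[n --> \oo] --> h (tau w) w) ->
  (forall n j s, 0 <= s -> (\int[P]_(w in grid_cell n j) (g s w)%:E =
     \int[P]_(w in grid_cell n j) (h s w)%:E)%E) ->
  (\int[P]_w (g (tau w) w)%:E = \int[P]_w (h (tau w) w)%:E)%E.
Proof.
move=> mg mh gB hB cg ch gh.
have G := integral_random_time mg gB cg; have H := integral_random_time mh hB ch.
rewrite -(cvg_lim _ G)// -(cvg_lim _ H)//; congr (limn _); apply/funext => n.
rewrite (integral_grid mg (gB n)) (integral_grid mh (hB n)).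
by apply: eq_eseriesr => j _; apply: gh; rewrite mulr_ge0 ?invr_ge0.
Qed.

End random_time.

Lemma step_path_cvg (R : realType) (x : R -> mseq R) (Phi : mseq R -> R) (s : R)
    (u : nat -> R) : step_path x -> 0 <= s -> (forall n, s < u n) ->
  u n @[n --> \oo] --> s -> Phi (x (u n)) @[n --> \oo] --> Phi (x s).
Proof.
move=> [tau [t0 _ tinf xE]] s0 su us.
have ex : exists k, s < tau k.
  have [k _ kP] : \forall k \near \oo, s < tau k.
    by apply: (cvgryPgt _).1 => //; exact: num_real.
  by exists k; apply: kP => /=.
have [[|k] sk kmin] := ex_minnP ex.
  by move: sk; rewrite t0 ltNge s0.
have ks : tau k <= s by rewrite leNgt; apply/negP => /kmin; rewrite ltnn.
apply: cvg_near_cst; near=> n.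
rewrite (xE k (u n)) ?(xE k s) ?ks//.
rewrite (le_trans ks (ltW (su n)))/=.
by near: n; apply: (cvgr_lt s).
Unshelve. all: by end_near. Qed.

Section time_change.
Context {R : realType}.
Variables (lambda C : R) (K F : R -> R -> R).
Hypothesis KF : rate_kernels lambda C K F.
Local Notation L := (gen_L K F).
Local Notation Lt := (gen_Ltilde lambda K F).

Lemma measurable_mass_powR (a : R) :
  measurable_fun (@Omega R) (fun z : mseq R => mass z `^ a).
Proof. by apply: (measurableT_comp (measurable_powR a)); exact: measurable_mass. Qed.

Lemma iter_Lt_bound N M Phi (z : mseq R) : cut_off N M Phi -> Omega z ->
  geometric_bound (2 * C) (if mass z <= N then M else 0) (fun n => iter n Lt Phi z).
Proof.
move=> cP Oz n; have tP := cut_off_tame cP; have m0 := mass_gt0 Oz.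
rewrite (iter_gen_Ltilde KF n tP Oz); case: ifPn => zN; last first.
  have [_ _ ->//] := cut_off_iter KF n cP; last by rewrite ltNge.
  by rewrite !mulr0 normr0.
have [_ bn] := tame_iter KF n tP.
rewrite normrM ger0_norm ?exprn_ge0 ?powR_ge0//.
apply: (@le_trans _ _ ((mass z `^ (- (2 + lambda))) ^+ n *
    (jump_rate lambda C (mass z) ^+ n * M))).
  by rewrite ler_wpM2l ?exprn_ge0 ?powR_ge0// bn.
rewrite mulrA -exprMn /jump_rate mulrCA powRN mulVf ?mulr1// gt_eqF//.
exact: powR_gt0.
Qed.

Lemma measurable_exp_Lt N M Phi s : cut_off N M Phi -> 0 <= M ->
  measurable_fun (@Omega R) (exp_op Lt s Phi).
Proof.
move=> cP M0; have tP := cut_off_tame cP.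
apply: (@measurable_series _ (fun n z => s ^+ n / n`!%:R * iter n Lt Phi z)).
  move=> n; apply: measurable_funM => //.
  apply: (@eq_measurable_fun _ _ _ _ _ (fun z =>
    (mass z `^ (- (2 + lambda))) ^+ n * iter n L Phi z)).
    by move=> z /set_mem Oz; rewrite (iter_gen_Ltilde KF n tP Oz).
  apply: measurable_funM; last by have [] := cut_off_iter KF n cP.
  by apply: measurable_funX; exact: measurable_mass_powR.
move=> z Oz; apply: (expser_cvg _ _ (iter_Lt_bound cP Oz)).
  by rewrite mulr_ge0 ?(rk_C KF).
by case: ifP.
Qed.

Lemma exp_Lt_rescale N M Phi t (z : mseq R) : cut_off N M Phi -> Omega z ->
  exp_op Lt (mass z `^ (2 + lambda) * t) Phi z = exp_op L t Phi z.
Proof.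
move=> cP Oz; congr (limn (series _)); apply/funext => n.
rewrite (iter_gen_Ltilde KF n (cut_off_tame cP) Oz) exprMn powRN exprVn.
have m0 : mass z `^ (2 + lambda) ^+ n != 0.
  by rewrite expf_neq0// gt_eqF// powR_gt0// mass_gt0.
rewrite -!mulrA mulrC -!mulrA; congr (_ * _); congr (_ * _).
by rewrite [X in _ * X]mulrC mulrA mulVf ?mul1r.
Qed.

Context d (T : measurableType d) (P : probability T R).
Variables Z Zt : R -> T -> mseq R.
Hypothesis mjZ : markov_jump_process P (@Omega R) Lt Zt.
Hypothesis ZE : forall t w, 0 <= t -> Z t w = Zt (mass (Zt 0 w) `^ (2 + lambda) * t) w.

Let mZt := let: And4 h _ _ _ := mjZ in h.
Let OZt := let: And4 _ h _ _ := mjZ in h.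
Let pathZt := let: And4 _ _ h _ := mjZ in h.
Let markov := let: And4 _ _ _ h := mjZ in h.

Section fixed_time.
Variable t : R.
Hypothesis t0 : 0 <= t.

Let tau w := mass (Zt 0 w) `^ (2 + lambda) * t.

Let tau0 w : 0 <= tau w. Proof. by rewrite mulr_ge0// powR_ge0. Qed.

Let mtau : measurable_fun setT tau.
Proof.
apply: measurable_funM => //.
apply: (measurable_comp_on measurable_Omega _ (measurable_mass_powR (2 + lambda))
  (mZt (lexx 0))).
by move=> w _; exact: OZt.
Qed.

Let grid_path_cvg (Phi : mseq R -> R) w :
  Phi (Zt (grid_time tau n w) w) @[n --> \oo] --> Phi (Zt (tau w) w).
Proof.
apply: (@step_path_cvg _ (Zt ^~ w) Phi (tau w) (fun n => grid_time tau n w)) => //.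
- by move=> n; have /andP[] := grid_time_bounds tau0 n w.
- exact: grid_time_cvg.
Qed.

Lemma measurable_time_change : measurable_fun setT (Z t).
Proof.
apply: measurable_mseq => i.
apply: (@eq_measurable_fun _ _ _ _ _ (fun w => Zt (tau w) w i)).
  by move=> w _; rewrite ZE.
apply: (measurable_random_time tau0 mtau (g := fun s w => Zt s w i)).
  move=> s s0; exact: (measurableT_comp (@measurable_coord R setT i) (mZt s0)).
by move=> w; exact: (@grid_path_cvg (fun z => z i : R) w).
Qed.

Let history_grid_cell n j : history Zt 0 (grid_cell tau n j).
Proof.
apply: sub_sigma_algebra; exists 0; first by rewrite /= in_itv/= lexx.
pose f (z : mseq R) := n.+1%:R * (mass z `^ (2 + lambda) * t).
have mf : measurable_fun (@Omega R) f.
  by apply: measurable_funM => //; apply: measurable_funM => //; exact: measurable_mass_powR.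
exists (@Omega R `&` f @^-1` `[j%:R, j.+1%:R[).
  by apply: mf; [exact: measurable_Omega|exact: measurable_itv].
rewrite setTI; apply/seteqP; split => w /=; first by move=> [_]; rewrite in_itv.
by move=> wj; split; [exact: OZt|rewrite in_itv].
Qed.

Lemma expectation_time_change N M Phi : cut_off N M Phi ->
  (\int[P]_w (Phi (Z t w))%:E = \int[P]_w (exp_op L t Phi (Z 0 w))%:E)%E.
Proof.
move=> cP; have [mP bP _] := cP.
have M0 : 0 <= M by exact: le_trans (bP _ (OZt point (lexx 0))).
have C0 := rk_C KF; have l0 := rk_lambda KF.
have l2 : 0 <= 2 + lambda by rewrite addr_ge0.
have Z0E w : Z 0 w = Zt 0 w by rewrite ZE// mulr0.
pose g s w := Phi (Zt s w); pose h s w := exp_op Lt s Phi (Zt 0 w).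
transitivity (\int[P]_w (g (tau w) w)%:E)%E.
  by apply: eq_integral => w _; rewrite ZE.
transitivity (\int[P]_w (h (tau w) w)%:E)%E; last first.
  apply: eq_integral => w _; rewrite Z0E; congr _%:E.
  exact: (exp_Lt_rescale t cP (OZt w (lexx 0))).
pose S := `|N| `^ (2 + lambda) * t + 1.
have S0 : 0 <= S by rewrite addr_ge0// mulr_ge0// powR_ge0.
have M1 : M <= M * expR (2 * C * S).
  by rewrite ler_peMr// -expR0 ler_expR !mulr_ge0.
apply: (@eq_integral_random_time _ _ _ P tau tau0 mtau g h (M * expR (2 * C * S))).
- move=> s s0; apply: (measurable_comp_on measurable_Omega _ mP (mZt s0)).
  by move=> w _; exact: OZt.
- move=> s s0; apply: (measurable_comp_on measurable_Omega _
    (measurable_exp_Lt s cP M0) (mZt (lexx 0))).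
  by move=> w _; exact: OZt.
- move=> n w; apply: le_trans M1; apply: bP; apply: OZt; exact: grid_time_ge0.
- move=> n w; have Ow := OZt w (lexx 0).
  have C20 : 0 <= 2 * C by rewrite mulr_ge0.
  have M'0 : 0 <= (if mass (Zt 0 w) <= N then M else 0) by case: ifP.
  have H := @expser_le _ _ _ C20 M'0 _ (grid_time tau n w) (iter_Lt_bound cP Ow).
  apply: (le_trans H); case: (boolP (mass (Zt 0 w) <= N)) => mN; last first.
    by rewrite mul0r mulr_ge0// expR_ge0.
  rewrite ler_wpM2l// ler_expR ler_wpM2l// ger0_norm ?grid_time_ge0//.
  have /andP[_ u] := grid_time_bounds tau0 n w; apply: (le_trans u).
  rewrite /S lerD//; last by rewrite invf_le1// ler1n.
  rewrite /tau ler_wpM2r// ge0_ler_powR ?nnegrE ?normr_ge0//.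
    by rewrite ltW// mass_gt0.
  exact: le_trans (ler_norm _).
- by move=> w; exact: grid_path_cvg.
- move=> w.
  have C20 : 0 <= 2 * C by rewrite mulr_ge0.
  have M'0 : 0 <= (if mass (Zt 0 w) <= N then M else 0) by case: ifP.
  have cc := continuous_expser C20 M'0 (iter_Lt_bound cP (OZt w (lexx 0))).
  have gc : grid_time tau n w @[n --> \oo] --> tau w by exact: grid_time_cvg.
  exact: (cvg_comp _ (expser (fun n => iter n Lt Phi (Zt 0 w))) gc (cc (tau w))).
- move=> n j s s0.
  have bb : bounded_borel (@Omega R) Phi by split => //; exists M.
  by have := markov (lexx 0) s0 bb (history_grid_cell n j); rewrite add0r.
Qed.

End fixed_time.

Lemma time_change_evolves : evolves K F P Z.
Proof.
split => [t t0|t w t0|t N M Phi t0 cP].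
- exact: measurable_time_change.
- by rewrite ZE//; apply: OZt; rewrite mulr_ge0// powR_ge0.
- exact: expectation_time_change cP.
Qed.

End time_change.

Section homogeneous_kernels.
Context {R : realType}.
Notation lebesgue := (@lebesgue_measure R).
Variables (lambda : R).
Hypothesis l0 : 0 <= lambda.

Lemma rate_function_diagonal (H : R -> R -> R) x y : rate_function lambda H ->
  0 < x -> 0 < y -> H x y = (x + y) `^ lambda * H (x / (x + y)) (1 - x / (x + y)).
Proof.
move=> [_ _ _ hom] x0 y0; have s0 : 0 < x + y by rewrite addr_gt0.
have E : 1 - x / (x + y) = y / (x + y).
  by rewrite -[1](@divff _ (x + y)) ?gt_eqF// -mulrBl addrAC subrr add0r.
rewrite E -hom ?divr_gt0//.
by rewrite !mulrA ![(x + y) * _]mulrC !mulfK ?gt_eqF.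
Qed.

Lemma coag_rate_bound (H : R -> R -> R) : coag_rate_function lambda H ->
  exists2 A : R, 0 <= A &
    forall x y, 0 < x -> 0 < y -> H x y <= A * (x + y) `^ lambda.
Proof.
move=> [rH ub /ltW sup0]; exists (sup [set H u (1 - u) | u in `]0, 1[ ]) => //.
move=> x y x0 y0; have s0 : 0 < x + y by rewrite addr_gt0.
rewrite (rate_function_diagonal rH)// mulrC ler_wpM2r ?powR_ge0//.
apply: ub_le_sup => //; exists (x / (x + y)) => //.
by rewrite /= in_itv/= divr_gt0//= ltr_pdivrMr// mul1r ltrDl.
Qed.

Lemma frag_rate_integral (H : R -> R -> R) x : rate_function lambda H -> 0 < x ->
  (\int[lebesgue]_(y in `]0%R, x[) (frag_kernel H y (x - y)%R)%:E =
   (x `^ (2 + lambda))%:E * \int[lebesgue]_(u in `]0%R, 1%R[) (H u (1 - u)%R)%:E)%E.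
Proof.
move=> [H0 Hs mH hom] x0.
have pos y : 0 < y < x -> 0 < y /\ 0 < x - y by move=> /andP[? ?]; rewrite subr_gt0.
have mS (a : R) : measurable_fun `]0, a[ (fun y => H y (a - y)).
  apply: (@measurable_comp_on _ _ _ _ _ _ (@quadrant R) (fun p : R * R => H p.1 p.2) _
    (fun y : R => (y, a - y))) => //.
  - exact: measurable_quadrant.
  - by move=> y /=; rewrite in_itv/= => /andP[y0 yx]; split => //=; rewrite subr_gt0.
  - by apply: measurable_fun_pair_on => //; exact: measurable_funB.
have kE y : frag_kernel H y (x - y) = x * H y (x - y).
  by rewrite /frag_kernel addrC subrK.
rewrite ge0_integral_rescale//.
- have -> : (\int[lebesgue]_(u in `]0%R, 1%R[) (frag_kernel H (u * x) (x - u * x)%R)%:E =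
      \int[lebesgue]_(u in `]0%R, 1%R[)
        ((x `^ (1 + lambda))%:E * (H u (1 - u)%R)%:E))%E.
    apply: eq_integral => u /set_mem; rewrite /= in_itv/= => /andP[u0 u1].
    rewrite -EFinM kE (_ : x - u * x = x * (1 - u)); last by lra.
    rewrite [u * x]mulrC hom ?subr_gt0// mulrA; congr (_ * _)%:E.
    by rewrite powRD ?powRr1 ?(ltW x0)//; apply/implyP => _; rewrite gt_eqF.
  rewrite ge0_integralZl_EFin ?powR_ge0//.
  + rewrite muleA -EFinM; congr (_%:E * _)%E.
    rewrite (_ : 2 + lambda = 1 + (1 + lambda)); last by lra.
    rewrite [in RHS]powRD ?powRr1 ?(ltW x0)//.
    by apply/implyP => _; rewrite gt_eqF.
  + by move=> u; rewrite /= in_itv/= => /andP[u0 u1]; rewrite lee_fin H0// subr_gt0.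
  + by apply/measurable_EFinP; exact: mS.
- apply/measurable_EFinP.
  apply: (@eq_measurable_fun _ _ _ _ _ (fun y => x * H y (x - y))).
    by move=> y _; rewrite kE.
  by apply: measurable_funM => //; exact: mS.
- by move=> y yx; have [? ?] := pos _ yx; rewrite lee_fin kE mulr_ge0 ?H0// ltW.
Qed.

Lemma homogeneous_rate_kernels (Hhat Hcheck : R -> R -> R) :
  coag_rate_function lambda Hhat -> frag_rate_function lambda Hcheck ->
  exists C, rate_kernels lambda C (coag_kernel Hhat) (frag_kernel Hcheck).
Proof.
move=> ch [rc cfin]; have [A A0 hA] := coag_rate_bound ch.
have [rh _ _] := ch; have [h0 hs mh hom] := rh; have [c0 cs mc _] := rc.
set B := (\int[lebesgue]_(u in _) _)%E in cfin; have /andP[B0 Bfin] := cfin.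
have Bn : B \is a fin_num by rewrite ge0_fin_numE// ltW.
have b0 : 0 <= fine B by apply: fine_ge0; exact: ltW.
have mD : measurable_fun (@quadrant R) (fun p : R * R => p.1 + p.2).
  by apply: measurable_funD; apply: measurable_funTS.
have mM : measurable_fun (@quadrant R) (fun p : R * R => p.1 * p.2).
  by apply: measurable_funM; apply: measurable_funTS.
exists (A + fine B); split => //.
- exact: addr_ge0.
- by move=> x y x0 y0; rewrite /coag_kernel !mulr_ge0 ?h0// ltW.
- by move=> x y x0 y0; rewrite /coag_kernel hs// [x * y]mulrC.
- move=> x y x0 y0; rewrite /coag_kernel.
  rewrite [leRHS](_ : _ = x * y * ((A + fine B) * (x + y) `^ lambda)); last by lra.
  rewrite ler_wpM2l ?mulr_ge0 ?(ltW x0) ?(ltW y0)// (le_trans (hA _ _ x0 y0))//.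
  by rewrite ler_wpM2r ?powR_ge0// lerDl.
- exact: measurable_funM.
- by move=> x y x0 y0; rewrite /frag_kernel mulr_ge0 ?c0// addr_ge0// ltW.
- by move=> x y x0 y0; rewrite /frag_kernel cs// [x + y]addrC.
- exact: measurable_funM.
- move=> x x0; rewrite frag_rate_integral// -/B -(fineK Bn) -EFinM lee_fin.
  by rewrite mulrC ler_wpM2r ?powR_ge0// lerDr.
Qed.

End homogeneous_kernels.

Lemma moments_shift (R : realType) d (T : measurableType d) (P : probability T R)
    (m : T -> R) p : measurable_fun setT m -> (forall w, 0 <= m w) ->
  (forall k, \int[P]_w (m w ^+ k)%:E < +oo)%E ->
  (\int[P]_w ((1 + m w) ^+ p)%:E < +oo)%E.
Proof.
move=> mm m0 fin.
have mp : measurable_fun setT (fun w => (m w ^+ p)%:E).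
  by apply/measurable_EFinP; exact: measurable_funX.
apply: (@le_lt_trans _ _ (\int[P]_w ((2 ^+ p)%:E * (1 + (m w ^+ p)%:E)))%E).
  apply: ge0_le_integral => //.
  - by move=> w _; rewrite lee_fin exprn_ge0// addr_ge0.
  - apply/measurable_EFinP; apply: measurable_funX; exact: measurable_funD.
  - by apply: emeasurable_funM => //; exact: emeasurable_funD.
  - move=> w _; rewrite -EFinD -EFinM lee_fin.
    case: (leP (m w) 1) => mw.
      apply: (@le_trans _ _ (2 ^+ p)); first by rewrite lerXn2r ?nnegrE ?addr_ge0//; lra.
      by rewrite ler_peMr ?exprn_ge0// lerDl exprn_ge0.
    apply: (@le_trans _ _ ((2 * m w) ^+ p)).
      by rewrite lerXn2r ?nnegrE ?addr_ge0 ?mulr_ge0//; lra.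
    by rewrite exprMn ler_wpM2l ?exprn_ge0// lerDr.
rewrite ge0_integralZl_EFin ?exprn_ge0//; last 2 first.
- by move=> w _; rewrite adde_ge0// lee_fin exprn_ge0.
- exact: emeasurable_funD.
rewrite ge0_integralD//; last by move=> w _; rewrite lee_fin exprn_ge0.
rewrite probability_ge0_cst lte_mul_pinfty// ?lee_fin ?exprn_ge0//.
by rewrite lte_add_pinfty// ltry.
Qed.

Theorem theorem3p2 (R : realType) :
  (forall (lambda : R) (Hhat Hcheck : R -> R -> R)
     (d : measure_display) (T : measurableType d) (P : probability T R)
     (Z : R -> T -> mseq R),
     0 <= lambda ->
     coag_rate_function lambda Hhat ->
     frag_rate_function lambda Hcheck ->
     generated_by_L P lambda (coag_kernel Hhat) (frag_kernel Hcheck) Z ->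
     (forall k : nat, (\int[P]_w (mass (Z 0%R w) ^+ k)%:E < +oo)%E) ->
     exists r : measure_family R,
       [/\ forall (t : R) (k : nat), 0 <= t -> (0 < k)%N ->
             is_correlation_measure P (Z t) (r t k),
           admissible lambda r &
           weak_solution (coag_kernel Hhat) (frag_kernel Hcheck) r]) /\
  (forall (Qhat Qcheck : R -> R -> R)
     (d : measure_display) (T : measurableType d) (P : probability T R)
     (X : R -> T -> mseq R),
     bounded_rate Qhat ->
     bounded_rate Qcheck ->
     let K1 := coag_kernel (ext_simplex2 Qhat) in
     let F1 := frag_kernel (ext_simplex2 Qcheck) in
     markov_jump_process P (@Omega1 R) (gen_L1 K1 F1) X ->
     exists q : measure_family R,
       [/\ forall (t : R) (k : nat), 0 <= t -> (0 < k)%N ->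
             is_correlation_measure P (X t) (q t k),
           admissible 0 q &
           weak_solution K1 F1 q]).
Proof.
split=> [lambda Hhat Hcheck d T P Z l0 ch fh [Zt [mjZ ZE]] mZ|
    Qhat Qcheck d T P X bh bc K1 F1 mjX].
- have [C KF] := homogeneous_rate_kernels l0 ch fh.
  have evZ := time_change_evolves KF mjZ ZE.
  have [mesZ OZ _] := evZ.
  have moments p : (\int[P]_w ((1 + mass (Z 0 w)) ^+ p)%:E < +oo)%E.
    apply: (@moments_shift _ _ _ P (fun w => mass (Z 0 w))) => //.
    + exact: (measurable_comp_Z evZ (lexx 0) (@measurable_mass R)).
    + by move=> w; apply/ltW/mass_gt0/OZ.
  exists (corr_family evZ); split.
  + by move=> t k t0 _; exact: corr_familyP.
  + exact: (corr_family_admissible KF).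
  + exact: (corr_family_weak_solution KF).
- have [C KF] := bounded_rate_kernels bh bc.
  have evX := unit_mass_evolves KF mjX.
  have moments := unit_mass_moments mjX.
  exists (corr_family evX); split.
  + by move=> t k t0 _; exact: corr_familyP.
  + exact: (corr_family_admissible KF).
  + exact: (corr_family_weak_solution KF).
Qed.
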